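(* Let $r\in\mathbb{N}$, $m\in\mathbb{N}_0$ and $a\in(l_0(\mathbb{Z}))^{r\times r}$ be such that $1$ is a simple eigenvalue of $\widehat{a}(0)$ and $2^k$ is not an eigenvalue of $\widehat{a}(0)$ for every $k\in\mathbb{N}$. Let $\phi$ be a vector of compactly supported distributions satisfying $\widehat{\phi}(2\xi)=\widehat{a}(\xi)\widehat{\phi}(\xi)$ and $\widehat{\phi}(0)\neq0$. Then the Lagrange subdivision scheme with mask $a$ is convergent with limiting functions in $C^m(\mathbb{R})$ if and only if $\operatorname{sm}_\infty(a)>0$ and $\operatorname{sm}_\infty(\phi)>m$.
   Context: Notation. $\mathbb{N}_0=\mathbb{N}\cup\{0\}$. $(l(\mathbb{Z}))^{s\times r}$ is the space of all sequences $\mathbb{Z}\to\mathbb{C}^{s\times r}$, and $(l_0(\mathbb{Z}))^{s\times r}$ its subspace of finitely supported sequences; $(l_0(\mathbb{Z}))^r:=(l_0(\mathbb{Z}))^{r\times1}$; $\|\cdot\|_{(l_\infty(\mathbb{Z}))^r}$ is the sup norm. $\boldsymbol{\delta}$ is the Dirac sequence ($\boldsymbol{\delta}(0)=1$, $\boldsymbol{\delta}(k)=0$ for $k\neq0$); $I_r$ is the identity matrix; $e_\ell$ is the $\ell$-th unit coordinate column vector in $\mathbb{R}^r$. Convolution: $[u*v](j)=\sum_{k}u(j-k)v(k)$. Symbol: $\widehat{u}(\xi):=\sum_{k\in\mathbb{Z}}u(k)e^{-ik\xi}$. Fourier transform: $\widehat{f}(\xi)=\int_{\mathbb{R}}f(x)e^{-ix\xi}dx$,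 extended to tempered distributions. $\widehat f(\xi)=\widehat g(\xi)+O(|\xi|^{k})$, $\xi\to0$, means $\widehat f^{(j)}(0)=\widehat g^{(j)}(0)$ for $j=0,\dots,k-1$. Subdivision operator: $(\mathcal{S}_av)(j):=2\sum_{k\in\mathbb{Z}}v(k)a(j-2k)$ for $v\in(l(\mathbb{Z}))^{s\times r}$, $j\in\mathbb{Z}$. Lagrange subdivision scheme: the Lagrange subdivision scheme with mask $a$ is convergent with limiting functions in $C^m(\mathbb{R})$ if for any $w_0\in(l(\mathbb{Z}))^{1\times r}$ there exist functions $\eta_1,\ldots,\eta_r\in C^m(\mathbb{R})$ ($m$ times continuously differentiable) such that for every constant $K>0$, $\lim_{n\to\infty}\sup_{k\in\mathbb{Z}\cap[-2^nK,2^nK]}|(\mathcal{S}_a^nw_0)(k)e_\ell-\eta_\ell(2^{-n}k)|=0$ for $\ell=1,\ldots,r$. Quantity $\operatorname{sm}_\infty(a)$: $a$ has order $k$ sum rules with a matching filter $v\in(l_0(\mathbb{Z}))^{1\times r}$ if $\widehat{v}(0)\neq0$, $\widehat{v}(2\xi)\widehat{a}(\xi)=\widehat{v}(\xi)+O(|\xi|^{k})$ and $\widehat{v}(2\xi)\widehat{a}(\xi+\pi)=O(|\xi|^{k})$ as $\xi\to0$. Let $\operatorname{sr}(a)$ be the largest $k\in\mathbb{N}_0$ such that $a$ has order $k$ sum rules with some matching filter, and let $v$ be such a filter for $k=\operatorname{sr}(a)$. With $\mathscr{V}_{j-1,v}:=\{u\in(l_0(\mathbb{Z}))^r:\widehat{v}(\xi)\widehat{u}(\xi)=O(|\xi|^{j}),\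 \xi\to0\}$ (so $\mathscr{V}_{-1,v}=(l_0(\mathbb{Z}))^r$), put $\rho_j(a,v)_\infty:=\sup\{\limsup_{n\to\infty}\|(\mathcal{S}_a^n(\boldsymbol{\delta}I_r))*u\|_{(l_\infty(\mathbb{Z}))^r}^{1/n}:u\in\mathscr{V}_{j-1,v}\}$ and $\operatorname{sm}_\infty(a):=-\log_2\rho_{\operatorname{sr}(a)}(a,v)_\infty$ (the value does not depend on the choice of $v$). Smoothness exponent of a function: for $f\in L_\infty(\mathbb{R})$, $\operatorname{sm}_\infty(f)$ is the supremum of $n+\tau$ with $n\in\mathbb{N}_0$, $0\le\tau<1$ such that $f\in W^n_\infty(\mathbb{R})$ (i.e. $f,\dots,f^{(n-1)}$ are absolutely continuous functions in $L_\infty(\mathbb{R})$ and $f^{(n)}\in L_\infty(\mathbb{R})$) and $f^{(n)}\in\operatorname{Lip}(\tau,L_\infty)$, meaning there is $C>0$ with $\|f^{(n)}-f^{(n)}(\cdot-t)\|_{L_\infty(\mathbb{R})}\le C|t|^\tau$ for all $t\in\mathbb{R}$. For a vector $\phi=[\phi_1,\dots,\phi_r]^{\mathsf T}$, $\operatorname{sm}_\infty(\phi):=\min_\ell\operatorname{sm}_\infty(\phi_\ell)$; the condition $\operatorname{sm}_\infty(\phi)>m$ includes that every entry of $\phi$ is in $L_\infty(\mathbb{R})$. *)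

(* Defs.v *)
From HB Require Import structures.
From mathcomp Require Import all_boot all_order all_algebra.
From mathcomp Require Import all_classical all_reals all_analysis.
From mathcomp.real_closed Require Import complex.

Set Implicit Arguments.
Unset Strict Implicit.
Unset Printing Implicit Defensive.

Import Order.TTheory GRing.Theory Num.Theory.
Import numFieldNormedType.Exports.
Import ComplexField.Normc.

Local Open Scope classical_set_scope.
Local Open Scope complex_scope.
Local Open Scope ring_scope.

Section ComplexFunctions.
Context {R : realType}.
Implicit Types (f g h : R -> R[i]).

Definition cis (x : R) : R[i] := cos x +i* sin x.

Definition re f : R -> R := fun x => complex.Re (f x).
Definition im f : R -> R := fun x => complex.Im (f x).

Definition cderiven (j : nat) f : R -> R[i] :=
  fun x => derive1n j (re f) x +i* derive1n j (im f) x.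

Definition realCk (m : nat) (g : R -> R) : Prop :=
  (forall j x, (j < m)%N -> derivable (derive1n j g) x 1) /\
  continuous (derive1n m g).

Definition Ck (m : nat) f : Prop := realCk m (re f) /\ realCk m (im f).

Definition smooth f : Prop := forall m, Ck m f.

(* f(xi) = g(xi) + O(|xi|^k) as xi -> 0, for smooth matrix-valued f, g:
   equality of the derivatives of order < k at 0. *)
Definition eq_O (s r : nat) (k : nat) (f g : R -> 'M[R[i]]_(s, r)) : Prop :=
  forall j, (j < k)%N -> forall (p : 'I_s) (q : 'I_r),
    cderiven j (fun xi => f xi p q) 0 = cderiven j (fun xi => g xi p q) 0.

End ComplexFunctions.

Section Sequences.
Context {R : realType}.
Local Notation C := R[i].

Definition fin_supp (s r : nat) (u : int -> 'M[C]_(s, r)) : Prop :=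
  finite_set [set k | u k != 0].

(* Finitely supported big operators evaluate to 0 on infinite supports: the sums
   over [int] below have their intended meaning when u or v ([seq_conv]), u
   ([symbol]) and a ([subdiv]) are finitely supported. *)
Definition seq_conv (s r t : nat)
    (u : int -> 'M[C]_(s, r)) (v : int -> 'M[C]_(r, t)) : int -> 'M[C]_(s, t) :=
  fun j => \sum_(k \in [set: int]) (u (j - k) *m v k).

Definition symbol (s r : nat) (u : int -> 'M[C]_(s, r)) (xi : R)
    : 'M[C]_(s, r) :=
  \sum_(k \in [set: int]) (cis (- (k%:~R * xi)) *: u k).

Definition diracI (r : nat) : int -> 'M[C]_r := fun k => ((k == 0)%:R)%:M.

Definition sup_norm (r : nat) (u : int -> 'cV[C]_r) : \bar R :=
  ereal_sup [set (normc (u kl.1 kl.2 0))%:E | kl in [set: int * 'I_r]].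

Definition subdiv (s r : nat) (a : int -> 'M[C]_r) (v : int -> 'M[C]_(s, r))
    : int -> 'M[C]_(s, r) :=
  fun j => 2%:R *: \sum_(k \in [set: int]) (v k *m a (j - 2 * k)).

Definition lagrange_convergent (r m : nat) (a : int -> 'M[C]_r) : Prop :=
  forall w0 : int -> 'rV[C]_r,
  exists eta : 'I_r -> R -> C,
    (forall l, Ck m (eta l)) /\
    forall K : R, 0 < K -> forall l : 'I_r,
      ereal_sup
        [set (normc (iter n (subdiv a) w0 k 0 l -
                     eta l (2%:R ^- n * k%:~R)))%:E
        | k in [set k : int | (`|k%:~R : R| <= 2%:R ^+ n * K)%R]]
        @[n --> \oo] --> 0%E.

Definition has_sum_rules (r : nat) (a : int -> 'M[C]_r) (k : nat)
    (v : int -> 'rV[C]_r) : Prop :=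
  [/\ fin_supp v, symbol v 0 != 0,
      eq_O k (fun xi => symbol v (2%:R * xi) *m symbol a xi) (symbol v) &
      eq_O k (fun xi => symbol v (2%:R * xi) *m symbol a (xi + pi))
             (fun=> 0)].

Definition is_sr (r : nat) (a : int -> 'M[C]_r) (k : nat) : Prop :=
  (exists v, has_sum_rules a k v) /\
  (forall k', (exists v, has_sum_rules a k' v) -> (k' <= k)%N).

(* The largest order of sum rules (0 if there is no largest one). *)
Definition sr (r : nat) (a : int -> 'M[C]_r) : nat := xget 0%N (is_sr a).

Definition sr_filter (r : nat) (a : int -> 'M[C]_r) : int -> 'rV[C]_r :=
  xget (fun=> 0) (has_sum_rules a (sr a)).

(* [Vspace j v] is the space usually written V_{j-1,v}. *)
Definition Vspace (r : nat) (j : nat) (v : int -> 'rV[C]_r)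
    : set (int -> 'cV[C]_r) :=
  [set u | fin_supp u /\
           eq_O j (fun xi => symbol v xi *m symbol u xi) (fun=> 0)].

Definition rho (r : nat) (j : nat) (a : int -> 'M[C]_r) (v : int -> 'rV[C]_r)
    : \bar R :=
  ereal_sup
    [set limn_esup (fun n : nat =>
           poweR (sup_norm (seq_conv (iter n (subdiv a) (@diracI r)) u))
                 (n%:R^-1))
    | u in Vspace j v].

(* [sr_filter a] is an arbitrary matching filter of maximal order; the exponent
   does not depend on that choice. As [lne 0 = -oo], it is +oo if rho is 0. *)
Definition sm_mask (r : nat) (a : int -> 'M[C]_r) : \bar R :=
  (- (lne (rho (sr a) a (sr_filter a)) * ((ln 2%:R)^-1)%:E))%E.

End Sequences.

Section FunctionSmoothness.
Context {R : realType}.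
Implicit Types (f g : R -> R[i]).
Local Notation mu := (@lebesgue_measure R).

Definition Linfty f : Prop :=
  re f \in Lfun mu +oo%E /\ im f \in Lfun mu +oo%E.

Definition Linfty_norm f : \bar R :=
  Lnorm mu +oo%E (fun x => (normc (f x))%:E).

Definition abs_continuous f : Prop :=
  forall e : R, 0 < e -> exists2 d : R, 0 < d &
    forall (n : nat) (x y : 'I_n -> R),
      (forall i, x i <= y i) ->
      (forall i j, i != j -> y i <= x j \/ y j <= x i) ->
      \sum_(i < n) (y i - x i) < d ->
      \sum_(i < n) normc (f (y i) - f (x i)) < e.

(* [sobolev_chain n f g]: f lies in W^n_oo and [g j] is a representative of its
   j-th derivative, for j <= n; the representatives of order < n are the
   absolutely continuous ones. As all the derivatives are bounded, it does not
   matter whether absolute continuity is meant locally or on the whole line. *)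
Definition sobolev_chain (n : nat) f (g : nat -> R -> R[i]) : Prop :=
  [/\ {ae mu, forall x, g 0%N x = f x},
      (forall j, (j <= n)%N -> Linfty (g j)),
      (forall j, (j < n)%N -> abs_continuous (g j)) &
      (forall j, (j < n)%N -> {ae mu, forall x,
         is_derive (x : R) (1 : R) (re (g j)) (re (g j.+1) x) /\
         is_derive (x : R) (1 : R) (im (g j)) (im (g j.+1) x)})].

Definition Lip_infty (tau : R) f : Prop :=
  exists2 K : R, 0 < K &
    forall t : R, (Linfty_norm (fun x => (f x - f (x - t))%R) <=
                   (K * `|t| `^ tau)%:E)%E.

Definition sm_fun f : \bar R :=
  ereal_sup [set s : \bar R | exists (n : nat) (tau : R),
    [/\ 0 <= tau, tau < 1, s = (n%:R + tau)%:E &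
        exists2 g, sobolev_chain n f g & Lip_infty tau (g n)]].

Definition sm_vec (r : nat) (f : 'I_r -> R -> R[i]) : \bar R :=
  \big[Order.min/+oo%E]_(l < r) sm_fun (f l).

End FunctionSmoothness.

Section CompactlySupportedDistributions.
Context {R : realType}.
Local Notation C := R[i].

(* Compactly supported distributions, as the continuous linear functionals on
   C^oo(R) with its usual Frechet topology. The values of T outside the smooth
   functions are irrelevant. *)
Definition compact_distribution (T : (R -> C) -> C) : Prop :=
  (forall (c : C) (f g : R -> C), smooth f -> smooth g ->
     T (fun x => c * f x + g x) = c * T f + T g) /\
  (exists (K B : R) (N : nat), forall f : R -> C, smooth f ->
     normc (T f) <=
       B * \sum_(j < N.+1) sup [set normc (cderiven j f x) | x in `[- K, K]]).

(* On compactly supported distributions the Fourier transform is the function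
   xi |-> <T, e^{-i x xi}>. *)
Definition fourier (T : (R -> C) -> C) (xi : R) : C :=
  T (fun x => cis (- (x * xi))).

Definition fourier_vec (r : nat) (phi : 'I_r -> (R -> C) -> C) (xi : R)
    : 'cV[C]_r :=
  \col_l fourier (phi l) xi.

Definition test_function (h : R -> C) : Prop :=
  smooth h /\ compact (closure [set x | h x != 0]).

Definition cintegral (h : R -> C) : C :=
  Rintegral (@lebesgue_measure R) setT (re h) +i*
  Rintegral (@lebesgue_measure R) setT (im h).

Definition represented_by (T : (R -> C) -> C) (f : R -> C) : Prop :=
  forall h, test_function h -> T h = cintegral (fun x => f x * h x).

(* sm_oo(phi) > m; this includes that every entry of phi is in L_oo. *)
Definition sm_distr_gt (r : nat) (phi : 'I_r -> (R -> C) -> C) (m : nat)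
    : Prop :=
  exists f : 'I_r -> R -> C,
    (forall l, Linfty (f l) /\ represented_by (phi l) (f l)) /\
    ((m%:R)%:E < sm_vec f)%E.

End CompactlySupportedDistributions.

(* Main.v *)
(* Let S_n be the n-th iterate of the mask on the Dirac sequence. If the scheme
   converges, then S_n(k) is uniformly close to Phi(2^-n k) for a compactly supported
   Phi of class C^m with Phi(x) = sum_k S_N(k) Phi(2^N x - k). As 1 is a simple
   eigenvalue, the rows of Phi are multiples of the left fixed vector of the symbol at
   0. Riemann sums identify the Fourier transforms of phi and Phi phihat(0), hence
   phi = Phi phihat(0). Differences of m-th derivatives over small dyadic cells span a
   finite dimensional space on which refinement to a deep level is a contraction, which
   gives Hoelder continuity, so the smoothness exceeds m. The sum rules of order 1
   follow from the polyphase relations of Phi, and S_n * u tends to 0 for each u of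
   vanishing moment; the same finite dimensional argument makes the decay exponential,
   so the exponent of the mask is positive.

   Conversely, a positive exponent forces sum rules, and lowering the number of
   vanishing moments one at a time turns the decay for moments of order sr(a) into the
   decay for moments of order 1. Hence S_n(floor(2^n x)) converges exponentially fast to
   a continuous Phi. If the smoothness of phi exceeds m, then m-fold integration of its
   derivatives and a mean value inequality show that phi, hence Phi = phi v / (v
   phihat(0)) with v the left fixed vector, is of class C^m; the limit functions are
   locally finite sums of translates of Phi. *)
Require Import Defs.
From HB Require Import structures.
From mathcomp Require Import all_boot all_order all_algebra.
From mathcomp Require Import all_classical all_reals all_analysis.
From mathcomp.real_closed Require Import complex.
From mathcomp Require Import zify ring lra.

Set Implicit Arguments.
Unset Strict Implicit.
Unset Printing Implicit Defensive.

Import Order.TTheory GRing.Theory Num.Theory.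
Import numFieldNormedType.Exports.
Import ComplexField.Normc.

Local Open Scope classical_set_scope.
Local Open Scope complex_scope.
Local Open Scope ring_scope.

(** * Sums over the integers and matrix norms *)

Section IntSums.
Implicit Types (V : zmodType).

(** Mere convergence has to produce two strict inequalities, sm(a) > 0 and sm(phi) > m, so a rate
    must come out of qualitative information, against the factor 2^(N m) picked up by m-th
    derivatives. What helps is that convolving with the mask and keeping one coset of 2Z halves
    support radii up to a constant: all data end up in a window fixed by the mask. There, smallness
    on finitely many spanning elements becomes a bound by 1/2 at one deep level N, and 2^-t at level
    N t is the power 1/N of the scale.

    The distribution is accessible only through its Fourier transform. Iterating the refinement
    equation expresses phihat(xi) by S_n and values of phihat near 0, and a functional of finite
    order that kills all exponentials is 0 by Taylor expansion and polynomial approximation of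
    derivatives, so that no inversion formula enters.

    Simplicity of the eigenvalue 1 acts through the pairing of a left with a right eigenvector,
    which does not vanish; this fixes the factor between Phi and phi and makes the smoothness of phi
    and of the limits one question. *)

Definition zr (L : nat) : seq int := [seq i%:Z - L%:Z | i <- iota 0 L.*2.+1].

Lemma mem_zr L k : (k \in zr L) = (`|k| <= L)%N.
Proof.
apply/mapP/idP => [[j]|kL]; first by rewrite mem_iota => jL ->; lia.
by exists `|(k + L%:Z)%R|%N; rewrite ?mem_iota; lia.
Qed.

Lemma zr_uniq L : uniq (zr L).
Proof. by rewrite map_inj_uniq ?iota_uniq// => i j; lia. Qed.

(** An explicit radius instead of a finite set: it is computed along with each operation, and sums
    over [int] become sums over lists that can be widened and reindexed. *)
Definition zsupp V (L : nat) (F : int -> V) := forall k, (L < `|k|)%N -> F k = 0.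

Lemma zsuppW V L L' (F : int -> V) : (L <= L')%N -> zsupp L F -> zsupp L' F.
Proof. by move=> LL' sF k kL; apply: sF; exact: leq_ltn_trans kL. Qed.

Lemma zsumE V L (F : int -> V) : zsupp L F ->
  \sum_(k \in [set: int]) F k = \sum_(k <- zr L) F k.
Proof.
move=> sF; rewrite (@fsbigE _ _ +%R _ _ (zr L))//; last 2 first.
- exact: zr_uniq.
- by move=> i _; rewrite mem_zr -ltnNge => /sF.
by apply: eq_bigl => i; rewrite in_setT.
Qed.

Lemma zsum_widen V L L' (F : int -> V) : (L <= L')%N -> zsupp L F ->
  \sum_(k <- zr L') F k = \sum_(k <- zr L) F k.
Proof. by move=> LL' sF; rewrite -(zsumE sF) (zsumE (zsuppW LL' sF)). Qed.

Lemma zsum_reindex V (h : int -> int) L L' (F : int -> V) : bijective h ->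
  zsupp L F -> zsupp L' (F \o h) ->
  \sum_(k <- zr L) F k = \sum_(k <- zr L') F (h k).
Proof.
by move=> bh sF sFh; rewrite -(zsumE sF) (@reindex_fsbigT _ _ +%R _ _ h F bh) (zsumE sFh).
Qed.

Lemma addzI_bij (c : int) : bijective (fun k : int => k + c).
Proof. by exists (fun k => k - c) => k; rewrite ?addrK ?subrK. Qed.

Lemma subzI_bij (c : int) : bijective (fun k : int => c - k).
Proof. by exists (fun k => c - k) => k; lia. Qed.

Lemma zsum_delta V L (F : int -> V) k0 : (`|k0| <= L)%N ->
  (forall k, k != k0 -> F k = 0) -> \sum_(k <- zr L) F k = F k0.
Proof.
move=> k0L F0; rewrite (bigD1_seq k0) ?mem_zr ?zr_uniq//= big1 ?addr0// => k /F0.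
Qed.

(** Passes between sums over the coset g + 2Z and sums over all integers with an indicator, that is,
    between polyphase sums and conditions on the coefficients of the mask. *)
Lemma zsum_parity V L L' (F : int -> V) (g : int) :
  zsupp L F -> zsupp L' (fun k => F (2 * k + g)) ->
  \sum_(k <- zr L') F (2 * k + g) =
  \sum_(l <- zr L) (if (2 %| l - g)%Z then F l else 0).
Proof.
move=> sF sF'; rewrite -(zsumE sF') -(@zsumE _ L); last first.
  by move=> k kL; rewrite (sF _ kL) if_same.
pose Q := [set l | (2 %| l - g)%Z].
transitivity (\sum_(l \in Q) F l); last first.
  rewrite (@fsbig_mkcond _ _ +%R); apply: (@eq_fsbigr _ _ +%R) => l _.
  by rewrite /patch mem_setE.
rewrite (@reindex_fsbig _ _ +%R _ _ (fun k => 2 * k + g) setT Q)//.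
split=> [k _|k l _ _|l]; rewrite /Q/=; [lia|lia|move=> lg].
by exists ((l - g) %/ 2)%Z => //; lia.
Qed.

End IntSums.

(** * Moduli of complex numbers and a real valued matrix norm *)

Section MatrixNorm.
Context {R : realType}.
Local Notation C := R[i].

Lemma normcD (x y : C) : normc (x + y) <= normc x + normc y.
Proof. exact: le_normcD. Qed.

Lemma normc_opp (x : C) : normc (- x) = normc x.
Proof. exact: (normcN x). Qed.

Lemma normc_ge0 (x : C) : 0 <= normc x.
Proof. by case: x => a b /=; exact: sqrtr_ge0. Qed.

Lemma normc_sum I (s : seq I) P (F : I -> C) :
  normc (\sum_(i <- s | P i) F i) <= \sum_(i <- s | P i) normc (F i).
Proof.
elim/big_rec2 : _ => [|i y x _ h]; first by rewrite normc0.
by rewrite (le_trans (normcD _ _))// lerD2l.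
Qed.

Lemma normc_Re (x : C) : `|complex.Re x| <= normc x.
Proof.
by case: x => a b /=; rewrite -sqrtr_sqr ler_wsqrtr// lerDl sqr_ge0.
Qed.

Lemma normc_Im (x : C) : `|complex.Im x| <= normc x.
Proof.
by case: x => a b /=; rewrite -sqrtr_sqr ler_wsqrtr// lerDr sqr_ge0.
Qed.

Lemma normc_real (x : R) : normc x%:C = `|x|.
Proof. by rewrite /= expr0n/= addr0 sqrtr_sqr. Qed.

Lemma normc_le_ReIm (x : C) : normc x <= `|complex.Re x| + `|complex.Im x|.
Proof.
case: x => a b /=; have ab0 : 0 <= `|a| + `|b| by rewrite addr_ge0.
rewrite -[leRHS](ger0_norm ab0) -sqrtr_sqr ler_wsqrtr//.
rewrite sqrrD !real_normK ?num_real// -addrA [`|a| * `|b| *+ 2 + _]addrC addrA.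
by rewrite lerDl mulrn_wge0// mulr_ge0.
Qed.

Lemma normc_eq0 (x : C) : (normc x == 0) = (x == 0).
Proof. by apply/eqP/eqP => [/eq0_normc|->] //; rewrite normc0. Qed.

Lemma normcX (x : C) n : normc (x ^+ n) = normc x ^+ n.
Proof. by elim: n => [|n IH]; rewrite ?expr0 ?normc1// !exprS normcM IH. Qed.

(** The sum of the moduli of all entries: real valued, above each entry, and submultiplicative for
    rectangular matrices. *)
Definition mnorm m n (M : 'M[C]_(m, n)) : R := \sum_i \sum_j normc (M i j).

Lemma mnorm_ge0 m n (M : 'M[C]_(m, n)) : 0 <= mnorm M.
Proof. by do 2 apply: sumr_ge0 => ? _; exact: normc_ge0. Qed.

Lemma mnorm0 m n : mnorm (0 : 'M[C]_(m, n)) = 0.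
Proof. by rewrite /mnorm big1// => i _; rewrite big1// => j _; rewrite mxE normc0. Qed.

Lemma mnormD m n (M N : 'M[C]_(m, n)) : mnorm (M + N) <= mnorm M + mnorm N.
Proof.
rewrite -big_split; apply: ler_sum => i _; rewrite -big_split.
by apply: ler_sum => j _; rewrite mxE normcD.
Qed.

Lemma mnormN m n (M : 'M[C]_(m, n)) : mnorm (- M) = mnorm M.
Proof. by do 2 apply: eq_bigr => ? _; rewrite mxE normc_opp. Qed.

Lemma mnormB m n (M N : 'M[C]_(m, n)) : mnorm (M - N) = mnorm (N - M).
Proof. by rewrite -mnormN opprB. Qed.

Lemma mnormZ m n c (M : 'M[C]_(m, n)) : mnorm (c *: M) = normc c * mnorm M.
Proof.
rewrite mulr_sumr; apply: eq_bigr => i _; rewrite mulr_sumr.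
by apply: eq_bigr => j _; rewrite mxE normcM.
Qed.

Lemma mnorm_sum I (s : seq I) P m n (F : I -> 'M[C]_(m, n)) :
  mnorm (\sum_(i <- s | P i) F i) <= \sum_(i <- s | P i) mnorm (F i).
Proof.
elim/big_rec2 : _ => [|i y x _ h]; first by rewrite mnorm0.
by rewrite (le_trans (mnormD _ _))// lerD2l.
Qed.

Lemma le_mnorm m n (M : 'M[C]_(m, n)) i j : normc (M i j) <= mnorm M.
Proof.
rewrite /mnorm (bigD1 i)//= (bigD1 j)//= -addrA lerDl addr_ge0//.
  by apply: sumr_ge0 => ? _; exact: normc_ge0.
by do 2 apply: sumr_ge0 => ? _; exact: normc_ge0.
Qed.

Lemma mnorm_eq0 m n (M : 'M[C]_(m, n)) : (mnorm M == 0) = (M == 0).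
Proof.
apply/eqP/eqP => [M0|->]; last by rewrite mnorm0.
apply/matrixP => i j; rewrite mxE; apply/eqP; rewrite -normc_eq0 eq_le normc_ge0.
by rewrite andbT -M0 le_mnorm.
Qed.

Lemma mnorm_le m n (M : 'M[C]_(m, n)) e : (forall i j, normc (M i j) <= e) ->
  mnorm M <= (m * n)%:R * e.
Proof.
move=> H; rewrite (le_trans (ler_sum _ (G := fun _ => \sum_(j < n) e) _))//.
  by move=> i _; apply: ler_sum => j _.
by rewrite !sumr_const !card_ord -mulrnA mulr_natl mulnC.
Qed.

Lemma mnormM m n p (M : 'M[C]_(m, n)) (N : 'M[C]_(n, p)) :
  mnorm (M *m N) <= mnorm M * mnorm N.
Proof.
rewrite {1}/mnorm mulr_suml; apply: ler_sum => i _.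
apply: (@le_trans _ _ (\sum_k \sum_j normc (M i k) * normc (N k j))).
  rewrite exchange_big/=; apply: ler_sum => j _; rewrite mxE.
  by rewrite (le_trans (normc_sum _ _ _))// ler_sum// => k _; rewrite normcM.
rewrite mulr_suml; apply: ler_sum => k _; rewrite -mulr_sumr ler_wpM2l ?normc_ge0//.
by rewrite /mnorm (bigD1 k)//= lerDl; do 2 apply: sumr_ge0 => ? _; exact: normc_ge0.
Qed.

Lemma fin_suppP s r (u : int -> 'M[C]_(s, r)) :
  fin_supp u <-> exists L, zsupp L u.
Proof.
split=> [|[L sL]].
  move=> /finite_seqP[X uX]; exists (\sum_(k <- X) `|k|)%N => k kX.
  apply/eqP/negPn/negP => uk0; have : [set k | u k != 0] k by [].
  by rewrite uX/= => kin; move: kX; rewrite (big_rem k)//=; lia.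
apply: (@sub_finite_set _ _ [set` zr L]); last exact: finite_seq.
move=> k /=; rewrite mem_zr; apply: contraNT; rewrite -ltnNge => /sL ->.
by rewrite eqxx.
Qed.

End MatrixNorm.

Lemma expz2 n : (2 ^+ n : int) = (2 ^ n)%N.
Proof. by elim: n => // n IH; rewrite exprS expnS IH PoszM. Qed.

(** * Iterated masks *)

Section Subdivision.
Context {R : realType}.
Local Notation C := R[i].
Variables (r : nat) (a : int -> 'M[C]_r) (A : nat).
Hypothesis sA : zsupp A a.

Definition Sn n : int -> 'M[C]_r := iter n (subdiv a) (@diracI R r).

Lemma seq_convE s p q (u : int -> 'M[C]_(s, p)) (v : int -> 'M[C]_(p, q)) L j :
  zsupp L v -> seq_conv u v j = \sum_(k <- zr L) u (j - k) *m v k.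
Proof.
by move=> sv; rewrite /seq_conv (@zsumE _ L)// => k /sv ->; rewrite mulmx0.
Qed.

Lemma seq_conv_supp s p q (u : int -> 'M[C]_(s, p)) (v : int -> 'M[C]_(p, q)) L L' :
  zsupp L u -> zsupp L' v -> zsupp (L + L') (seq_conv u v).
Proof.
move=> su sv j jL; rewrite (seq_convE _ _ sv) big_seq big1// => k.
by rewrite mem_zr => kL; rewrite su ?mul0mx//; lia.
Qed.

Lemma subdivE s (w : int -> 'M[C]_(s, r)) B j : (`|j| + A <= B)%N ->
  subdiv a w j = 2%:R *: \sum_(k <- zr B) w k *m a (j - 2 * k).
Proof.
move=> jB; rewrite /subdiv (@zsumE _ B)// => k kB.
by rewrite sA ?mulmx0//; lia.
Qed.

(** The radii obey R_(n+1) = 2 R_n + A with R_0 = 0. That the radius stays strictly below 2^n A is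
    what makes the limit vanish already at |x| = A in [mask_limit]. *)
Lemma Sn_supp0 n : zsupp ((2 ^ n).-1 * A) (Sn n).
Proof.
elim: n => [|n IH] k kA.
  by rewrite /Sn/= /diracI; case: eqP => [k0|_]; [lia|rewrite raddf0].
rewrite [Sn _]/= (subdivE _ (leqnn _)) big1 ?scaler0// => l _.
have [lA|lA] := ltnP ((2 ^ n).-1 * A) `|l|; first by rewrite IH// mul0mx.
rewrite sA ?mulmx0//; move: kA; rewrite expnS.
by have := expn_gt0 2 n; case: (2 ^ n)%N lA => //= m; nia.
Qed.

Lemma Sn_supp n : zsupp (2 ^ n * A) (Sn n).
Proof. by apply: zsuppW (@Sn_supp0 n); rewrite leq_mul2r leq_pred orbT. Qed.

(** The radius [B] does not depend on n: a nonzero term has |j - 2^n k| <= 2^n A, hence |k| <= |j| +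
    A. *)
Lemma iter_subdivE s (w : int -> 'M[C]_(s, r)) n B j : (`|j| + A <= B)%N ->
  iter n (subdiv a) w j = \sum_(k <- zr B) w k *m Sn n (j - 2 ^+ n * k).
Proof.
elim: n B j => [|n IH] B j jB.
  rewrite /Sn/= (@zsum_delta _ _ _ j); first by rewrite expr0 mul1r subrr mulmx1.
    by lia.
  move=> k kj; rewrite expr0 mul1r /diracI subr_eq0 eq_sym (negbTE kj).
  by rewrite raddf0 mulmx0.
rewrite iterS (subdivE _ jB).
have S0 m k : (B < `|k|)%N -> (`|m| + A <= B)%N -> w k *m Sn n (m - 2 ^+ n * k) = 0.
  move=> kB mB; rewrite Sn_supp ?mulmx0//.
  have := expn_gt0 2 n; rewrite expz2.
  by move: (2 ^ n)%N => N /= N0; nia.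
(* Here l runs up to B, so the induction hypothesis is taken with the radius B + A, which is cut
   back to B once the sums are exchanged. *)
transitivity (2%:R *: \sum_(l <- zr B) \sum_(k <- zr (B + A)) (w k *m Sn n (l - 2 ^+ n * k)) *m a (j - 2 * l)).
  congr (_ *: _); rewrite !big_seq; apply: eq_bigr => l; rewrite mem_zr => lB.
  by rewrite (IH (B + A)%N) ?mulmx_suml// leq_add2r.
rewrite exchange_big scaler_sumr.
rewrite -(@zsum_widen _ B (B + A)) ?leq_addr//; last first.
  move=> k kB; rewrite Sn_supp ?mulmx0//.
  have := expn_gt0 2 n; rewrite exprS expnS; rewrite expz2.
  by move: (2 ^ n)%N => N /= N0; nia.
rewrite !big_seq; apply: eq_bigr => k; rewrite mem_zr => kB.
rewrite [Sn n.+1]/= (subdivE _ (leqnn _)) -scalemxAr; congr (_ *: _).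
rewrite mulmx_sumr.
rewrite [RHS](@zsum_reindex _ (fun l => l - 2 ^+ n * k) _ B); last 3 first.
- exact: addzI_bij.
- by move=> l lB; rewrite sA ?mulmx0//; lia.
- move=> l lB; rewrite /= sA ?mulmx0//; rewrite exprS; lia.
apply: eq_bigr => l _; rewrite /= mulmxA; congr (_ *m a _).
by rewrite exprS; lia.
Qed.

Lemma SnD n N B j : (`|j| + A <= B)%N ->
  Sn (n + N) j = \sum_(k <- zr B) Sn N k *m Sn n (j - 2 ^+ n * k).
Proof. by move=> jB; rewrite /Sn iterD (iter_subdivE _ _ jB). Qed.

Definition yn p (u : int -> 'M[C]_(r, p)) n := seq_conv (Sn n) u.

(* One coset of 2Z in a subdivision step, see [ynS]: every estimate on yn u n is
   obtained by applying Tg 0 and Tg 1 to u and lowering n. *)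
Definition Tg (g : int) p (u : int -> 'M[C]_(r, p)) : int -> 'M[C]_(r, p) :=
  fun m => 2%:R *: seq_conv a u (2 * m + g).

(** The excess of the radius over that of the mask is halved, so repeated application leads into the
    window of radius A + 1, which is stable. *)
Lemma Tg_supp g p (u : int -> 'M[C]_(r, p)) L : (`|g| <= 1)%N -> zsupp L u ->
  zsupp ((L + A).+1)./2 (Tg g u).
Proof.
move=> g1 su m mL; rewrite /Tg (seq_conv_supp sA su) ?scaler0//.
by move: mL; lia.
Qed.

(** The last mask in S_(n+1) stands on the right, next to u: it can be convolved with u first, and
    the dilation by 2 then selects one coset of the result. *)
Lemma ynS p (u : int -> 'M[C]_(r, p)) L n k g : zsupp L u -> (`|g| <= 1)%N ->
  yn u n.+1 (2 * k + g) = yn (Tg g u) n k.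
Proof.
move=> su g1; rewrite /yn (seq_convE _ _ su).
have sT : zsupp (L + A).+1 (Tg g u) by apply: zsuppW (Tg_supp g1 su); lia.
rewrite (seq_convE _ _ sT) /Tg.
pose B := (`|k| + L + A + (L + A).+1).+2%N.
transitivity (\sum_(i <- zr L) \sum_(l <- zr B) 2%:R *: (Sn n (k - l) *m (a (2 * l + g - i) *m u i))).
  rewrite !big_seq; apply: eq_bigr => i; rewrite mem_zr => iL.
  rewrite [Sn n.+1]/= (subdivE _ (leqnn _)) -scalemxAl mulmx_suml scaler_sumr.
  rewrite (@zsum_reindex _ (fun l => k - l) _ B); last 3 first.
  - exact: subzI_bij.
  - by move=> l lB; rewrite sA ?mulmx0 ?mul0mx ?scaler0//; lia.
  - by move=> l lB; rewrite /= sA ?mulmx0 ?mul0mx ?scaler0//; lia.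
  apply: eq_bigr => l _; rewrite -mulmxA; congr (_ *: (_ *m (a _ *m _))); lia.
rewrite exchange_big/= -(@zsum_widen _ _ B _ _ (_ : zsupp (L + A).+1 _)) /B; last 2 first.
- by lia.
- by move=> l lB; rewrite (seq_conv_supp sA su) ?scaler0 ?mulmx0//; lia.
apply: eq_bigr => l _; rewrite (seq_convE _ _ su) -scalemxAr mulmx_sumr.
by rewrite scaler_sumr.
Qed.

End Subdivision.

(** * Simple eigenvalues *)

Section SimpleEigenvalue.
Context {F : fieldType}.

Lemma char_poly_conj n (P A : 'M[F]_n) : P \in unitmx ->
  char_poly (P *m A *m invmx P) = char_poly A.
Proof.
move=> uP; have -> : char_poly (P *m A *m invmx P) =
    \det (map_mx polyC P *m char_poly_mx A *m map_mx polyC (invmx P)).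
  congr (\det _); rewrite /char_poly_mx mulmxBr mulmxBl -!map_mxM; congr (_ - _).
  by rewrite scalar_mxC -mulmxA -map_mxM mulmxV// map_scalar_mx mulmx1.
rewrite !det_mulmx mulrAC -det_mulmx -map_mxM mulmxV// map_scalar_mx.
by rewrite det1 mul1r.
Qed.

Lemma char_poly_lblock m n (A : 'M[F]_m) (C : 'M[F]_(n, m)) (D : 'M[F]_n) :
  char_poly (block_mx A 0 C D) = char_poly A * char_poly D.
Proof.
rewrite /char_poly /char_poly_mx scalar_mx_block map_block_mx opp_block_mx.
by rewrite add_block_mx map_mx0 oppr0 addr0 det_lblock.
Qed.

(* In a basis starting with v the matrix is block triangular with corner l; if v w
   were 0, then w would be an eigenvector of the other diagonal block, and l a
   multiple root. *)
Lemma simple_eig_pair n (A : 'M[F]_n) (l : F) (v : 'rV_n) (w : 'cV_n) :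
  mup l (char_poly A) = 1%N -> v *m A = l *: v -> A *m w = l *: w ->
  v != 0 -> w != 0 -> (v *m w) 0 0 != 0.
Proof.
case: n A v w => [|n] A v w mu vA Aw v0 w0.
  by case/negP: v0; apply/eqP/matrixP => i [].
apply/negP => /eqP vw0.
have vr : \rank v = 1%N by apply/eqP; rewrite rank_rV v0.
pose P := row_ebase v; have uP : P \in unitmx by exact: row_ebase_unit.
pose e : 'rV[F]_(1 + n) := row_mx 1%:M 0.
(* In rank one, [mulmx_ebase] says that v is a multiple of the first row of the invertible matrix P;
   the factor is the only entry of [col_ebase v]. *)
have [c c0 vE] : exists2 c : F, c != 0 & v = c *: (e *m P).
  have := mulmx_ebase v; rewrite vr => vE.
  have cu : col_ebase v \in unitmx by exact: col_ebase_unit.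
  exists (col_ebase v 0 0).
    by move: cu; rewrite [col_ebase v]mx11_scalar unitmxE det_scalar1 unitfE mxE eqxx mulr1n.
  rewrite -{1}vE {1}[col_ebase v]mx11_scalar mul_scalar_mx -scalemxAl.
  congr (_ *: (_ *m _)); rewrite /e; apply/rowP => i; rewrite !mxE/=.
  case: splitP => j; rewrite ?ord1 ?mxE => ->//.
pose B := P *m A *m invmx P.
have eB : e *m B = l *: e.
  apply: (scalerI c0); rewrite scalemxAl /B !mulmxA -[c *: e *m P]scalemxAl -vE vA -scalemxAl vE -scalemxAl -mulmxA.
  by rewrite mulmxV// mulmx1 scalerA mulrC -scalerA.
pose w' : 'cV[F]_(1 + n) := P *m w.
have Bw : B *m w' = l *: w'.
  by rewrite /B /w' -!mulmxA (mulmxA (invmx P)) mulVmx// mul1mx Aw -scalemxAr.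
have ew : e *m w' = 0.
  have : (v *m w) = 0 by apply/matrixP => i j; rewrite !ord1 vw0 mxE.
  rewrite vE -scalemxAl -mulmxA => /(congr1 (fun M => c^-1 *: M)).
  by rewrite scalerA mulVf// scale1r scaler0.
have w'0 : w' != 0.
  apply: contra w0 => /eqP w'0; rewrite -(mul1mx w) -(mulVmx uP) -mulmxA -/w' w'0.
  by rewrite mulmx0.
pose B' : 'M[F]_(1 + n) := B.
have Bu : usubmx B' = row_mx l%:M 0.
  have -> : usubmx B' = e *m B.
    rewrite -[B in RHS](@vsubmxK _ 1 n (1 + n)%N) mul_row_col mul1mx mul0mx addr0.
    by [].
  by rewrite eB /e scale_row_mx scalemx1 scaler0.
have Bb : B' = block_mx l%:M 0 (dlsubmx B') (drsubmx B').
  rewrite -{1}[B']submxK; congr block_mx.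
    by rewrite /ulsubmx Bu row_mxKl.
  by rewrite /ursubmx Bu row_mxKr.
have w'u : usubmx w' = 0.
  by move: ew; rewrite -[w']vsubmxK mul_row_col mul1mx mul0mx addr0 col_mxKu.
have Dw : drsubmx B' *m dsubmx w' = l *: dsubmx w'.
  have : block_mx l%:M 0 (dlsubmx B') (drsubmx B') *m
      col_mx (usubmx w') (dsubmx w') = l *: col_mx (usubmx w') (dsubmx w').
    by rewrite vsubmxK -Bb.
  rewrite w'u mul_block_col scale_col_mx => /eq_col_mx[_].
  by rewrite mulmx0 add0r.
have w2 : dsubmx w' != 0.
  by apply: contra w'0 => /eqP w20; rewrite -[w']vsubmxK w'u w20 col_mx0.
have rD : root (char_poly (drsubmx B')) l.
  rewrite /root /char_poly -[_.[_]]/(horner_eval l _) -det_map_mx -det_tr.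
  apply/det0P; exists (dsubmx w')^T; first by rewrite trmx_eq0.
  rewrite -trmx_mul; apply/eqP; rewrite trmx_eq0 /char_poly_mx map_mxB mulmxBl.
  rewrite map_scalar_mx/= /horner_eval hornerX mul_scalar_mx -Dw subr_eq0; apply/eqP.
  by congr (_ *m _); apply/matrixP => i j; rewrite !mxE /= hornerC.
have cA : char_poly A = ('X - l%:P) * char_poly (drsubmx B').
  rewrite -(char_poly_conj A uP) -/B.
  have -> : char_poly B = char_poly (block_mx l%:M 0 (dlsubmx B') (drsubmx B')).
    by rewrite -Bb.
  rewrite char_poly_lblock; congr (_ * _).
  by rewrite /char_poly /char_poly_mx map_scalar_mx -raddfB det_scalar1.
have /factor_theorem[q qE] := rD.
have cA0 : char_poly A != 0 by rewrite monic_neq0// char_poly_monic.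
have : (2 <= mup l (char_poly A))%N.
  by rewrite mup_geq// cA qE mulrC -mulrA -expr2 dvdp_mull.
by rewrite mu.
Qed.

(** With this factor the difference of v' and the multiple of v is orthogonal to w. It satisfies the
    eigenvector equation too, so by [simple_eig_pair] it can only be 0. *)
Lemma simple_eig_line n (A : 'M[F]_n) (l : F) (v v' : 'rV_n) (w : 'cV_n) :
  mup l (char_poly A) = 1%N -> v *m A = l *: v -> v' *m A = l *: v' ->
  A *m w = l *: w -> v != 0 -> w != 0 ->
  v' = ((v' *m w) 0 0 / (v *m w) 0 0) *: v.
Proof.
move=> mu vA v'A Aw v0 w0; have vw := simple_eig_pair mu vA Aw v0 w0.
set c := _ / _; apply/eqP; rewrite -subr_eq0; apply/negPn/negP => d0.
have dA : (v' - c *: v) *m A = l *: (v' - c *: v).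
  by rewrite mulmxBl v'A -scalemxAl vA scalerBr !scalerA mulrC.
have := simple_eig_pair mu dA Aw d0 w0.
rewrite mulmxBl -scalemxAl.
have -> : (v' *m w - c *: (v *m w)) 0 0 = (v' *m w) 0 0 - c * (v *m w) 0 0.
  by move: (v' *m w) (v *m w) => M N; rewrite !mxE.
by rewrite /c divfK// subrr eqxx.
Qed.

End SimpleEigenvalue.

(** * Functions of class C^m *)

Section RealCalculus.
Context {R : realType}.
Implicit Types (f g h : R -> R) (G : nat -> R -> R).
Local Notation isd f x d := (is_derive (x : R) (1 : R) (f : R -> R) (d : R)).

(** Smooth functions are presented by a whole chain of candidate derivatives; this identifies all
    iterated derivatives at once, without rewriting under [derive1n]. *)
Lemma chain_derive1n m G :
  (forall j x, (j < m)%N -> isd (G j) x (G j.+1 x)) ->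
  forall j, (j <= m)%N -> derive1n j (G 0%N) = G j.
Proof.
move=> dG; elim=> [|j IH] jm; first by rewrite derive1n0.
rewrite derive1nS IH ?(ltnW jm)//; apply/funext => x.
by rewrite derive1E; have dj := dG j x jm; rewrite derive_val.
Qed.

Lemma realCk_chain m G :
  (forall j x, (j < m)%N -> isd (G j) x (G j.+1 x)) ->
  continuous (G m) -> realCk m (G 0%N).
Proof.
move=> dG cG; split=> [j x jm|]; last by rewrite (chain_derive1n dG).
by rewrite (chain_derive1n dG) ?(ltnW jm)//; have [] := dG j x jm.
Qed.

Lemma realCk_derive m f j x : realCk m f -> (j < m)%N ->
  isd (derive1n j f) x (derive1n j.+1 f x).
Proof.
by move=> [df _] jm; rewrite derive1nS derive1E; apply: derivableP; exact: df.
Qed.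

Lemma derivable_cts f : (forall x, derivable f x 1) -> continuous f.
Proof. by move=> df x; apply: differentiable_continuous; exact/derivable1_diffP. Qed.

Lemma realCk_cts m f j : realCk m f -> (j <= m)%N -> continuous (derive1n j f).
Proof.
move=> Cf; rewrite leq_eqVlt => /orP[/eqP ->|jm]; first by case: Cf.
by apply: derivable_cts => x; case: Cf => + _; apply.
Qed.

Lemma isdD f g x a b : isd f x a -> isd g x b -> isd (fun t => f t + g t) x (a + b).
Proof. by move=> ? ?; exact: is_deriveD. Qed.

Lemma isdB f g x a b : isd f x a -> isd g x b -> isd (fun t => f t - g t) x (a - b).
Proof. by move=> ? ?; exact: is_deriveB. Qed.

Lemma isdZ f x c a : isd f x a -> isd (fun t => c * f t) x (c * a).
Proof. by move=> ?; exact: is_deriveZ. Qed.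

Lemma isdM f g x a b : isd f x a -> isd g x b ->
  isd (fun t => f t * g t) x (a * g x + f x * b).
Proof.
move=> fa gb; have := is_deriveM fa gb; rewrite addrC ![_ *: _]mulrC => h.
by rewrite [f x * b]mulrC.
Qed.

Lemma isd_cst x c : isd (fun=> c) x 0.
Proof. exact: is_derive_cst. Qed.

Lemma isd_eq f x a b : isd f x a -> a = b -> isd f x b.
Proof. by move=> ? <-. Qed.

Lemma isd_affine (s t : R) x : isd (fun y => s * y + t) x s.
Proof.
apply: (@isd_eq _ _ (s * 1 + 0)); last by rewrite mulr1 addr0.
Qed.

Lemma isd_lin f (s t : R) x d : isd f (s * x + t) d ->
  isd (fun y => f (s * y + t)) x (s * d).
Proof.
move=> df; rewrite mulrC.
exact: (@is_derive1_comp _ f (fun y => s * y + t) x d s df (isd_affine _ _ _)).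
Qed.

Lemma isd_sum I (s : seq I) (F : I -> R -> R) (D : I -> R) x :
  (forall i, isd (F i) x (D i)) ->
  isd (fun t => \sum_(i <- s) F i t) x (\sum_(i <- s) D i).
Proof.
move=> dF; elim: s => [|i s IH].
  by under eq_fun do rewrite big_nil; rewrite big_nil; exact: isd_cst.
by under eq_fun do rewrite big_cons; rewrite big_cons; exact: isdD.
Qed.

Lemma isd_cts f x d : isd f x d -> {for x, continuous f}.
Proof. by move=> [df _]; apply: differentiable_continuous; exact/derivable1_diffP. Qed.

Lemma mvt_le f (D : R -> R) (a b M : R) :
  (forall x, a <= x <= b -> isd f x (D x)) ->
  (forall x, a <= x <= b -> `|D x| <= M) -> a <= b ->
  `|f b - f a| <= M * (b - a).
Proof.
move=> df DM ab.
have [||c cab ->] := @MVT_segment R f D a b ab.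
- by move=> x /itvP xab; apply: df; rewrite !xab.
- apply: derivable_within_continuous => x /itvP xab.
  by have [] := df x; rewrite ?xab.
rewrite normrM [X in _ * X]ger0_norm ?subr_ge0// ler_wpM2r ?subr_ge0//.
by apply: DM; rewrite !(itvP cab).
Qed.

Lemma mvt_le_sym f (D : R -> R) (K M x y : R) :
  (forall z, `|z| <= K -> isd f z (D z)) ->
  (forall z, `|z| <= K -> `|D z| <= M) -> `|x| <= K -> `|y| <= K ->
  `|f y - f x| <= M * `|y - x|.
Proof.
wlog xy : x y / x <= y => [H df DM xK yK|df DM].
  have [/H|/ltW/H] := leP x y; first exact.
  by rewrite distrC [`|y - x|]distrC; apply.
move=> xK' yK'; have /andP[xK _] : - K <= x <= K by rewrite -ler_norml.
have /andP[_ yK] : - K <= y <= K by rewrite -ler_norml.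
rewrite [`|y - x|]ger0_norm ?subr_ge0//.
apply: (@mvt_le f D) => // z /andP[xz zy]; [apply: df|apply: DM];
  by rewrite ler_norml (le_trans xK)// (le_trans zy).
Qed.

(** Downward induction on the order: recovering G j from its derivative and its zero at 0 costs a
    factor K, and K >= 1 allows one bound for all orders. *)
Lemma chain_le_top n G (K e : R) : 1 <= K -> 0 <= e ->
  (forall j x, (j < n)%N -> isd (G j) x (G j.+1 x)) ->
  (forall j, (j < n)%N -> G j 0 = 0) ->
  (forall x, `|x| <= K -> `|G n x| <= e) ->
  forall j x, (j <= n)%N -> `|x| <= K -> `|G j x| <= e * K ^+ n.
Proof.
move=> K1 e0 dG G0 Gn.
have K0 : 0 <= K by exact: le_trans K1.
have H i j x : (i <= n)%N -> (j = n - i)%N -> `|x| <= K -> `|G j x| <= e * K ^+ i.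
  elim: i j x => [|i IH] j x iN jE xK; first by rewrite expr0 mulr1 jE subn0 Gn.
  have jn : (j < n)%N by lia.
  have -> : G j x = G j x - G j 0 by rewrite G0// subr0.
  apply: (@le_trans _ _ (e * K ^+ i * `|x - 0|)).
    apply: (@mvt_le_sym _ (G j.+1) K) => //; last by rewrite normr0.
      by move=> z _; exact: dG.
    by move=> z zK; apply: IH => //; lia.
  by rewrite subr0 exprSr mulrA ler_wpM2l// mulr_ge0// exprn_ge0.
move=> j x jn xK; apply: (le_trans (H (n - j)%N j x _ _ xK)); [lia|lia|].
by rewrite ler_wpM2l// ler_weXn2l// leq_subr.
Qed.

Lemma chain_horner (p : {poly R}) j x : isd (horner p^`(j)) x (p^`(j.+1)).[x].
Proof. by rewrite derivnS; exact: is_derive_poly. Qed.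

(** Advancing the phase by pi / 2 differentiates a cosine, so one formula covers all orders, and the
    sine as well. *)
Lemma chain_cos (t th : R) j x :
  isd (fun y => t ^+ j * cos (t * y + (th + j%:R * (pi / 2)))) x
      (t ^+ j.+1 * cos (t * x + (th + j.+1%:R * (pi / 2)))).
Proof.
rewrite exprSr -mulrA; apply: isdZ; apply: isd_lin.
have -> : t * x + (th + j.+1%:R * (pi / 2)) = (t * x + (th + j%:R * (pi / 2))) + pi / 2.
  by rewrite -natr1; ring.
by rewrite cosDpihalf; exact: is_derive_cos.
Qed.

Lemma antideriv_poly (q : {poly R}) c : exists p : {poly R}, p^`() = q /\ p.[0] = c.
Proof.
exists (\poly_(i < (size q).+1) (if i is j.+1 then q`_j / j.+1%:R else c)).
split; last by rewrite horner_coef0 coef_poly.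
apply/polyP => i; rewrite coef_deriv coef_poly ltnS.
case: ltnP => iq; last by rewrite mul0rn nth_default.
by rewrite -[LHS]mulr_natr divfK// pnatr_eq0.
Qed.

Lemma antideriv_polyn (q : {poly R}) N (c : nat -> R) :
  exists p : {poly R}, p^`(N) = q /\ forall j, (j < N)%N -> (p^`(j)).[0] = c j.
Proof.
elim: N q => [|N IH] q; first by exists q.
have [q' [q'q q'c]] := antideriv_poly q (c N).
have [p [pq pc]] := IH q'; exists p; rewrite derivnS pq; split=> // j.
by rewrite ltnS leq_eqVlt => /orP[/eqP ->|/pc//]; rewrite pq.
Qed.

End RealCalculus.

(** * Polynomial approximation *)

Section Weierstrass.
Context {R : realType}.
Implicit Types (f g h : R -> R) (x y K e d M : R).

Lemma ctsP f x : {for x, continuous f} <->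
  forall e : R, 0 < e -> exists2 d : R, 0 < d & forall y, `|x - y| < d -> `|f x - f y| < e.
Proof.
split=> [cf e e0|H].
  have /cvgrPdist_lt /(_ e e0)/nbhs_ballP[d /= d0 H] := cf.
  by exists d => // y xy; apply: H.
apply/cvgrPdist_lt => e /H[d d0 Hd]; apply/nbhs_ballP; by exists d.
Qed.

(** Only one of the two points is confined to the compact interval, so that later estimates may
    cross its ends. *)
Lemma heine f K e : continuous f -> 0 < e -> exists2 d : R, 0 < d &
  forall x y, `|x| <= K -> `|x - y| < d -> `|f x - f y| < e.
Proof.
move=> cf e0.
have cK : compact `[- K, K] by exact: segment_compact.
move/compact_near_coveringP: cK => /(_ R (0^'+) (fun d x => forall y, `|x - y| < d -> `|f x - f y| < e)).
have ne : Filter (0 : R)^'+ by exact: at_right_proper_filter.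
move=> /(_ ne); case.
  move=> x _; have e2 : 0 < e / 2 by rewrite divr_gt0.
  have [d d0 Hd] := (ctsP f x).1 (cf x) _ e2.
  have d2 : 0 < d / 2 by rewrite divr_gt0.
  near=> x' d' => y /= xy.
  have x'x : `|x - x'| < d / 2 by near: x'; apply/nbhs_ballP; exists (d / 2).
  have d'd : d' < d / 2 by near: d'; exact: nbhs_right_lt.
  have -> : f x' - f y = (f x - f y) - (f x - f x') by ring.
  have h1 : `|f x - f x'| < e / 2 by apply: Hd; lra.
  have h2 : `|f x - f y| < e / 2.
    apply: Hd; have -> : x - y = (x - x') + (x' - y) by ring.
    by have := ler_normD (x - x') (x' - y); lra.
  by have := ler_normB (f x - f y) (f x - f x'); lra.
move=> d /= d0 H; exists (d / 2); first by rewrite divr_gt0.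
move=> x y xK xy; apply: (H (d / 2)) => //=.
- by rewrite sub0r normrN ger0_norm ?divr_ge0 ?ltW// ltr_pdivrMr// ltr_pMr// ltr1n.
- by rewrite divr_gt0.
- by rewrite in_itv/= -ler_norml.
Unshelve. all: by end_near. Qed.

Lemma cts_bounded f K : continuous f -> exists2 M : R, 0 <= M & forall x, `|x| <= K -> `|f x| <= M.
Proof.
move=> cf; have [K0|K0] := ltP K 0.
  by exists 0 => // x; rewrite leNgt (lt_le_trans K0).
have cnf : {within `[- K, K], continuous (fun x => `|f x|)}.
  by apply: continuous_subspaceT => x; apply: continuous_comp; [exact: cf|exact: norm_continuous].
have [|c _ cM] := EVT_max _ cnf; first by lra.
exists `|f c| => // x; rewrite ler_norml => xK; apply: cM; by rewrite in_itv.
Qed.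

(* Bernstein polynomials, by de Casteljau's recursion: [bernstein n u] is the
   expectation of [u k] for a binomial variable k with parameters n and 'X. *)
Fixpoint bernstein (n : nat) (u : nat -> R) : {poly R} :=
  if n is m.+1 then 'X * bernstein m (fun k => u k.+1) + (1 - 'X) * bernstein m u
  else (u 0%N)%:P.

Local Notation E n u x := (bernstein n u).[x].

Lemma bernsteinS n u x :
  E n.+1 u x = x * E n (fun k => u k.+1) x + (1 - x) * E n u x.
Proof. by rewrite /= !hornerE. Qed.

Lemma bernstein_lin n c u v x :
  E n (fun k => c * u k + v k) x = c * E n u x + E n v x.
Proof.
elim: n u v => [|n IH] u v; first by rewrite /= !hornerE.
by rewrite !bernsteinS !IH; ring.
Qed.

Lemma bernstein_ext n u v x : u =1 v -> E n u x = E n v x.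
Proof. by move=> /funext ->. Qed.

Lemma bernstein_cst n c x : E n (fun=> c) x = c.
Proof. by elim: n => [|n IH]; rewrite ?bernsteinS ?IH /= ?hornerE//; ring. Qed.

Lemma bernstein_le n u v x : 0 <= x <= 1 -> (forall k, (k <= n)%N -> u k <= v k) ->
  E n u x <= E n v x.
Proof.
move=> /andP[x0 x1]; elim: n u v => [|n IH] u v uv; first by rewrite /= !hornerE uv.
rewrite !bernsteinS lerD// ler_wpM2l ?subr_ge0// IH// => k kn; apply: uv => //.
exact: ltnW.
Qed.

Lemma bernstein_mean n x : E n (fun k => k%:R - n%:R * x) x = 0.
Proof.
elim: n => [|n IH]; first by rewrite /= hornerE mul0r subrr.
rewrite bernsteinS.
rewrite (@bernstein_ext n _ (fun k => 1 * (k%:R - n%:R * x) + (1 - x))); last first.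
  by move=> k; rewrite -!natr1; ring.
rewrite (@bernstein_ext n (fun k => k%:R - n.+1%:R * x) (fun k => 1 * (k%:R - n%:R * x) + (- x))); last first.
  by move=> k; rewrite -!natr1; ring.
by rewrite !bernstein_lin !bernstein_cst !IH; ring.
Qed.

Lemma bernstein_var n x : E n (fun k => (k%:R - n%:R * x) ^+ 2) x = n%:R * (x * (1 - x)).
Proof.
elim: n => [|n IH]; first by rewrite /= hornerE mul0r subrr expr0n/= mul0r.
rewrite bernsteinS.
rewrite (@bernstein_ext n _ (fun k => 1 * ((k%:R - n%:R * x) ^+ 2) +
   (2 * (1 - x) * (k%:R - n%:R * x) + (1 - x) ^+ 2))); last first.
  by move=> k; rewrite -!natr1; ring.
rewrite (@bernstein_ext n (fun k => (k%:R - n.+1%:R * x) ^+ 2)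
   (fun k => 1 * ((k%:R - n%:R * x) ^+ 2) +
   ((- 2 * x) * (k%:R - n%:R * x) + x ^+ 2))); last first.
  by move=> k; rewrite -!natr1; ring.
by rewrite !bernstein_lin !bernstein_cst !IH !bernstein_mean -natr1; ring.
Qed.

(** Chebyshev's argument: |f(x) - f(k/n)| is at most e/2 if k/n is within d of x, and at most 2 M /
    d^2 times (x - k/n)^2 otherwise. Taking expectations, the variance x (1 - x) / n leaves 2 M /
    (d^2 n), which is at most e/2 by the choice of n. *)
Lemma bernstein_approx f e : continuous f -> 0 < e ->
  exists q : {poly R}, forall x, 0 <= x <= 1 -> `|f x - q.[x]| <= e.
Proof.
move=> cf e0; have e2 : 0 < e / 2 by rewrite divr_gt0.
have [d d0 Hd] := heine 1 cf e2.
have [M M0 HM] := cts_bounded 1 cf.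
pose n := (Num.truncn (4 * M / d ^+ 2 / e)).+1.
have nM : 4 * M / d ^+ 2 / e <= n%:R by rewrite ltW// Num.Theory.truncnS_gt.
have n0 : 0 < n%:R :> R by rewrite ltr0n.
exists (bernstein n (fun k => f (k%:R / n%:R))) => x x01.
have /andP[x0 x1] := x01.
have d2 : 0 < d ^+ 2 by rewrite exprn_gt0.
have c0 : 0 <= 2 * M / d ^+ 2 / n%:R ^+ 2.
  by do 2 (apply: divr_ge0; last by rewrite exprn_ge0// ltW); rewrite mulr_ge0.
have H k : (k <= n)%N -> `|f x - f (k%:R / n%:R)| <=
    (2 * M / d ^+ 2 / n%:R ^+ 2) * (k%:R - n%:R * x) ^+ 2 + e / 2.
  move=> kn; have [kd|kd] := ltP `|x - k%:R / n%:R| d.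
    rewrite (le_trans (ltW (Hd x _ _ kd)))//; first by rewrite ger0_norm.
    by rewrite lerDr mulr_ge0// sqr_ge0.
  have kn1 : `|k%:R / n%:R : R| <= 1.
    by rewrite ger0_norm ?divr_ge0// ler_pdivrMr// mul1r ler_nat.
  apply: (@le_trans _ _ (2 * M)).
    have := ler_normB (f x) (f (k%:R / n%:R)); have := HM _ kn1.
    by have := HM x; rewrite ger0_norm// => /(_ x1); lra.
  apply: (@le_trans _ _ ((2 * M / d ^+ 2 / n%:R ^+ 2) * (k%:R - n%:R * x) ^+ 2)); last first.
    by rewrite lerDl ltW.
  have -> : (k%:R - n%:R * x) ^+ 2 = n%:R ^+ 2 * `|x - k%:R / n%:R| ^+ 2.
    by rewrite real_normK ?num_real//; field; rewrite gt_eqF.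
  rewrite mulrA divfK ?expf_neq0 ?gt_eqF// -mulrA ler_peMr ?mulr_ge0//.
  by rewrite mulrC ler_pdivlMr// mul1r lerXn2r ?nnegrE// ltW.
(* The operator is linear and monotone; the two signs s = 1 and s = -1 together give the absolute
   value. *)
have bnd s : `|s| = 1 -> s * (f x - (bernstein n (fun k => f (k%:R / n%:R))).[x]) <= e.
  move=> s1.
  have -> : s * (f x - (bernstein n (fun k => f (k%:R / n%:R))).[x]) =
      E n (fun k => s * (f x - f (k%:R / n%:R))) x.
    rewrite (@bernstein_ext n (fun k => s * (f x - f (k%:R / n%:R)))
      (fun k => (- s) * f (k%:R / n%:R) + s * f x)); last by move=> k; ring.
    by rewrite bernstein_lin bernstein_cst; ring.
  apply: (@le_trans _ _ (E n (fun k => (2 * M / d ^+ 2 / n%:R ^+ 2) * (k%:R - n%:R * x) ^+ 2 + e / 2) x)).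
    apply: bernstein_le => // k kn; apply: le_trans (H k kn).
    by rewrite (le_trans (ler_norm _))// normrM s1 mul1r.
  rewrite bernstein_lin bernstein_cst bernstein_var [leRHS]splitr lerD2r.
  have -> : 2 * M / d ^+ 2 / n%:R ^+ 2 * (n%:R * (x * (1 - x))) = 2 * M / d ^+ 2 / n%:R * (x * (1 - x)).
    by field; rewrite ?gt_eqF.
  apply: (@le_trans _ _ (2 * M / d ^+ 2 / n%:R)).
    rewrite ler_piMr//; first by rewrite !divr_ge0 ?mulr_ge0// ltW.
    by rewrite mulr_ile1//; lra.
  rewrite ler_pdivrMr//; move: nM; rewrite ler_pdivrMr//.
  by rewrite -2![_ * M / _]mulrA; move: (M / d ^+ 2) => z; lra.
rewrite ler_norml; apply/andP; split.
  by rewrite lerNl -mulN1r bnd// normrN1.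
by rewrite -[leLHS]mul1r bnd// normr1.
Qed.

Lemma weierstrass f K e : continuous f -> 0 < K -> 0 < e ->
  exists q : {poly R}, forall x, `|x| <= K -> `|f x - q.[x]| <= e.
Proof.
move=> cf K0 e0.
have cg : continuous (fun y => f (2 * K * y + - K)).
  move=> y; apply: (@continuous_comp _ _ _ (fun y => 2 * K * y + - K) f); last exact: cf.
  exact: isd_cts (isd_affine _ _ _).
have [q Hq] := bernstein_approx cg e0.
exists (q \Po ((2 * K)^-1 *: 'X + (1 / 2)%:P)) => x; rewrite ler_norml => /andP[xK Kx].
rewrite horner_comp !hornerE.
have {1}-> : x = 2 * K * ((2 * K)^-1 * x + 2^-1) + - K by field; rewrite gt_eqF.
apply: Hq; apply/andP; split.
  rewrite -(@ler_pM2l _ (2 * K)) ?mulr_gt0// mulr0.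
  have -> : 2 * K * ((2 * K)^-1 * x + 2^-1) = x + K by field; rewrite gt_eqF.
  lra.
rewrite -(@ler_pM2l _ (2 * K)) ?mulr_gt0//.
have -> : 2 * K * ((2 * K)^-1 * x + 2^-1) = x + K by field; rewrite gt_eqF.
lra.
Qed.

End Weierstrass.

(** * Functionals vanishing on the exponentials *)

Section Uniqueness.
Context {R : realType}.
Local Notation C := R[i].
Implicit Types (f g : R -> R) (x t th : R).

Definition smoothR f := forall m, realCk m f.

Lemma smoothR_chain (G : nat -> R -> R) :
  (forall j x, is_derive (x : R) (1 : R) (G j) (G j.+1 x)) -> smoothR (G 0%N).
Proof.
move=> dG m; apply: (@realCk_chain _ m G (fun j x _ => dG j x)) => x.
exact: isd_cts (dG m x).
Qed.

Lemma smoothR_derive f j x : smoothR f ->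
  is_derive (x : R) (1 : R) (derive1n j f) (derive1n j.+1 f x).
Proof. by move=> sf; exact: realCk_derive (sf j.+1) _. Qed.

Lemma smoothR_lin c f g : smoothR f -> smoothR g -> smoothR (fun x => c * f x + g x).
Proof.
move=> sf sg.
apply: (@smoothR_chain (fun j x => c * derive1n j f x + derive1n j g x)) => j x.
by apply: isdD; [apply: isdZ|]; exact: smoothR_derive.
Qed.

Lemma smoothR_horner (p : {poly R}) : smoothR (horner p).
Proof.
apply: (@smoothR_chain (fun j x => (p^`(j)).[x])) => j x; exact: chain_horner.
Qed.

Lemma smoothR_cos t th : smoothR (fun x => cos (t * x + th)).
Proof.
have := @smoothR_chain (fun j x => t ^+ j * cos (t * x + (th + j%:R * (pi / 2))))
  (fun j x => chain_cos t th j x).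
by under eq_fun do rewrite expr0 mul1r mul0r addr0.
Qed.

(** A polynomial of degree < M that is O(t^M) at 0 is zero: its constant term is its limit at 0, and
    the rest can be divided by t. *)
Lemma vanishing_coefs (M : nat) (d : nat -> C) (B : R) :
  (forall t, 0 < t <= 1 -> normc (\sum_(j < M) (t ^+ j)%:C * d j) <= B * t ^+ M) ->
  forall j, (j < M)%N -> d j = 0.
Proof.
elim: M d => [//|M IH] d H.
pose T t := \sum_(j < M) (t ^+ j)%:C * d j.+1.
have E t : \sum_(j < M.+1) (t ^+ j)%:C * d j = d 0%N + t%:C * T t.
  rewrite big_ord_recl expr0 mul1r; congr (_ + _); rewrite /T mulr_sumr.
  by apply: eq_bigr => i _; rewrite lift0 exprS rmorphM mulrA.
pose S := \sum_(j < M) normc (d j.+1).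
have TS t : 0 < t <= 1 -> normc (T t) <= S.
  move=> /andP[t0 t1]; rewrite (le_trans (normc_sum _ _ _))// ler_sum// => i _.
  rewrite normcM normc_real (ger0_norm (exprn_ge0 _ (ltW t0))).
  by rewrite ler_piMl ?normc_ge0// exprn_ile1// ltW.
have d0 : d 0%N = 0.
  apply/eqP; rewrite -normc_eq0 eq_le normc_ge0 andbT.
  have Ht t : 0 < t <= 1 -> normc (d 0%N) <= t * (`|B| + S).
    move=> t01; have /andP[t0 t1] := t01.
    have -> : d 0%N = (d 0%N + t%:C * T t) - t%:C * T t by rewrite addrK.
    rewrite -E mulrDr (le_trans (normcD _ _))// lerD//.
      rewrite (le_trans (H _ t01))// exprS mulrCA; apply: ler_wpM2l; first exact: ltW.
      rewrite (le_trans (ler_norm _))// normrM ler_piMr//.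
      by rewrite (ger0_norm (exprn_ge0 _ (ltW t0))) exprn_ile1// ltW.
    by rewrite normc_opp normcM normc_real (gtr0_norm t0) ler_pM2l// TS.
  have S0 : 0 <= `|B| + S by rewrite addr_ge0// sumr_ge0// => i _; exact: normc_ge0.
  apply/ler_addgt0Pr => /= e e0; rewrite add0r.
  pose t := Num.min 1 (e / (`|B| + S + 1)).
  have tp : 0 < t <= 1 by rewrite lt_min ltr01 divr_gt0 ?ge_min ?lexx// ltr_wpDl.
  rewrite (le_trans (Ht _ tp))//.
  have te : t <= e / (`|B| + S + 1) by rewrite ge_min lexx orbT.
  rewrite (le_trans (ler_wpM2r S0 te))// mulrAC ler_pdivrMr ?ltr_wpDl//.
  by rewrite ler_pM2l// lerDl.
case=> [//|j]; rewrite ltnS => jM; apply: (IH (fun j => d j.+1)) => // t t01.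
have /andP[t0 t1] := t01.
have := H t t01; rewrite E d0 add0r normcM normc_real (gtr0_norm t0).
by rewrite exprS mulrCA ler_pM2l.
Qed.

Variables (L : (R -> R) -> C) (K B : R) (N : nat).
Hypothesis K1 : 1 <= K.
Hypothesis B0 : 0 <= B.
Hypothesis Llin : forall c f g, smoothR f -> smoothR g ->
  L (fun x => c * f x + g x) = c%:C * L f + L g.
Hypothesis Lbnd : forall f (e : R), smoothR f -> 0 <= e ->
  (forall j x, (j <= N)%N -> `|x| <= K -> `|derive1n j f x| <= e) ->
  normc (L f) <= B * e.
Hypothesis Lcos : forall t th, L (fun x => cos (t * x + th)) = 0.

Lemma L_zero : L (fun=> 0) = 0.
Proof.
have := Lcos 0 (pi / 2); under eq_fun do rewrite mul0r add0r cos_pihalf.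
by [].
Qed.

Lemma L_horner (p : {poly R}) : L (horner p) = \sum_(i < size p) (p`_i)%:C * L (horner 'X^i).
Proof.
have H n : L (horner (\sum_(i < n) p`_i *: 'X^i)) = \sum_(i < n) (p`_i)%:C * L (horner 'X^i).
  elim: n => [|n IH].
    by rewrite !big_ord0 (_ : horner 0 = fun=> 0) ?L_zero//; apply/funext => x; rewrite horner0.
  rewrite !big_ord_recr/= -IH addrC [RHS]addrC -Llin; try exact: smoothR_horner.
  by congr L; apply/funext => x; rewrite hornerD hornerZ.
by rewrite -H -poly_def coefK.
Qed.

(** If the Taylor polynomial of f at 0 vanishes to order M >= N, a bound on the M-th derivative
    alone controls the finitely many derivatives seen by L. *)
Lemma L_small f (G : nat -> R -> R) M e : (N <= M)%N -> 0 <= e ->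
  (forall x, f x = G 0%N x) ->
  (forall j x, is_derive (x : R) (1 : R) (G j) (G j.+1 x)) ->
  (forall j, (j < M)%N -> G j 0 = 0) ->
  (forall x, `|x| <= K -> `|G M x| <= e) -> normc (L f) <= B * (e * K ^+ M).
Proof.
move=> NM e0 /funext -> dG G0 GM; have K0 : 0 <= K by exact: le_trans K1.
apply: Lbnd => [||j x jN xK].
- exact: smoothR_chain.
- by rewrite mulr_ge0// exprn_ge0.
rewrite (@chain_derive1n _ M _ _ j) ?(leq_trans jN)//.
by apply: (@chain_le_top _ M) => //; rewrite (leq_trans jN).
Qed.

(* Taylor expansion of cos (t x + th) in t: the values of L at the monomials are the
   coefficients of a polynomial in t that is O(t^M). *)
Lemma L_monomial i : L (horner 'X^i) = 0.
Proof.
(* Larger than N, so that a bound on the M-th derivative controls L, and larger than i, so that the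
   i-th monomial occurs in the Taylor polynomial. *)
pose M := (maxn N i).+1.
have iM : (i < M)%N by rewrite ltnS leq_max leqnn orbT.
have H th : (cos (th + i%:R * (pi / 2)))%:C * L (horner 'X^i) = 0.
  pose c j := cos (th + j%:R * (pi / 2)) : R.
  have Hd : forall j, (j < M)%N -> (c j / j`!%:R)%:C * L (horner 'X^j) = 0.
    apply: (@vanishing_coefs M (fun j => (c j / j`!%:R)%:C * L (horner 'X^j)) (B * K ^+ M)).
    move=> t /andP[t0 t1].
    pose p : {poly R} := \poly_(j < M) (t ^+ j * c j / j`!%:R).
    have -> : \sum_(j < M) (t ^+ j)%:C * ((c j / j`!%:R)%:C * L (horner 'X^j)) = L (horner p).
      rewrite L_horner -(big_mkord xpredT (fun i => (p`_i)%:C * L (horner 'X^i))).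
      have sp : (size p <= M)%N by exact: size_poly.
      have -> : \sum_(0 <= i0 < size p) (p`_i0)%:C * L (horner 'X^i0) =
          \sum_(0 <= i0 < M) (p`_i0)%:C * L (horner 'X^i0).
        rewrite [RHS](big_cat_nat (n := size p))//= [X in _ + X]big_nat.
        rewrite [X in _ + X]big1 ?addr0// => j /andP[spj _].
        by rewrite nth_default// mul0r.
      rewrite big_mkord; apply: eq_bigr => j _.
      by rewrite coef_poly ltn_ord mulrA -rmorphM mulrA.
    (* As L kills the cosine, its value at the Taylor polynomial is, up to sign, its value at the
       remainder, whose M-th derivative is O(t^M). *)
    have -> : normc (L (horner p)) = normc (L (fun x => (-1) * p.[x] + cos (t * x + th))).
      rewrite Llin; [|exact: smoothR_horner|exact: smoothR_cos].
      by rewrite Lcos addr0 normcM normc_real normrN1 mul1r.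
    pose G j x := (-1) * (p^`(j)).[x] + t ^+ j * cos (t * x + (th + j%:R * (pi / 2))).
    rewrite -[leRHS]mulrA [K ^+ M * _]mulrC.
    apply: (@L_small _ G); rewrite ?exprn_ge0 ?ltW//.
    - by rewrite (leq_trans (leq_maxl N i)).
    - by move=> x; rewrite /G expr0 mul1r mul0r addr0.
    - by move=> j x; exact: isdD (isdZ _ (chain_horner _ _ _)) (chain_cos _ _ _ _).
    - move=> j jM; rewrite /G horner_coef0 coef_derivn addn0 coef_poly jM mulr0 add0r.
      by rewrite ffactnn -[_ *+ j`!]mulr_natr divfK ?pnatr_eq0 -?lt0n ?fact_gt0// mulN1r addNr.
    move=> x xK; rewrite /G derivn_poly0 ?size_poly// horner0 mulr0 add0r normrM.
    have tM := exprn_ge0 M (ltW t0).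
    by rewrite (ger0_norm tM) ler_piMr// ler_norml cos_geN1 cos_le1.
  have := Hd i iM; rewrite rmorphM mulrAC => /eqP; rewrite mulf_eq0 => /orP[/eqP //|].
  by rewrite fmorph_eq0 invr_eq0 pnatr_eq0 eqn0Ngt fact_gt0.
(* The phases 0 and pi / 2 suffice: cos(i pi / 2) and - sin(i pi / 2) do not both vanish. *)
have [c0|c0] := eqVneq (cos (0 + i%:R * (pi / 2) : R)) 0; last first.
  by have /eqP := H 0; rewrite mulf_eq0 fmorph_eq0 (negbTE c0) => /eqP.
have [c1|c1] := eqVneq (cos (pi / 2 + i%:R * (pi / 2) : R)) 0; last first.
  by have /eqP := H (pi / 2); rewrite mulf_eq0 fmorph_eq0 (negbTE c1) => /eqP.
have := cos2Dsin2 (i%:R * (pi / 2) : R).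
move: c0 c1; rewrite add0r addrC cosDpihalf => -> /eqP; rewrite oppr_eq0 => /eqP ->.
by rewrite !expr0n/= addr0 => /eqP; rewrite eq_sym oner_eq0.
Qed.

Lemma L_poly0 (p : {poly R}) : L (horner p) = 0.
Proof. by rewrite L_horner big1// => i _; rewrite L_monomial mulr0. Qed.

(* Weierstrass approximation of the N-th derivative of f, integrated N times. *)
Lemma L_smooth0 f : smoothR f -> L f = 0.
Proof.
move=> sf; apply/eqP; rewrite -normc_eq0 eq_le normc_ge0 andbT.
have K0 : 0 < K by exact: lt_le_trans K1.
apply/ler_addgt0Pr => /= e e0; rewrite add0r.
have BK : 0 < B * K ^+ N + 1 by rewrite ltr_wpDl// mulr_ge0// exprn_ge0// ltW.
have e1 : 0 < e / (B * K ^+ N + 1) by rewrite divr_gt0.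
have cf : continuous (derive1n N f) by case: (sf N).
have [q Hq] := weierstrass cf K0 e1.
have [p [pq pc]] := antideriv_polyn q N (fun j => derive1n j f 0).
have -> : L f = L (fun x => (-1) * p.[x] + f x).
  by rewrite Llin ?L_poly0 ?mulr0 ?add0r//; exact: smoothR_horner.
pose G j x := (-1) * (p^`(j)).[x] + derive1n j f x.
apply: (le_trans (@L_small _ G N (e / (B * K ^+ N + 1)) _ _ _ _ _ _)) => //.
- exact: ltW.
- by move=> j x; exact: isdD (isdZ _ (chain_horner _ _ _)) (smoothR_derive _ _ sf).
- by move=> j jN; rewrite /G pc// mulN1r addNr.
- by move=> x xK; rewrite /G pq mulN1r addrC; exact: Hq.
rewrite mulrCA mulrAC ler_pdivrMr// ler_pM2l// mulrC.
by rewrite lerDl.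
Qed.

End Uniqueness.

(** * Absolutely continuous functions *)

Section AbsoluteContinuity.
Context {R : realType}.
Implicit Types (f g h : R -> R) (x y K e d M : R).
Local Notation isd f x d := (is_derive (x : R) (1 : R) (f : R -> R) (d : R)).
Local Notation mu := (@lebesgue_measure R).

Lemma isdP f x d : isd f x d <-> forall e : R, 0 < e ->
  exists2 s : R, 0 < s & forall y, `|y - x| < s -> `|f y - f x - d * (y - x)| <= e * `|y - x|.
Proof.
pose q (h : R) : R := h^-1 * (f (h + x) - f x).
have E (h e : R) : h != 0 -> (`|d - q h| <= e) = (`|f (h + x) - f x - d * h| <= e * `|h|).
  move=> h0; rewrite -(@ler_pM2r _ `|h|) ?normr_gt0// -normrM -normrN.
  by congr (`|_| <= _); rewrite mulrBl /q mulrAC mulVf// mul1r opprB.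
have qE : (fun h : R => h^-1 *: ((f \o shift x) (h *: (1 : R)) - f x)) = q.
  by apply/funext => h; rewrite /q /= [h *: _]mulr1.
split=> [[df dE] e e0|H].
  have : q @ 0^' --> d by rewrite -dE /derive qE; move: df; rewrite /derivable qE.
  move/cvgrPdist_le => /(_ e e0); rewrite near_withinE => /nbhs_ballP[s /= s0 Hs].
  exists s => // y yx; have [->|yx0] := eqVneq y x.
    by rewrite !subrr mulr0 subr0 normr0 mulr0.
  have h0 : y - x != 0 by rewrite subr_eq0.
  have := Hs (y - x); rewrite /ball/= sub0r normrN => /(_ yx h0).
  by rewrite E// subrK.
have qd : q @ 0^' --> d.
  apply/cvgrPdist_le => e /H[s s0 Hs]; rewrite near_withinE; apply/nbhs_ballP.
  exists s => //= h; rewrite /ball/= sub0r normrN => hs h0.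
  by rewrite E//; have := Hs (h + x); rewrite addrK; apply.
apply: DeriveDef; first by rewrite /derivable qE; apply/cvg_ex; exists d.
by rewrite /derive qE; exact: cvg_lim.
Qed.

Definition rAC h := forall e : R, 0 < e -> exists2 d : R, 0 < d &
  forall (n : nat) (x y : 'I_n -> R), (forall i, x i <= y i) ->
    (forall i j, i != j -> y i <= x j \/ y j <= x i) ->
    \sum_(i < n) (y i - x i) < d -> \sum_(i < n) `|h (y i) - h (x i)| < e.

Lemma rAC_cts h : rAC h -> continuous h.
Proof.
move=> ach x; apply/ctsP => e /ach[d d0 Hd]; exists d => // y xy.
have H u v : u <= v -> v - u < d -> `|h v - h u| < e.
  move=> uv vu; have := Hd 1%N (fun=> u) (fun=> v) (fun=> uv).
  rewrite !big_ord1; apply => // i j; rewrite !ord1 eqxx//.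
have [xley|ylex] := leP x y.
  by rewrite distrC; apply: H => //; move: xy; rewrite distrC ger0_norm ?subr_ge0.
by apply: H; [exact: ltW|move: xy; rewrite gtr0_norm ?subr_gt0].
Qed.

(** Covers both uses of the mean value inequality: for increments g(x) - g(x - t), and for g minus a
    candidate tangent. *)
Lemma rAC_lin h c M : rAC h -> rAC (fun x => h (x + c) - M * x).
Proof.
move=> ach e e0; have e2 : 0 < e / 2 by rewrite divr_gt0.
have [d d0 Hd] := ach _ e2.
have M0 : 0 < `|M| + 1 by rewrite ltr_wpDl.
exists (Num.min d (e / 2 / (`|M| + 1))); first by rewrite lt_min d0 divr_gt0.
move=> n x y xy dj; rewrite lt_min => /andP[s1 s2].
have h1 : \sum_(i < n) `|h (y i + c) - h (x i + c)| < e / 2.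
  apply: (Hd n (fun i => x i + c) (fun i => y i + c)) => [i|i j /dj|].
  - by rewrite lerD2r.
  - by rewrite !lerD2r.
  - by rewrite (eq_bigr (fun i => y i - x i))// => i _; ring.
apply: (@le_lt_trans _ _ (\sum_(i < n) `|h (y i + c) - h (x i + c)| +
    \sum_(i < n) (`|M| + 1) * (y i - x i))).
  rewrite -big_split/=; apply: ler_sum => i _.
  have -> : h (y i + c) - M * y i - (h (x i + c) - M * x i) =
     (h (y i + c) - h (x i + c)) - M * (y i - x i) by ring.
  rewrite (le_trans (ler_normB _ _))// lerD2l normrM (@ger0_norm _ (y i - x i)) ?subr_ge0//.
  by rewrite ler_wpM2r ?subr_ge0// lerDl.
rewrite [ltRHS]splitr ltrD// -mulr_sumr mulrC.
by move: s2; rewrite ltr_pdivlMr.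
Qed.

Lemma rAC_sub f g : rAC f -> rAC g -> rAC (fun x => f x - g x).
Proof.
move=> acf acg e e0; have e2 : 0 < e / 2 by rewrite divr_gt0.
have [d d0 Hd] := acf _ e2; have [d' d'0 Hd'] := acg _ e2.
exists (Num.min d d'); first by rewrite lt_min d0.
move=> n x y xy dj; rewrite lt_min => /andP[s1 s2].
have h1 := Hd n x y xy dj s1; have h2 := Hd' n x y xy dj s2.
rewrite [ltRHS]splitr; apply: (le_lt_trans _ (ltrD h1 h2)).
rewrite -big_split/=; apply: ler_sum => i _.
have -> : f (y i) - g (y i) - (f (x i) - g (x i)) = (f (y i) - f (x i)) - (g (y i) - g (x i)) by ring.
exact: ler_normB.
Qed.

(* Closed approximations from inside of the set where the derivative of h is at
   most M: they make a Vitali covering unnecessary in the mean value inequality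
   for absolutely continuous functions. *)
Definition slow h a b M (n : nat) : set R :=
  [set x | a <= x <= b /\ forall y, `|y - x| < n.+1%:R^-1 -> `|h y - h x| <= M * `|y - x|].

Lemma slow_closed h a b M n : continuous h -> closed (slow h a b M n).
Proof.
move=> ch.
have -> : slow h a b M n = `[a, b] `&` \bigcap_(y in setT)
    ((fun x => `|y - x|) @^-1` [set z | n.+1%:R^-1 <= z] `|`
     (fun x => `|h y - h x| - M * `|y - x|) @^-1` [set z | z <= 0]).
  apply/seteqP; split=> [x [xab H]|x [xab H]].
    split=> [|y _]/=; first by rewrite /= in_itv.
    by have [|/H] := leP n.+1%:R^-1 `|y - x|; [left|right; rewrite subr_le0].
  split=> [|y yx]; first by move: xab; rewrite /= in_itv.
  by have [/=|/=] := H y I; [rewrite leNgt yx|rewrite subr_le0].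
apply: closedI; first exact: interval_closed.
have cn y : continuous (fun x : R => `|y - x|).
  move=> x; apply: (@continuous_comp _ _ _ (fun x => y - x) Num.Def.normr); last exact: norm_continuous.
  by apply: cvgB; [exact: cvg_cst|exact: cvg_id].
apply: closed_bigI => y _; apply: closedU.
  by apply: (continuous_closedP _).1; [exact: cn|exact: closed_ge].
apply: (continuous_closedP _).1; last exact: closed_le.
move=> x; apply: cvgB; last by apply: cvgM; [exact: cvg_cst|exact: cn].
apply: (@continuous_comp _ _ _ (fun x => h y - h x) Num.Def.normr); last exact: norm_continuous.
by apply: cvgB; [exact: cvg_cst|exact: ch].
Qed.

Lemma slow_mono h a b M n m : (n <= m)%N -> slow h a b M n `<=` slow h a b M m.
Proof.
move=> nm x [xab H]; split=> // y yx; apply: H; apply: (lt_le_trans yx).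
by rewrite lef_pV2 ?posrE// ler_nat.
Qed.

Lemma slow_exhaust h a b M M' d x : M < M' -> a <= x <= b -> isd h x d -> `|d| <= M ->
  exists n, slow h a b M' n x.
Proof.
move=> MM' xab /isdP; rewrite -subr_gt0 in MM' => /(_ _ MM')[s s0 Hs] dM.
exists (Num.truncn s^-1); split=> // y yx.
have ys : `|y - x| < s.
  rewrite (lt_trans yx)// invf_plt ?posrE// Num.Theory.truncnS_gt//.
have -> : h y - h x = (h y - h x - d * (y - x)) + d * (y - x) by rewrite subrK.
rewrite (le_trans (ler_normD _ _))// -[M'](subrK M) mulrDl lerD ?Hs//.
by rewrite normrM ler_wpM2r.
Qed.

(** Continuity from above: inside an interval of finite measure the complements of the slow sets
    decrease to a null set, by [slow_exhaust]. *)
Lemma slow_measure h a b M M' e : continuous h -> M < M' -> 0 < e -> a <= b ->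
  {ae mu, forall x, a <= x <= b -> exists2 d, isd h x d & `|d| <= M} ->
  exists n, (mu (`[a, b] `\` slow h a b M' n) < e%:E)%E.
Proof.
move=> ch MM' e0 ab [N [mN N0 HN]].
pose F n := `[a, b] `\` slow h a b M' n.
have mF n : measurable (F n).
  by apply: measurableD => //; apply: measurable_realfun.closed_measurable; exact: slow_closed.
have FN : \bigcap_n F n `<=` N.
  move=> x Fx; apply: HN => /= H.
  have [/= xab _] := Fx 0%N I; rewrite in_itv/= in xab.
  have [d dx dM] := H xab.
  have [n sn] := slow_exhaust MM' xab dx dM.
  by have [_] := Fx n I; apply.
have muF : mu (\bigcap_n F n) = 0%E.
  apply/eqP; rewrite eq_le measure_ge0 andbT -N0 le_measure ?inE//.
  exact: bigcapT_measurable.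
have Fle n : (mu (F n) <= mu `[a, b])%E.
  apply: le_measure; rewrite ?inE; [exact: mF|exact: measurable_itv|exact: subDsetl].
have ab_fin : (mu `[a, b] < +oo)%E.
  by rewrite lebesgue_measure_itv/=; case: ifP; rewrite ?ltry// -EFinB ltry.
have cF : (mu \o F) x @[x --> \oo] --> mu (\bigcap_n F n).
  apply: nonincreasing_cvg_mu => //.
  - exact: le_lt_trans (Fle 0%N) ab_fin.
  - exact: bigcapT_measurable.
  - by move=> n m nm; apply/subsetPset; apply: setDS; exact: slow_mono.
move: cF; rewrite muF => /fine_cvgP[_] /cvgrPdist_lt /(_ e e0)[n _ /(_ n (leqnn n))]/= Hn.
exists n; rewrite -/(F n).
have fF : mu (F n) \is a fin_num.
  by rewrite ge0_fin_numE ?measure_ge0//; exact: le_lt_trans (Fle n) ab_fin.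
rewrite -(fineK fF) lte_fin; move: Hn; rewrite sub0r normrN.
by apply: le_lt_trans; exact: ler_norm.
Qed.

(* On a fine partition of [a, b], the cells meeting the slow set contribute at most
   M' (b - a), and the other ones have small total length. *)
Lemma ac_mvt_eps h a b M e : rAC h -> 0 <= M -> a <= b -> 0 < e ->
  {ae mu, forall x, a <= x <= b -> exists2 d, isd h x d & `|d| <= M} ->
  `|h b - h a| <= (M + e) * (b - a) + e.
Proof.
move=> ach M0 ab e0 aeM; have [d d0 Hd] := ach _ e0.
have ch := rAC_cts ach.
have MM' : M < M + e by rewrite ltrDl.
have [n Hn] := slow_measure ch MM' d0 ab aeM.
(* The cells are narrower than 1 / (n + 1), the scale up to which a slow point controls
   increments. *)
pose N := (Num.truncn ((b - a) * n.+1%:R)).+1.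
have N0 : 0 < N%:R :> R by rewrite ltr0n.
pose c (i : nat) := a + (b - a) * i%:R / N%:R.
pose w := (b - a) / N%:R.
have w0 : 0 <= w by rewrite divr_ge0 ?subr_ge0// ltW.
have cS i : c i.+1 = c i + w by rewrite /c /w -natr1; field; rewrite gt_eqF.
have c0 : c 0%N = a by rewrite /c mulr0 mul0r addr0.
have cN : c N = b by rewrite /c mulfK ?gt_eqF// addrC subrK.
have cmono i j : (i <= j)%N -> c i <= c j.
  by move=> ij; rewrite /c lerD2l ler_pM2r ?invr_gt0// ler_wpM2l ?subr_ge0// ler_nat.
have wn : w < n.+1%:R^-1.
  by rewrite /w ltr_pdivrMr// mulrC ltr_pdivlMr// Num.Theory.truncnS_gt.
pose bad i := ~~ `[< exists x, slow h a b (M + e) n x /\ c i <= x <= c i.+1 >].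
(* Good cells are collapsed to a point, so that absolute continuity can be applied to a family
   indexed by all cells. *)
pose y i := if bad i then c i.+1 else c i.
have cy i : c i <= y i by rewrite /y; case: ifP => // _; exact: cmono.
have yc i : y i <= c i.+1 by rewrite /y; case: ifP => // _; exact: cmono.
pose G i := if bad i && (i < N)%N then `]c i, c i.+1[%classic else set0.
have Gin i x : G i x -> c i < x < c i.+1.
  by rewrite /G; case: ifP => // _; rewrite /= in_itv.
have mG i : measurable (G i) by rewrite /G; case: ifP => // _; exact: measurable_itv.
have tG : trivIset setT G.
  move=> i j _ _ [x [/Gin/andP[ix xi] /Gin/andP[jx xj]]].
  case: (ltngtP i j) => // lt.
    by have := cmono _ _ lt; rewrite leNgt (lt_trans jx xi).
  by have := cmono _ _ lt; rewrite leNgt (lt_trans ix xj).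
have GF : \big[setU/set0]_(i < N) G i `<=` `[a, b] `\` slow h a b (M + e) n.
  move=> x; rewrite -bigcup_mkord => -[i /= iN Gx].
  have /andP[ix xi] := Gin _ _ Gx.
  split=> [|sx].
    rewrite /= in_itv/= -{1}c0 -cN (le_trans (cmono 0%N i _) (ltW ix))//=.
    by rewrite (le_trans (ltW xi))// cmono.
  move: Gx; rewrite /G; case: ifP => // /andP[/negP bi _] _; apply: bi.
  by apply/asboolP; exists x; rewrite !ltW.
have muG i : (i < N)%N -> mu (G i) = (y i - c i)%:E.
  move=> iN; rewrite /G /y iN andbT; case: ifP => _; last by rewrite measure0 subrr.
  rewrite lebesgue_measure_itv/= lte_fin; case: ifP => [_|/negbT]; first by rewrite EFinB.
  by rewrite -leNgt => le; rewrite (@le_anti _ _ (c i.+1) (c i)) ?subrr// le cmono.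
have sumd : \sum_(i < N) (y i - c i) < d.
  rewrite -lte_fin -sumEFin (eq_bigr (fun i : 'I_N => mu (G i))); last by move=> i _; rewrite muG.
  rewrite -measure_bigsetU//; apply: le_lt_trans Hn; apply: le_measure => //; rewrite inE.
    by apply: bigsetU_measurable => i _; exact: mG.
  apply: measurableD => //; apply: measurable_realfun.closed_measurable.
  exact: slow_closed.
have := Hd N (fun i => c i) (fun i => y i) (fun i => cy i).
have dj (i j : 'I_N) : i != j -> y i <= c j \/ y j <= c i.
  rewrite neq_ltn => /orP[ij|ij]; [left|right]; exact: le_trans (yc _) (cmono _ _ ij).
move=> /(_ dj sumd) Hs.
have -> : h b - h a = \sum_(i < N) (h (c i.+1) - h (c i)).
  by rewrite -(big_mkord xpredT (fun i => h (c i.+1) - h (c i))) telescope_sumr// c0 cN.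
rewrite (le_trans (ler_norm_sum _ _ _))//.
apply: (@le_trans _ _ (\sum_(i < N) (M + e) * w + \sum_(i < N) `|h (y i) - h (c i)|)).
  rewrite -big_split/=; apply: ler_sum => i _; rewrite /y.
  case: ifP => [_|/negbFE/asboolP[x [[xab sx] /andP[ix xi]]]].
    by rewrite lerDr mulr_ge0// addr_ge0// ltW.
  rewrite subrr normr0 addr0 -(subrK (h x) (h (c i.+1))) -addrA.
  have h1 : `|h (c i.+1) - h x| <= (M + e) * `|c i.+1 - x|.
    apply: sx; rewrite ger0_norm ?subr_ge0// (le_lt_trans _ wn)// cS; lra.
  have h2 : `|h (c i) - h x| <= (M + e) * `|c i - x|.
    apply: sx; rewrite distrC ger0_norm ?subr_ge0// (le_lt_trans _ wn)//.
    by rewrite cS in xi; lra.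
  rewrite (le_trans (ler_normD _ _))// [`|h x - _|]distrC (le_trans (lerD h1 h2))//.
  have Me : 0 <= M + e by rewrite addr_ge0// ltW.
  rewrite -mulrDr; apply: ler_wpM2l => //.
  by rewrite ger0_norm ?subr_ge0// distrC ger0_norm ?subr_ge0// cS; lra.
rewrite sumr_const card_ord -mulr_natr -mulrA /w divfK ?gt_eqF// lerD2l ltW//.
Qed.

Lemma ac_mvt h a b M : rAC h -> 0 <= M -> a <= b ->
  {ae mu, forall x, a <= x <= b -> exists2 d, isd h x d & `|d| <= M} ->
  `|h b - h a| <= M * (b - a).
Proof.
move=> ach M0 ab aeM; apply/ler_addgt0Pr => /= e e0.
have ba : 0 < b - a + 1 by rewrite ltr_wpDl ?subr_ge0.
have e1 : 0 < e / (b - a + 1) by rewrite divr_gt0.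
rewrite (le_trans (ac_mvt_eps ach M0 ab e1 aeM))// mulrDl -addrA lerD2l.
rewrite -[X in _ + X]mulr1 -mulrDr divfK// gt_eqF//.
Qed.

End AbsoluteContinuity.

(** * From derivatives almost everywhere to classical derivatives *)

Section Sobolev.
Context {R : realType}.
Implicit Types (f g h G : R -> R) (x y z t e d M : R).
Local Notation isd f x d := (is_derive (x : R) (1 : R) (f : R -> R) (d : R)).
Local Notation mu := (@lebesgue_measure R).

Lemma lebesgue_shift t (X : set R) : measurable X ->
  mu ((fun x => x - t) @^-1` X) = mu X.
Proof.
move=> mX.
have mt : @measurable_fun _ _ (measurableTypeR R) (measurableTypeR R) setT (fun x : R => x - t).
  by apply: measurable_realfun.continuous_measurable_fun => x; apply: cvgB; [exact: cvg_id|exact: cvg_cst].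
pose f : {mfun measurableTypeR R >-> measurableTypeR R} :=
  HB.pack (fun x : R => x - t : measurableTypeR R) (isMeasurableFun.Build _ _ _ _ _ mt).
rewrite -[LHS]/(pushforward mu f X).
apply/esym/lebesgue_measure_unique => //= _ [[a b]] _ <-.
rewrite /pushforward/=.
have -> : f @^-1` `]a, b] = `]a + t, b + t]%classic.
  by apply/seteqP; split=> x; rewrite /= !in_itv/= /f/= ltrBrDr lerBlDr.
rewrite !lebesgue_measure_itv/= !lte_fin ltrD2r; case: ifP => // _.
by rewrite -!EFinB; congr EFin; ring.
Qed.

Lemma aeS (P Q : R -> Prop) : {ae mu, forall x, P x} -> (forall x, P x -> Q x) ->
  {ae mu, forall x, Q x}.
Proof.
move=> [N [mN N0 HN]] PQ; exists N; split=> // x /= Qx; apply: HN => /= Px.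
exact/Qx/PQ.
Qed.

Lemma ae_and (P Q : R -> Prop) : {ae mu, forall x, P x} -> {ae mu, forall x, Q x} ->
  {ae mu, forall x, P x /\ Q x}.
Proof.
move=> nP nQ; have := negligibleU nP nQ; apply: negligibleS => x /= /not_andP[]; by [left|right].
Qed.

Lemma ae_shift (P : R -> Prop) t : {ae mu, forall x, P x} ->
  {ae mu, forall x, P (x - t)}.
Proof.
move=> [N [mN N0 HN]]; exists ((fun x => x - t) @^-1` N); split.
- have mt : measurable_fun setT (fun x : R => x - t).
    by apply: measurable_realfun.continuous_measurable_fun => x; apply: cvgB; [exact: cvg_id|exact: cvg_cst].
  by have := mt measurableT N mN; rewrite setTI.
- by rewrite lebesgue_shift.
- by move=> x /= Px; apply: HN.
Qed.

Lemma ae_dense (P : R -> Prop) x e : {ae mu, forall x, P x} -> 0 < e ->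
  exists2 y, `|y - x| < e & P y.
Proof.
move=> [N [mN N0 HN]] e0; apply: contrapT => H.
have sub : `]x - e, x + e[ `<=` N.
  move=> y; rewrite /= in_itv/= => /andP[y1 y2]; apply: HN => Py; apply: H.
  by exists y => //; rewrite ltr_norml; lra.
have : (mu `](x - e)%R, (x + e)%R[ <= mu N)%E by apply: le_measure; rewrite ?inE.
have lt : x - e < x + e by lra.
have pos : 0 < (x + e) - (x - e) by rewrite subr_gt0.
by rewrite N0 lebesgue_measure_itv/= lte_fin lt -EFinB lee_fin leNgt pos.
Qed.

(** Near x the derivative of g(z) - G(x) z is almost everywhere at most e in modulus, so [ac_mvt]
    bounds its increments by e times the distance. *)
Lemma ac_derive_cts g G : rAC g -> {ae mu, forall x, isd g x (G x)} ->
  continuous G -> forall x, isd g x (G x).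
Proof.
move=> acg dg cG x; apply/isdP => e e0.
have [s s0 Hs] := (ctsP G x).1 (cG x) e e0.
exists s => // y yx.
have ach : rAC (fun z => g (z + 0) - G x * z) by exact: rAC_lin.
have key a b : a <= b -> (forall z, a <= z <= b -> `|x - z| < s) ->
    `|(g b - G x * b) - (g a - G x * a)| <= e * (b - a).
  move=> ab Hab; have := @ac_mvt R _ a b e ach (ltW e0) ab; rewrite !addr0; apply.
  apply: (aeS dg) => z dz zab; exists (G z - G x); last by rewrite distrC ltW// Hs// Hab.
  have -> : (fun z => g (z + 0) - G x * z) = (fun z => g z - G x * z).
    by apply/funext => u; rewrite addr0.
  apply: isd_eq (isdB dz (isdZ (G x) (is_derive_id z 1))) _.
  by rewrite mulr1.
have -> : g y - g x - G x * (y - x) = (g y - G x * y) - (g x - G x * x) by ring.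
have [xley|/ltW ylex] := leP x y.
  rewrite [`|y - x|]ger0_norm ?subr_ge0//; apply: key => // z zxy.
  by move: yx; rewrite ger0_norm ?subr_ge0// distrC ger0_norm; lra.
rewrite distrC [`|y - x|]distrC [`|x - y|]ger0_norm ?subr_ge0//; apply: key => // z zxy.
by move: yx; rewrite distrC ger0_norm ?subr_ge0// ger0_norm; lra.
Qed.

(* G is only controlled almost everywhere; the derivative at an arbitrary point is
   recovered as a lower limit of G along the good points. *)
Lemma ac_derive_holder g G (K tau : R) : rAC g -> {ae mu, forall x, isd g x (G x)} ->
  0 < K -> 0 < tau ->
  (forall t, {ae mu, forall x, `|G x - G (x - t)| <= K * `|t| `^ tau}) ->
  exists G', continuous G' /\ forall x, isd g x (G' x).
Proof.
move=> acg dg K0 tau0 LG.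
pose om (s : R) := K * s `^ tau.
have om_mono s s' : 0 <= s -> s <= s' -> om s <= om s'.
  move=> s0 ss'; rewrite /om ler_pM2l// ge0_ler_powR ?nnegrE//; first exact: ltW.
  exact: le_trans ss'.
have om_ge0 s : 0 <= om s by rewrite /om mulr_ge0 ?powR_ge0 ?ltW.
have om_small e : 0 < e -> exists2 s, 0 < s & om s <= e.
  move=> e0; exists ((e / K) `^ tau^-1); first by apply: powR_gt0; exact: divr_gt0.
  rewrite /om -powRrM mulVf ?gt_eqF// powRr1; last by apply: divr_ge0; exact: ltW.
  by rewrite mulrCA divff ?gt_eqF// mulr1 lexx.
(* Mean value inequality for g(x) - g(x - t), whose derivative is almost everywhere bounded by the
   modulus [om]. *)
have inc t a b : a <= b -> `|(g b - g (b - t)) - (g a - g (a - t))| <= om `|t| * (b - a).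
  move=> ab.
  have acd : rAC (fun x => (g (x + 0) - 0 * x) - (g (x + (- t)) - 0 * x)).
    by apply: rAC_sub; exact: rAC_lin.
  have := @ac_mvt R _ a b (om `|t|) acd (om_ge0 _) ab; rewrite !addr0 !mul0r !subr0; apply.
  have := ae_and (ae_and dg (ae_shift t dg)) (LG t).
  move=> /aeS; apply=> z [[d1 d2] d3] zab; exists (G z - G (z - t)) => //.
  have -> : (fun x => g (x + 0) - 0 * x - (g (x - t) - 0 * x)) =
      (fun x => g x - g (1 * x + (- t))).
    by apply/funext => u; rewrite !mul0r !subr0 addr0 mul1r.
  apply: isd_eq (isdB d1 (@isd_lin _ g 1 (- t) z (G (z - t)) _)) _; rewrite mul1r//.
(* Dividing [inc] by a small common step u turns the almost everywhere estimate on G into one at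
   every pair of points of differentiability. *)
have good z z' : isd g z (G z) -> isd g z' (G z') -> `|G z - G z'| <= om `|z - z'|.
  move=> /isdP dz /isdP dz'; apply/ler_addgt0Pr => /= e e0.
  have e2 : 0 < e / 2 by rewrite divr_gt0.
  have [s s0 Hs] := dz _ e2; have [s' s'0 Hs'] := dz' _ e2.
  pose u := Num.min s s' / 2.
  have u0 : 0 < u by rewrite divr_gt0// lt_min s0.
  have us : u < s by rewrite /u ltr_pdivrMr// gt_min ltr_pMr// ltr1n.
  have us' : u < s' by rewrite /u ltr_pdivrMr// gt_min [X in _ || X]ltr_pMr// ltr1n orbT.
  have := Hs (z + u); have := Hs' (z' + u); have := inc (z - z') z (z + u).
  rewrite lerDl (ltW u0) ![_ + u - _]addrAC !subrr !add0r !(gtr0_norm u0).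
  have -> : z - (z - z') = z' by ring.
  move=> /(_ isT) h1 /(_ us') h2 /(_ us) h3.
  rewrite -(ler_pM2r u0) -[X in _ * X <= _](gtr0_norm u0) -normrM.
  have -> : (G z - G z') * u = (g (z + u) - g (z' + u) - (g z - g z')) -
     (g (z + u) - g z - G z * u) + (g (z' + u) - g z' - G z' * u) by ring.
  rewrite (le_trans (ler_normD _ _))// mulrDl.
  have := ler_normB (g (z + u) - g (z' + u) - (g z - g z')) (g (z + u) - g z - G z * u).
  have -> : e * u = e / 2 * u + e / 2 * u by rewrite -mulrDl -splitr.
  by lra.
(* The supremum of [S x] is the lower limit of G at x along the points of differentiability, which
   are dense by [ae_dense]. *)
pose S x := [set c : R | exists2 s, 0 < s & forall z, isd g z (G z) -> `|z - x| < s -> c <= G z].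
pose G' x := sup (S x).
have G'G x s z : isd g z (G z) -> `|z - x| < s -> `|G' x - G z| <= om (2 * s).
  move=> dz zx; have s0 : 0 < s by exact: le_lt_trans zx.
  have lb : S x (G z - om (2 * s)).
    exists s => // z' dz' z'x; rewrite lerBlDr -lerBlDl.
    rewrite (le_trans (ler_norm _))// (le_trans (good _ _ dz dz'))// om_mono//.
    have -> : z - z' = (z - x) - (z' - x) by ring.
    by rewrite (le_trans (ler_normB _ _))//; lra.
  have ub : ubound (S x) (G z + om (2 * s)).
    move=> c [s' s'0 Hc].
    have [z' z'x dz'] := @ae_dense _ x (Num.min s s') dg ltac:(by rewrite lt_min s0).
    move: z'x; rewrite lt_min => /andP[z's z's'].
    rewrite (le_trans (Hc _ dz' z's'))// -lerBlDl.
    rewrite (le_trans (ler_norm _))// (le_trans (good _ _ dz' dz))// om_mono//.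
    have -> : z' - z = (z' - x) - (z - x) by ring.
    by rewrite (le_trans (ler_normB _ _))//; lra.
  rewrite ler_distl; apply/andP; split.
    by apply: ub_le_sup => //; exists (G z + om (2 * s)).
  by apply: ge_sup => //; exists (G z - om (2 * s)).
exists G'; split=> [x|x].
  apply/ctsP => e e0; have e4 : 0 < e / 4 by rewrite divr_gt0.
  have [s s0 Hs] := om_small _ e4.
  exists (s / 4); first by rewrite divr_gt0.
  move=> y xy; have [z zx dz] := @ae_dense _ x (s / 4) dg ltac:(by rewrite divr_gt0).
  have zx2 : `|z - x| < s / 2 by lra.
  have zy2 : `|z - y| < s / 2.
    have -> : z - y = (z - x) + (x - y) by ring.
    by rewrite (le_lt_trans (ler_normD _ _))//; lra.
  have := G'G x _ z dz zx2; have := G'G y _ z dz zy2.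
  have -> : 2 * (s / 2) = s by field.
  have -> : G' x - G' y = (G' x - G z) - (G' y - G z) by ring.
  by have := ler_normB (G' x - G z) (G' y - G z); lra.
apply/isdP => e e0; have e4 : 0 < e / 4 by rewrite divr_gt0.
have [s s0 Hs] := om_small _ e4.
exists (s / 4); first by rewrite divr_gt0.
move=> y yx; have [z zx dz] := @ae_dense _ x (s / 4) dg ltac:(by rewrite divr_gt0).
have key a b : a <= b -> (forall w, a <= w <= b -> `|w - x| < s / 4) ->
    `|(g b - G z * b) - (g a - G z * a)| <= e / 2 * (b - a).
  move=> ab Hab; have ach : rAC (fun w => g (w + 0) - G z * w) by exact: rAC_lin.
  have e2 : 0 <= e / 2 by rewrite divr_ge0// ltW.
  have := @ac_mvt R _ a b (e / 2) ach e2 ab; rewrite !addr0; apply.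
  apply: (aeS dg) => w dw wab; exists (G w - G z).
    have -> : (fun z0 => g (z0 + 0) - G z * z0) = (fun z0 => g z0 - G z * z0).
      by apply/funext => u; rewrite addr0.
    apply: isd_eq (isdB dw (isdZ (G z) (is_derive_id w 1))) _.
    by rewrite mulr1.
  rewrite (le_trans (good _ _ dw dz))// (le_trans (om_mono _ s _ _))//; last by lra.
  have -> : w - z = (w - x) - (z - x) by ring.
  by rewrite (le_trans (ler_normB _ _))//; have := Hab w wab; lra.
have kxy : `|(g y - G z * y) - (g x - G z * x)| <= e / 2 * `|y - x|.
  have [xley|/ltW ylex] := leP x y.
    rewrite [`|y - x|]ger0_norm ?subr_ge0//; apply: key => // w wxy.
    by move: yx; rewrite ger0_norm ?subr_ge0// ger0_norm; lra.
  rewrite distrC [`|y - x|]distrC [`|x - y|]ger0_norm ?subr_ge0//; apply: key => // w wxy.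
  by move: yx; rewrite distrC ger0_norm ?subr_ge0// distrC ger0_norm; lra.
have GG : `|G' x - G z| <= e / 4.
  by rewrite (le_trans (G'G x (s / 2) z dz _))//; [lra|rewrite mulrC divfK//].
have -> : g y - g x - G' x * (y - x) =
    ((g y - G z * y) - (g x - G z * x)) - (G' x - G z) * (y - x) by ring.
rewrite (le_trans (ler_normB _ _))// normrM.
have := ler_wpM2r (normr_ge0 (y - x)) GG; have := normr_ge0 (y - x).
by have : 0 <= e / 4 * `|y - x|; [rewrite mulr_ge0// ltW|lra].
Qed.

(** Below order n the next representative is absolutely continuous, hence continuous, so the
    derivatives are classical. Only in the case m = n does the Hoelder condition have to provide a
    continuous top derivative. *)
Lemma sobolev_realCk n m (g : nat -> R -> R) : (m <= n)%N ->
  (forall j, (j < n)%N -> rAC (g j)) ->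
  (forall j, (j < n)%N -> {ae mu, forall x, isd (g j) x (g j.+1 x)}) ->
  (0 < m)%N -> (m = n -> exists K tau : R, [/\ 0 < K, 0 < tau &
    forall t, {ae mu, forall x, `|g n x - g n (x - t)| <= K * `|t| `^ tau}]) ->
  realCk m (g 0%N).
Proof.
move=> mn acg dg m0 H.
have low j x : (j.+1 < n)%N -> isd (g j) x (g j.+1 x).
  move=> jn; apply: ac_derive_cts => //; [exact: acg (ltnW jn)|exact: dg (ltnW jn)|].
  exact/rAC_cts/acg.
have [mltn|] := ltnP m n.
  apply: realCk_chain => [j x jm|]; first by apply: low; exact: leq_ltn_trans mltn.
  exact/rAC_cts/acg.
move=> nm; have mE : m = n by apply/eqP; rewrite eqn_leq mn.
have [K [tau [K0 tau0 LG]]] := H mE; subst m; clear H nm mn.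
case: n m0 acg dg LG low => // n _ acg dg LG low.
have [G' [cG' dG']] := ac_derive_holder (acg n (leqnn _)) (dg n (leqnn _)) K0 tau0 LG.
pose g' j := if (j == n.+1)%N then G' else g j.
have -> : g 0%N = g' 0%N by [].
apply: realCk_chain => [j x jn|]; last by rewrite /g' eqxx.
rewrite /g' (ltn_eqF jn) eqSS; have [->//|jn'] := eqVneq j n.
by apply: low; rewrite ltnS ltn_neqAle jn' -ltnS.
Qed.

End Sobolev.

(** * Bump functions and integrals *)

Section Bump.
Context {R : realType}.
Implicit Types (f g h G : R -> R) (x y z t e d M : R).
Local Notation isd f x d := (is_derive (x : R) (1 : R) (f : R -> R) (d : R)).

Lemma isd_near f g x d s : 0 < s -> (forall y, `|y - x| < s -> f y = g y) ->
  isd f x d -> isd g x d.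
Proof.
move=> s0 fg /isdP df; apply/isdP => e /df[s' s'0 H].
exists (Num.min s s'); first by rewrite lt_min s0.
move=> y; rewrite lt_min => /andP[ys ys'].
by rewrite -!fg ?subrr ?normr0// H.
Qed.

Lemma realCkS m h h' : (forall x, isd h x (h' x)) -> realCk m h' -> realCk m.+1 h.
Proof.
move=> dh [d c]; have E j : derive1n j.+1 h = derive1n j h'.
  rewrite derive1Sn; congr (derive1n j _); apply/funext => x.
  by have hx := dh x; rewrite derive1E derive_val.
split=> [[|j] x jm|]; last by rewrite E.
  by have [] := dh x.
by rewrite E; exact: d.
Qed.

Lemma realCkSP m h : realCk m.+1 h -> realCk m (derive1n 1 h).
Proof.
move=> [d c]; have E j : derive1n j (derive1n 1 h) = derive1n j.+1 h.
  by rewrite derive1n1 -derive1Sn.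
split=> [j x jm|]; rewrite E//; exact: d.
Qed.

Lemma realCk_lin m c f g : realCk m f -> realCk m g -> realCk m (fun x => c * f x + g x).
Proof.
move=> Cf Cg.
apply: (@realCk_chain _ m (fun j x => c * derive1n j f x + derive1n j g x)) => [j x jm|].
  exact: (@isdD _ (fun x => c * derive1n j f x) (derive1n j g) x _ _
    (isdZ c (realCk_derive x Cf jm)) (realCk_derive x Cg jm)).
by move=> x; apply: cvgD; [apply: cvgM; [exact: cvg_cst|case: Cf => _; exact]|case: Cg => _; exact].
Qed.

Lemma realCk_mul m f g : smoothR f -> smoothR g -> realCk m (fun x => f x * g x).
Proof.
elim: m f g => [|m IH] f g sf sg.
  split=> // x; apply: cvgM; [have [_ +] := sf 0%N|have [_ +] := sg 0%N]; exact.
have dsm h : smoothR h -> smoothR (derive1n 1 h) by move=> sh k; exact: realCkSP.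
apply: (@realCkS m (fun x => f x * g x) (fun x => 1 * (derive1n 1 f x * g x) + f x * derive1n 1 g x)).
  move=> x; rewrite mul1r; exact: isdM (smoothR_derive 0 x sf) (smoothR_derive 0 x sg).
by apply: realCk_lin; apply: IH => //; exact: dsm.
Qed.

Lemma smoothR_mul f g : smoothR f -> smoothR g -> smoothR (fun x => f x * g x).
Proof. by move=> sf sg m; exact: realCk_mul. Qed.

(* p(1/x) exp(-1/x) on the positive half-line; differentiation acts on p by
   p |-> X^2 (p - p'). *)
Definition flat (p : {poly R}) x := if 0 < x then p.[x^-1] * expR (- x^-1) else 0.

(** From exp(s) >= s^(n+1) / (n+1)!; the gain of a factor 1/s over mere boundedness is what the
    origin requires in [isd_flat]. *)
Lemma poly_expR_bound (p : {poly R}) : exists2 B : R, 0 <= B &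
  forall s, 1 <= s -> `|p.[s] * expR (- s)| <= B / s.
Proof.
pose n := size p; pose S := \sum_(i < n) `|p`_i|.
have S0 : 0 <= S by exact: sumr_ge0.
exists (S * (n.+1)`!%:R); first by rewrite mulr_ge0.
move=> s s1; have s0 : 0 < s by exact: lt_le_trans s1.
have ps : `|p.[s]| <= S * s ^+ n.
  rewrite horner_coef (le_trans (ler_norm_sum _ _ _))// mulr_suml ler_sum// => i _.
  rewrite normrM ler_wpM2l// ger0_norm ?exprn_ge0 ?(ltW s0)//.
  by rewrite ler_weXn2l// ltnW.
rewrite normrM [`|expR _|]ger0_norm ?expR_ge0// (le_trans (ler_wpM2r (expR_ge0 _) ps))//.
rewrite -!mulrA ler_wpM2l// expRN ler_pdivrMr ?expR_gt0// mulrAC ler_pdivlMr//.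
rewrite -exprSr mulrC -ler_pdivrMr ?ltr0n ?fact_gt0//.
by have := expR_ge1Dxn n (ltW s0); lra.
Qed.

Lemma isd_flat (p : {poly R}) x : isd (flat p) x (flat ('X^2 * (p - p^`())) x).
Proof.
have [x0|x0|->] := ltgtP x 0.
- apply: (@isd_near (fun=> 0) _ _ _ (- x)); rewrite ?oppr_gt0//.
    move=> y yx; rewrite /flat ifF//; apply/negbTE; rewrite -leNgt.
    by have := ler_norm (y - x); lra.
  by rewrite /flat ifF ?(lt_gtF x0)//; exact: isd_cst.
- apply: (@isd_near (fun x => p.[x^-1] * expR (- x^-1)) _ _ _ x) => //.
    move=> y yx; rewrite /flat ifT//.
    by have := ler_norm (x - y); rewrite distrC in yx; lra.
  have xn : x != 0 by rewrite gt_eqF.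
  have dV : isd (fun x => x^-1) x (- x ^- 2).
    have := @is_deriveV _ id x 1 1 xn (is_derive_id x 1).
    by rewrite [_ *: _]mulr1.
  have dp : isd (fun x => p.[x^-1]) x (p^`().[x^-1] * - x ^- 2).
    exact: (@is_derive1_comp _ (horner p) (fun x => x^-1) x _ _ (is_derive_poly _ _) dV).
  have dE : isd (fun x => expR (- x^-1)) x (expR (- x^-1) * (x ^- 2)).
    apply: (@is_derive1_comp _ expR (fun x => - x^-1) x) => //.
    by rewrite -[x ^- 2]opprK; exact: is_deriveN.
  apply: (isd_eq (isdM dp dE)); rewrite /flat x0 hornerM hornerXn hornerD hornerN exprVn.
  by ring.
- have f0 q : flat q 0 = 0 by rewrite /flat ltxx.
  rewrite f0; apply/isdP => e e0.
  (* Applied to X p, the bound reads |flat p y| <= B y^2, so the difference quotient at 0 tends to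
     0. *)
  have [B B0 HB] := poly_expR_bound ('X * p).
  exists (Num.min 1 (e / (B + 1))); first by rewrite lt_min ltr01 divr_gt0// ltr_wpDl.
  move=> y; rewrite f0 !subr0 lt_min => /andP[y1 ye]; rewrite mul0r subr0 /flat.
  case: ifP => y0; last by rewrite normr0 mulr_ge0// ltW.
  rewrite (gtr0_norm y0) in y1 ye *.
  have := HB y^-1; rewrite invf_ge1// => /(_ (ltW y1)).
  rewrite invrK !hornerE -mulrA normrM gtr0_norm ?invr_gt0// mulrC ler_pdivrMr// => h.
  rewrite (le_trans h)// -mulrA [X in _ <= X]mulrC.
  rewrite [leRHS]mulrC mulrA ler_wpM2r ?(ltW y0)//.
  have : y * (B + 1) < e by rewrite -ltr_pdivlMr// ltr_wpDl.
  by nra.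
Qed.

Lemma smoothR_flat (p : {poly R}) : smoothR (flat p).
Proof.
pose P j := iter j (fun p : {poly R} => 'X^2 * (p - p^`())) p.
exact: (@smoothR_chain _ (fun j => flat (P j)) (fun j x => isd_flat (P j) x)).
Qed.

Lemma smoothR_affine f s t : smoothR f -> smoothR (fun x => f (s * x + t)).
Proof.
move=> sf.
have := @smoothR_chain R (fun j x => s ^+ j * derive1n j f (s * x + t)).
rewrite /= (_ : (fun x => s ^+ 0 * f (s * x + t)) = fun x => f (s * x + t)); last first.
  by apply/funext => x; rewrite expr0 mul1r.
apply=> j x; rewrite exprSr -mulrA; apply: isdZ; apply: isd_lin.
exact: smoothR_derive.
Qed.

Lemma bump_exists x0 d : 0 < d -> exists b : R -> R, [/\ smoothR b,
  forall x, 0 <= b x, b x0 > 0 & forall x, d <= `|x - x0| -> b x = 0].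
Proof.
move=> d0; pose b x := flat 1 ((-1) * x + (d + x0)) * flat 1 (1 * x + (d - x0)).
have fge0 x : 0 <= flat 1 x.
  by rewrite /flat; case: ifP => // _; rewrite hornerC mul1r expR_ge0.
exists b; split.
- by apply: smoothR_mul; apply: smoothR_affine; exact: smoothR_flat.
- by move=> x; rewrite mulr_ge0.
- rewrite /b /flat; have -> : -1 * x0 + (d + x0) = d by ring.
  have -> : 1 * x0 + (d - x0) = d by ring.
  by rewrite d0 hornerC mul1r mulr_gt0 ?expR_gt0.
move=> x; rewrite ler_normr /b /flat => /orP[h|h].
  by rewrite ifF ?mul0r//; apply/negbTE; rewrite -leNgt; lra.
by rewrite [X in _ * X]ifF ?mulr0//; apply/negbTE; rewrite -leNgt; lra.
Qed.

End Bump.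

(** * Integrals of compactly supported continuous functions *)

Section Integrals.
Context {R : realType}.
Implicit Types (f g h G : R -> R) (x y z t e d M K : R).
Local Notation isd f x d := (is_derive (x : R) (1 : R) (f : R -> R) (d : R)).
Local Notation mu := (@lebesgue_measure R).

Lemma cs_patch f K : (forall x, K < `|x| -> f x = 0) -> f \_ `[- K, K] = f.
Proof.
move=> f0; apply/funext => x; rewrite /patch; case: ifPn => //.
rewrite mem_setE in_itv/= -ler_norml -ltNge => /f0 ->//.
Qed.

Lemma cs_integrable f K : continuous f -> (forall x, K < `|x| -> f x = 0) ->
  mu.-integrable setT (EFin \o f).
Proof.
move=> cf f0.
have iK : mu.-integrable `[- K, K] (EFin \o f).
  apply: continuous_compact_integrable; first exact: segment_compact.
  exact: continuous_subspaceT.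
have := (@integrable_mkcond _ _ R mu `[- K, K] (EFin \o f) (measurable_itv _)).1 iK.
by rewrite restrict_EFin cs_patch.
Qed.

(** The primitive starts at - K - 1, so that - K is an interior point and the derivative exists
    there as well. This reduces integrals to the mean value theorem. *)
Lemma cs_integral f K : continuous f -> 0 < K -> (forall x, K < `|x| -> f x = 0) ->
  exists2 G, (forall x, - K <= x -> isd G x (f x)) &
    Rintegral mu setT f = G K - G (- K).
Proof.
move=> cf K0 f0.
pose a := - K - 1.
pose G x : R := (\int[mu]_(t in `[a, x]) f t)%R.
have iT := cs_integrable cf f0.
have dG x : - K <= x -> isd G x (f x).
  move=> Kx; have ax : a < x by rewrite /a; lra.
  have iax : mu.-integrable `[a, x + 1] (EFin \o f) by apply: integrableS iT.
  have xx1 : x < x + 1 by rewrite ltrDl.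
  have [dF EF] := @continuous_FTC1_closed R f a x (x + 1) xx1 iax ax (cf x).
  by rewrite -EF derive1E; exact: derivableP.
exists G => //.
have KK : - K < K by lra.
rewrite -[f in LHS](cs_patch f0) -Rintegral_mkcond /Rintegral.
rewrite (@continuous_FTC2 R f G (- K) K) //.
- exact: continuous_subspaceT.
- split=> [x|  |].
  + by rewrite in_itv/= => /andP[/ltW Kx _]; have [] := dG x Kx.
  + by apply: cvg_at_right_filter; have := isd_cts (dG (- K) (lexx _)).
  + by apply: cvg_at_left_filter; have := isd_cts (dG K (ltW KK)).
move=> x; rewrite in_itv/= => /andP[/ltW Kx _].
by rewrite derive1E; have dx := dG x Kx; rewrite derive_val.
Qed.

Lemma sum_zr_shift (F : int -> R) (M : nat) :
  \sum_(k <- zr M) F k = \sum_(0 <= i < M.*2.+1) F (i%:Z - M%:Z).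
Proof. by rewrite /zr big_map /index_iota subn0. Qed.

(** On each cell the increment of the primitive is 2^-n times a value of f in that cell, which
    uniform continuity compares with the value at the left end. *)
Lemma riemann_sum f (K : nat) e : continuous f -> (0 < K)%N ->
  (forall x, K%:R <= `|x| -> f x = 0) -> 0 < e -> exists N, forall n, (N <= n)%N ->
  `|2 ^- n * \sum_(k <- zr (2 ^ n * K)) f (2 ^- n * k%:~R) - Rintegral mu setT f| <= e.
Proof.
move=> cf K0 f0 e0; have KR : 0 < K%:R :> R by rewrite ltr0n.
have [G dG ->] := @cs_integral f K%:R cf KR (fun x (h : K%:R < `|x|) => f0 x (ltW h)).
have K2 : 0 < 2 * K%:R + 2 :> R by rewrite ltr_wpDl// mulr_ge0.
have e1 : 0 < e / (2 * K%:R + 2) by rewrite divr_gt0.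
have [d d0 Hd] := heine K%:R cf e1.
exists (Num.truncn d^-1).+1 => n Nn.
have p2 : 0 < 2 ^+ n :> R by rewrite exprn_gt0.
have hn : 2 ^- n < d :> R.
  rewrite invf_plt ?posrE//; apply: (@lt_le_trans _ _ (Num.truncn d^-1).+1%:R).
    by rewrite Num.Theory.truncnS_gt.
  rewrite (le_trans (_ : _ <= n%:R)) ?ler_nat//.
  by rewrite -natrX ler_nat ltnW// ltn_expl.
pose M := (2 ^ n * K)%N.
have MR : M%:R = 2 ^+ n * K%:R :> R by rewrite /M natrM natrX.
pose c (i : nat) : R := 2 ^- n * (i%:R - M%:R).
have c0 : c 0%N = - K%:R by rewrite /c sub0r MR mulrN mulKf// gt_eqF.
have cM : c M.*2 = K%:R.
  by rewrite /c -addnn natrD addrK MR mulKf// gt_eqF.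
have cS i : c i.+1 = c i + 2 ^- n by rewrite /c -natr1; ring.
have cle i j : (i <= j)%N -> c i <= c j.
  by move=> ij; rewrite /c ler_pM2l ?invr_gt0// lerD2r ler_nat.
have cb i : (i <= M.*2)%N -> - K%:R <= c i <= K%:R.
  by move=> iM; rewrite -{1}c0 -cM !cle.
(* The last node is K, where f vanishes; the remaining nodes are exactly the left ends of the
   cells. *)
rewrite sum_zr_shift big_nat_recr//= [f (_ * _)]f0 ?addr0; last first.
  rewrite -/M (_ : _ * _ = c M.*2) ?cM ?ger0_norm ?ler0n//.
  by rewrite /c rmorphB.
have -> : G K%:R - G (- K%:R) = \sum_(0 <= i < M.*2) (G (c i.+1) - G (c i)).
  by rewrite telescope_sumr// c0 cM.
rewrite mulr_sumr -sumrB (le_trans (ler_norm_sum _ _ _))//.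
apply: (@le_trans _ _ (\sum_(0 <= i < M.*2) (e / (2 * K%:R + 2) * 2 ^- n))).
  rewrite big_nat [leRHS]big_nat; apply: ler_sum => i /andP[_ iM].
  have /andP[ic ci] := cb i (ltnW iM).
  have -> : f (2 ^- n * (i%:Z - M%:Z)%:~R) = f (c i) by rewrite /c rmorphB.
  have cc : c i <= c i.+1 by exact: cle.
  have [||z zi ->] := @MVT_segment R G f (c i) (c i.+1) cc.
  - move=> x; rewrite in_itv/= => /andP[/ltW xi _]; apply: dG; exact: le_trans xi.
  - apply: derivable_within_continuous => x; rewrite in_itv/= => /andP[xi _].
    by have [] := dG x (le_trans ic xi).
  rewrite cS [c i + _ - _]addrC addKr mulrC -mulrBl normrM [`|2 ^- n|]gtr0_norm ?invr_gt0//.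
  rewrite ler_pM2r ?invr_gt0//; apply/ltW/Hd.
    by rewrite ler_norml ic ci.
  move: zi; rewrite in_itv/= => /andP[zi]; rewrite cS => iz.
  by rewrite distrC ger0_norm ?subr_ge0//; lra.
rewrite sumr_const_nat subn0 -[leLHS]mulr_natr -addnn natrD MR.
have -> : e / (2 * K%:R + 2) / 2 ^+ n * (2 ^+ n * K%:R + 2 ^+ n * K%:R) =
   e * (2 * K%:R) / (2 * K%:R + 2) by field; rewrite !gt_eqF.
by rewrite ler_pdivrMr// ler_pM2l//; lra.
Qed.

(** Test with a bump supported where F keeps the sign of F(x0): the product has constant sign and
    integral 0, so it vanishes almost everywhere, hence at points as close to x0 as desired, where
    both factors are nonzero. *)
Lemma fundamental_lemma (F : R -> R) : continuous F ->
  (forall b, smoothR b -> (exists K, forall x, K < `|x| -> b x = 0) ->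
     Rintegral mu setT (fun x => F x * b x) = 0) ->
  forall x, F x = 0.
Proof.
move=> cF HF x0; apply/eqP/negPn/negP => F0.
have Fp : 0 < `|F x0| by rewrite normr_gt0.
have [d d0 Hd] := (ctsP F x0).1 (cF x0) _ Fp.
have [b [sb b0 bx0 bs]] := bump_exists x0 d0.
pose s := Num.sg (F x0).
have sF x : `|x - x0| < d -> s * F x = `|F x| /\ 0 < `|F x|.
  rewrite distrC => /Hd; rewrite /s; have [Fn|Fg|Fz] := ltgtP (F x0) 0.
  - rewrite (ltr0_sg Fn) mulN1r (ltr0_norm Fn) ltr_norml => /andP[h1 h2].
    by rewrite ltr0_norm; [split=> //|]; lra.
  - rewrite (gtr0_sg Fg) mul1r (gtr0_norm Fg) ltr_norml => /andP[h1 h2].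
    by rewrite gtr0_norm; [split=> //|]; lra.
  - by rewrite Fz eqxx in F0.
pose h x := F x * b x.
have cb : continuous b by have [_] := sb 0%N.
have ch : continuous h by move=> x; apply: cvgM; [exact: cF|exact: cb].
have hs : forall x, `|x0| + d < `|x| -> h x = 0.
  move=> x xd; rewrite /h bs ?mulr0//.
  by have := lerB_normD x (- x0); rewrite normrN; lra.
have ih := cs_integrable ch hs.
have habs x : `|h x| = s * h x.
  rewrite /h normrM (ger0_norm (b0 x)) mulrA.
  have [/sF[-> _]//|/bs->] := ltP `|x - x0| d; by rewrite !mulr0.
have : (\int[mu]_x `|(h x)%:E|)%E = 0%E.
  under eq_integral do rewrite abse_EFin habs EFinM.
  rewrite integralZl//.
  have : fine (\int[mu]_x (h x)%:E)%E = 0.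
    apply: HF => //; exists (`|x0| + d) => x xd; apply: bs.
    by have := lerB_normD x (- x0); rewrite normrN; lra.
  move=> hf; rewrite -(fineK (integrable_fin_num _ ih))//= hf mule0//.
have /integrableP[mh _] := ih.
move/(ae_eq_integral_abs mu measurableT mh) => ae0.
have ae1 : {ae mu, forall x, h x = 0}.
  by apply: filterS ae0 => x /(_ I)[].
have [d' d'0 Hd'] := (ctsP b x0).1 (cb x0) _ bx0.
have dd : 0 < Num.min d d' by rewrite lt_min d0.
have [y + hy] := ae_dense x0 ae1 dd; rewrite lt_min => /andP[yd yd'].
have [_ Fy] := sF y yd; move: Fy; rewrite normr_gt0 => Fy.
have : b y != 0.
  rewrite distrC in yd'; have := Hd' y yd'; rewrite ltr_norml => /andP[_ h2].
  by rewrite gt_eqF//; lra.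
by move=> by0; move/eqP: hy; rewrite mulf_eq0 (negbTE Fy) (negbTE by0).
Qed.

End Integrals.

(** * Uniform limits of the iterated masks *)

Section FiniteChoice.
Context {R : realType}.

Lemma normr_int_le (k : int) (m : nat) : (`|k%:~R| <= m%:R :> R) = (`|k| <= m)%N.
Proof. by rewrite -intr_norm pmulrn ler_int; lia. Qed.

Lemma mul_frac_le (e x y : R) : 0 <= e -> 0 < y -> x <= y -> e * (x / y) <= e.
Proof. by move=> e0 y0 xy; rewrite ler_piMr// ler_pdivrMr// mul1r. Qed.

Lemma seq_min_pos (I : eqType) (s : seq I) (P : I -> R -> Prop) :
  (forall i (d d' : R), d' <= d -> P i d -> P i d') ->
  (forall i, exists2 d : R, 0 < d & P i d) ->
  exists2 d : R, 0 < d & forall i, i \in s -> P i d.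
Proof.
move=> mP Pd; elim: s => [|i s [d d0 IH]]; first by exists 1.
have [d' d'0 Pi] := Pd i; exists (Num.min d d'); first by rewrite lt_min d0.
move=> j; rewrite inE => /orP[/eqP ->|/IH Pj].
  by apply: mP Pi; rewrite ge_min lexx orbT.
by apply: mP Pj; rewrite ge_min lexx.
Qed.

Lemma seq_max_nat (I : eqType) (s : seq I) (P : I -> nat -> Prop) :
  (forall i N N', (N <= N')%N -> P i N -> P i N') ->
  (forall i, exists N, P i N) -> exists N, forall i, i \in s -> P i N.
Proof.
move=> mP PN; elim: s => [|i s [N IH]]; first by exists 0%N.
have [N' Pi] := PN i; exists (maxn N N') => j; rewrite inE => /orP[/eqP ->|/IH].
  by apply: mP Pi; rewrite leq_maxr.
by apply: mP; rewrite leq_maxl.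
Qed.

Lemma fin_min_pos (I : finType) (P : I -> R -> Prop) :
  (forall i (d d' : R), d' <= d -> P i d -> P i d') ->
  (forall i, exists2 d : R, 0 < d & P i d) -> exists2 d : R, 0 < d & forall i, P i d.
Proof.
move=> mP Pd; have [d d0 H] := seq_min_pos (enum I) mP Pd; exists d => // i.
by apply: H; rewrite mem_enum.
Qed.

Lemma pow2_large (c : R) : exists N, forall n, (N <= n)%N -> c <= 2 ^+ n.
Proof.
exists (Num.truncn `|c|).+1 => n Nn; rewrite (le_trans (ler_norm c))//.
apply: (@le_trans _ _ (Num.truncn `|c|).+1%:R); first by rewrite ltW// Num.Theory.truncnS_gt.
by rewrite (le_trans (_ : _ <= n%:R)) ?ler_nat// -natrX ler_nat ltnW// ltn_expl.
Qed.

Lemma le0_lim (x B : R) : (forall e : R, 0 < e -> x <= B * e) -> x <= 0.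
Proof.
move=> H; apply/ler_addgt0Pr => /= e e0; rewrite add0r.
have B1 : 0 < `|B| + 1 by rewrite ltr_wpDl.
rewrite (le_trans (H (e / (`|B| + 1)) (divr_gt0 e0 B1)))// mulrCA.
by apply: mul_frac_le => //; [exact: ltW|rewrite (le_trans (ler_norm _))// lerDl].
Qed.

Lemma cs_unif f (A : R) e : continuous (f : R -> R) -> (forall x, A <= `|x| -> f x = 0) -> 0 < e ->
  exists2 d, 0 < d & forall x y, `|x - y| < d -> `|f x - f y| < e.
Proof.
move=> cf f0 e0; have [d d0 H] := heine A cf e0; exists d => // x y xy.
have [xA|/ltW xA] := leP `|x| A; first exact: H.
have [yA|/ltW yA] := leP `|y| A; first by rewrite distrC H// distrC.
by rewrite !f0// subrr normr0.
Qed.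

Lemma mx_unif p q (Psi : R -> 'M[R[i]]_(p, q)) (A e : R) :
  (forall i j, continuous (re (fun x => Psi x i j)) /\ continuous (im (fun x => Psi x i j))) ->
  (forall x, A <= `|x| -> Psi x = 0) -> 0 < e ->
  exists2 d : R, 0 < d & forall x y, `|x - y| < d -> mnorm (Psi x - Psi y) <= e.
Proof.
move=> cPhi sPhi e0; pose e1 := e / (p * q).+1%:R / 2.
have e10 : 0 < e1 by rewrite !divr_gt0.
have [d d0 H] : exists2 d : R, 0 < d & forall (ij : 'I_p * 'I_q) x y, `|x - y| < d ->
    normc (Psi x ij.1 ij.2 - Psi y ij.1 ij.2) <= 2 * e1.
  apply: fin_min_pos => [ij d d' dd H x y xy|[i j]].
    by apply: H; exact: lt_le_trans dd.
  have [c1 c2] := cPhi i j.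
  have s1 : forall x, A <= `|x| -> re (fun x => Psi x i j) x = 0.
    by move=> x /sPhi h; rewrite /re h mxE.
  have s2 : forall x, A <= `|x| -> im (fun x => Psi x i j) x = 0.
    by move=> x /sPhi h; rewrite /im h mxE.
  have [d1 d10 H1] := cs_unif c1 s1 e10; have [d2 d20 H2] := cs_unif c2 s2 e10.
  exists (Num.min d1 d2); first by rewrite lt_min d10.
  move=> x y; rewrite lt_min => /andP[/H1 h1 /H2 h2] /=.
  rewrite (le_trans (normc_le_ReIm _))//; move: h1 h2; rewrite /re /im.
  case: (Psi x i j) => u v; case: (Psi y i j) => u' v' /= h1 h2; lra.
exists d => // x y xy.
rewrite (le_trans (mnorm_le (e := 2 * e1) _))//.
  by move=> i j; rewrite !mxE; exact: (H (i, j)).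
rewrite /e1 [2 * _]mulrC divfK// mulrCA.
by apply: mul_frac_le; rewrite ?ltr0n ?ler_nat//; exact: ltW.
Qed.

End FiniteChoice.

(** * Identities inherited by the limit from the iterated masks *)

Section Limit.
Context {R : realType}.
Local Notation C := R[i].
Variables (r : nat) (a : int -> 'M[C]_r) (A : nat).
Hypothesis sA : zsupp A a.
Variable Phi : R -> 'M[C]_r.
Hypothesis cPhi : forall i j, continuous (re (fun x => Phi x i j)) /\
  continuous (im (fun x => Phi x i j)).
Hypothesis sPhi : forall x, A%:R <= `|x| -> Phi x = 0.
Local Notation S := (Sn a).
Hypothesis limS : forall e : R, 0 < e -> exists N, forall n, (N <= n)%N ->
  forall k : int, mnorm (S n k - Phi (2 ^- n * k%:~R)) <= e.

Lemma Phi_unif (e : R) : 0 < e -> exists2 d : R, 0 < d &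
  forall x y, `|x - y| < d -> mnorm (Phi x - Phi y) <= e.
Proof. exact: (mx_unif cPhi sPhi). Qed.

Lemma limS_near (e : R) (c : nat) : 0 < e -> exists N, forall n, (N <= n)%N ->
  forall x (k : int), `|k%:~R - 2 ^+ n * x| <= c%:R -> mnorm (S n k - Phi x) <= e.
Proof.
move=> e0; have e2 : 0 < e / 2 by rewrite divr_gt0.
have [N HN] := limS e2; have [d d0 Hd] := Phi_unif e2.
have [N' HN'] := pow2_large ((c%:R + 1) / d).
exists (maxn N N') => n; rewrite geq_max => /andP[Nn N'n] x k kx.
have -> : S n k - Phi x = (S n k - Phi (2 ^- n * k%:~R)) + (Phi (2 ^- n * k%:~R) - Phi x).
  by rewrite addrA subrK.
rewrite (le_trans (mnormD _ _))// [e]splitr lerD//; first exact: HN.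
apply: Hd; have p2 : 0 < 2 ^+ n :> R by rewrite exprn_gt0.
have -> : 2 ^- n * k%:~R - x = 2 ^- n * (k%:~R - 2 ^+ n * x) by field; rewrite gt_eqF.
rewrite normrM gtr0_norm ?invr_gt0// mulrC ltr_pdivrMr// (le_lt_trans kx)//.
have := HN' n N'n; rewrite ler_pdivrMr// mulrC; apply: lt_le_trans.
by rewrite ltrDl.
Qed.

Lemma floor_near n (x : R) : `|(Num.floor (2 ^+ n * x))%:~R - 2 ^+ n * x| <= 1%:R.
Proof.
have /andP[h1 h2] := floor_itv (2 ^+ n * x).
by rewrite rmorphD/= in h2; rewrite ler_norml; lra.
Qed.

Lemma mx_eq_lim m p (M N : 'M[C]_(m, p)) (B : R) :
  (forall e : R, 0 < e -> mnorm (M - N) <= B * e) -> M = N.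
Proof.
move=> /le0_lim H; apply/eqP; rewrite -subr_eq0 -mnorm_eq0 eq_le mnorm_ge0.
by rewrite H.
Qed.

Lemma normc_eq_lim (x y : C) (B : R) :
  (forall e : R, 0 < e -> normc (x - y) <= B * e) -> x = y.
Proof.
move=> /le0_lim H; apply/eqP; rewrite -subr_eq0 -normc_eq0 eq_le normc_ge0.
by rewrite H.
Qed.

Lemma mnorm_sum_le I (s : seq I) m p (F : I -> 'M[C]_(m, p)) (b : I -> R) (e : R) :
  (forall i, mnorm (F i) <= b i * e) -> mnorm (\sum_(i <- s) F i) <= (\sum_(i <- s) b i) * e.
Proof.
move=> H; rewrite (le_trans (mnorm_sum _ _ _))// mulr_suml; apply: ler_sum => i _.
exact: H.
Qed.

(* The polyphase sums of the mask; their average is the symbol at 0. *)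
Definition phase (g : int) : 'M[C]_r := 2%:R *: \sum_(l <- zr A.+1) a (2 * l + g).

(** In S_(N+1)(2q + g) = sum_l S_N(q - l) 2 a(2l + g) with q near 2^N x, all values of S_N and
    S_(N+1) are close to Phi(x). *)
Lemma Phi_phase x (g : int) : (`|g| <= 1)%N -> Phi x = Phi x *m phase g.
Proof.
move=> g1; pose B := 1 + \sum_(l <- zr A.+1) mnorm (2%:R *: a (2 * l + g)).
apply: (@mx_eq_lim _ _ _ _ B) => e e0.
(* The bound A + 4 covers both distances: at most 3 from 2q + g to 2^(N+1) x, and at most A + 2 from
   q - l to 2^N x. *)
have [N HN] := limS_near A.+4 e0.
pose q := Num.floor (2 ^+ N * x).
have qx := floor_near N x.
have SE : S N.+1 (2 * q + g) = \sum_(l <- zr A.+1) S N (q - l) *m (2%:R *: a (2 * l + g)).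
  rewrite [S _]/= (subdivE sA _ (leqnn _)) scaler_sumr.
  rewrite (@zsum_reindex _ (fun l => q - l) _ A.+1); last 3 first.
  - exact: subzI_bij.
  - by move=> l lB; rewrite sA ?mulmx0 ?scaler0//; lia.
  - by move=> l lB; rewrite /= sA ?mulmx0 ?scaler0//; lia.
  apply: eq_bigr => l _; rewrite scalemxAr; congr (_ *m (_ *: a _)); lia.
have -> : Phi x - Phi x *m phase g = (Phi x - S N.+1 (2 * q + g)) +
    \sum_(l <- zr A.+1) (S N (q - l) - Phi x) *m (2%:R *: a (2 * l + g)).
  under [X in _ = _ + X]eq_bigr do rewrite mulmxBl.
  rewrite sumrB -SE addrA subrK; congr (_ - _).
  by rewrite -mulmx_sumr /phase scaler_sumr.
rewrite (le_trans (mnormD _ _))//.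
rewrite [B * e]mulrDl [1 * e]mul1r lerD//.
  rewrite mnormB HN// exprS -mulrA rmorphD rmorphM/=.
  have -> : 2%:~R * q%:~R + g%:~R - 2 * (2 ^+ N * x) = 2 * (q%:~R - 2 ^+ N * x) + g%:~R :> R by ring.
  rewrite (le_trans (ler_normD _ _))// normrM ger0_norm//.
  have : `|g%:~R| <= 1%:R :> R by rewrite normr_int_le.
  have : 4 <= A.+4%:R :> R by rewrite ler_nat.
  by move: qx; lra.
rewrite mulr_suml (le_trans (mnorm_sum _ _ _))// !big_seq; apply: ler_sum => l.
rewrite mem_zr => lA; rewrite (le_trans (mnormM _ _))// mulrC ler_wpM2l ?mnorm_ge0// HN//.
have -> : (q - l)%:~R - 2 ^+ N * x = (q%:~R - 2 ^+ N * x) - l%:~R :> R by rewrite rmorphB/=; ring.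
rewrite (le_trans (ler_normB _ _))//.
have : `|l%:~R| <= A.+1%:R :> R by rewrite normr_int_le.
by rewrite -(natr1 A.+3) -(natr1 A.+2) -(natr1 A.+1); move: qx; lra.
Qed.

(** The limit of [SnD] when the number of further steps grows and N stays fixed. *)
Lemma Phi_refine N x : Phi x = \sum_(k <- zr (2 ^ N * A)) S N k *m Phi (2 ^+ N * x - k%:~R).
Proof.
pose B := 1 + \sum_(k <- zr (2 ^ N * A)) mnorm (S N k).
apply: (@mx_eq_lim _ _ _ _ B) => e e0.
have [n0 Hn] := limS_near 1 e0.
pose j := Num.floor (2 ^+ (n0 + N) * x).
have jx := floor_near (n0 + N) x.
have SE : S (n0 + N) j = \sum_(k <- zr (2 ^ N * A)) S N k *m S n0 (j - 2 ^+ n0 * k).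
  rewrite (@SnD _ _ _ _ sA n0 N (`|j| + A + 2 ^ N * A)); last by rewrite leq_addr.
  apply: zsum_widen; first by rewrite leq_addl.
  by move=> k kA; rewrite (Sn_supp sA)// mul0mx.
have -> : Phi x - \sum_(k <- zr (2 ^ N * A)) S N k *m Phi (2 ^+ N * x - k%:~R) =
    (Phi x - S (n0 + N) j) + \sum_(k <- zr (2 ^ N * A))
      S N k *m (S n0 (j - 2 ^+ n0 * k) - Phi (2 ^+ N * x - k%:~R)).
  under [X in _ = _ + X]eq_bigr do rewrite mulmxBr.
  by rewrite sumrB -SE addrA subrK.
rewrite (le_trans (mnormD _ _))// /B mulrDl mul1r lerD//.
  by rewrite mnormB Hn// leq_addr.
apply: mnorm_sum_le => k; rewrite (le_trans (mnormM _ _))// ler_wpM2l ?mnorm_ge0// Hn//.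
have -> : (j - 2 ^+ n0 * k)%:~R - 2 ^+ n0 * (2 ^+ N * x - k%:~R) = j%:~R - 2 ^+ (n0 + N) * x :> R.
  by rewrite rmorphB rmorphM rmorphXn/= exprD; ring.
exact: jx.
Qed.

Lemma zsupp_w s (w : int -> 'M[C]_(s, r)) (K : nat) n (j : int) : `|j%:~R : R| <= 2 ^+ n * K%:R ->
  forall k : int, (K + A < `|k|)%N -> w k *m S n (j - 2 ^+ n * k) = 0.
Proof.
move=> jK k kA; rewrite (Sn_supp sA) ?mulmx0//.
have jK' : (`|j| <= 2 ^ n * K)%N.
  by move: jK; rewrite -natrX -natrM normr_int_le.
rewrite expz2; have := expn_gt0 2 n; move: (2 ^ n)%N jK' => m jK' m0.
have : (m * (K + A).+1 <= m * `|k|)%N by rewrite leq_mul2l kA orbT.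
have : `|(m%:Z * k)%R|%N = (m * `|k|)%N by rewrite abszM.
by rewrite mulnS mulnDr; move: (m%:Z * k) (m * `|k|)%N (m * K)%N (m * A)%N jK'; lia.
Qed.

(** The initial sequence may have infinite support: on the window |j| <= 2^n K only its values at
    |k| <= K + A contribute, at every level. *)
Lemma lim_iter s (w : int -> 'M[C]_(s, r)) (K : nat) (e : R) : 0 < e -> exists N, forall n, (N <= n)%N ->
  forall j : int, `|j%:~R : R| <= 2 ^+ n * K%:R ->
  mnorm (iter n (subdiv a) w j - \sum_(k <- zr (K + A)) w k *m Phi (2 ^- n * j%:~R - k%:~R)) <= e.
Proof.
move=> e0; pose B := 1 + \sum_(k <- zr (K + A)) mnorm (w k).
have B0 : 0 < B by rewrite ltr_wpDr// sumr_ge0// => k _; exact: mnorm_ge0.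
have [N HN] := limS (divr_gt0 e0 B0).
exists N => n Nn j jK.
rewrite (iter_subdivE sA w n (B := (`|j| + A + (K + A))%N)) ?leq_addr//.
rewrite (@zsum_widen _ (K + A)%N); [|by rewrite leq_addl|exact: zsupp_w].
rewrite -sumrB (le_trans (_ : _ <= (\sum_(k <- zr (K + A)) mnorm (w k)) * (e / B)))//.
  apply: mnorm_sum_le => k; rewrite -mulmxBr (le_trans (mnormM _ _))// ler_wpM2l ?mnorm_ge0//.
  have -> : 2 ^- n * j%:~R - k%:~R = 2 ^- n * (j - 2 ^+ n * k)%:~R :> R.
    by rewrite rmorphB rmorphM rmorphXn/=; field; rewrite gt_eqF// exprn_gt0.
  exact: HN.
by rewrite mulrCA; apply: mul_frac_le => //; [exact: ltW|rewrite lerDr].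
Qed.

(** Phi is within 1 of the values of a single finitely supported S_N, hence bounded, and the later
    S_n are within 1 of Phi. *)
Lemma S_bounded : exists (M : R) (N : nat), 0 <= M /\ forall n, (N <= n)%N -> forall k, mnorm (S n k) <= M.
Proof.
have [N HN] := limS_near 1 ltr01.
pose B : R := \sum_(k <- zr (2 ^ N * A)) mnorm (S N k).
have SB k : mnorm (S N k) <= B.
  have [kA|kA] := leqP `|k| (2 ^ N * A); last first.
    by rewrite (Sn_supp sA)// mnorm0 sumr_ge0// => l _; exact: mnorm_ge0.
  rewrite /B (bigD1_seq k) ?mem_zr ?zr_uniq//= lerDl sumr_ge0// => l _.
  exact: mnorm_ge0.
have PB x : mnorm (Phi x) <= B + 1.
  have := HN N (leqnn _) x (Num.floor (2 ^+ N * x)) (floor_near _ _).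
  rewrite mnormB => h; rewrite -(subrK (S N (Num.floor (2 ^+ N * x))) (Phi x)).
  by rewrite (le_trans (mnormD _ _))// addrC lerD.
have [N' HN'] := limS ltr01.
exists (1 + (B + 1)), N'; split.
  by rewrite addr_ge0// (le_trans (mnorm_ge0 (Phi 0))).
move=> n Nn k; rewrite -(subrK (Phi (2 ^- n * k%:~R)) (S n k)).
by rewrite (le_trans (mnormD _ _))// lerD// HN'.
Qed.

End Limit.

(** * The refinable distribution as a function *)

Section Distribution.
Context {R : realType}.
Local Notation C := R[i].
Local Notation mu := (@lebesgue_measure R).
Implicit Types (f g : R -> R) (u v h : R -> C) (x y t th e : R) (K : nat).

Lemma cisD x y : cis (x + y) = cis x * cis y :> C.
Proof.
apply/eqP; rewrite eq_complex/= cosD sinD; apply/andP; split; apply/eqP; ring.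
Qed.

Lemma cis0 : cis 0 = 1 :> C.
Proof. by rewrite /cis cos0 sin0. Qed.

Lemma normc_cis x : normc (cis x : C) = 1.
Proof. by rewrite /cis /= cos2Dsin2 sqrtr1. Qed.

Lemma cReM (a b : C) : complex.Re (a * b) = complex.Re a * complex.Re b - complex.Im a * complex.Im b.
Proof. by case: a b => [? ?] []. Qed.

Lemma cImM (a b : C) : complex.Im (a * b) = complex.Re a * complex.Im b + complex.Im a * complex.Re b.
Proof. by case: a b => [? ?] []. Qed.

Lemma cReD (a b : C) : complex.Re (a + b) = complex.Re a + complex.Re b.
Proof. by case: a b => [? ?] []. Qed.

Lemma cImD (a b : C) : complex.Im (a + b) = complex.Im a + complex.Im b.
Proof. by case: a b => [? ?] []. Qed.

Lemma Re_sum I (s : seq I) (F : I -> C) :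
  complex.Re (\sum_(i <- s) F i) = \sum_(i <- s) complex.Re (F i).
Proof. by elim: s => [|i s IH]; rewrite ?big_nil// !big_cons cReD IH. Qed.

Lemma Im_sum I (s : seq I) (F : I -> C) :
  complex.Im (\sum_(i <- s) F i) = \sum_(i <- s) complex.Im (F i).
Proof. by elim: s => [|i s IH]; rewrite ?big_nil// !big_cons cImD IH. Qed.

Lemma ReIm_eq (a b : C) : complex.Re a = complex.Re b -> complex.Im a = complex.Im b -> a = b.
Proof. by case: a b => [? ?] [? ?] /= -> ->. Qed.

Lemma smooth_ReIm h : smooth h <-> smoothR (re h) /\ smoothR (im h).
Proof. by split=> [H|[H1 H2]] => [|m]; [split=> m; have [] := H m|split]. Qed.

Lemma smoothR_cst c : smoothR (fun=> c : R).
Proof.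
have := @smoothR_horner R c%:P; congr smoothR; apply/funext => x.
by rewrite hornerC.
Qed.

Lemma smooth_real f : smoothR f -> smooth (fun x => (f x)%:C).
Proof. by move=> sf; apply/smooth_ReIm; split=> //; exact: smoothR_cst. Qed.

Lemma smooth_lin c h v : smooth h -> smooth v -> smooth (fun x => c * h x + v x).
Proof.
move=> /smooth_ReIm[h1 h2] /smooth_ReIm[v1 v2]; apply/smooth_ReIm; split.
  have -> : re (fun x => c * h x + v x) =
      (fun x => complex.Re c * re h x + ((- complex.Im c) * im h x + re v x)).
    by apply/funext => x; rewrite /re /im cReD cReM; ring.
  by apply: smoothR_lin => //; exact: smoothR_lin.
have -> : im (fun x => c * h x + v x) =
    (fun x => complex.Re c * im h x + (complex.Im c * re h x + im v x)).
  by apply/funext => x; rewrite /re /im cImD cImM; ring.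
by apply: smoothR_lin => //; exact: smoothR_lin.
Qed.

Lemma smooth_exp t : smooth (fun x => cis (- (x * t)) : C).
Proof.
apply/smooth_ReIm; split.
  have -> : re (fun x => cis (- (x * t)) : C) = (fun x => cos ((- t) * x + 0)).
    by apply/funext => x; rewrite /re /=; congr cos; ring.
  exact: smoothR_cos.
have -> : im (fun x => cis (- (x * t)) : C) = (fun x => cos ((- t) * x + - (pi / 2))).
  apply/funext => x; rewrite /im /= cosB cos_pihalf sin_pihalf mulr0 add0r mulr1.
  by congr sin; ring.
exact: smoothR_cos.
Qed.

Lemma compact_distribution_bound T : compact_distribution T ->
  exists (K B : R) (N : nat), [/\ 1 <= K, 0 <= B &
    forall f (e : R), smoothR f -> 0 <= e ->
      (forall j x, (j <= N)%N -> `|x| <= K -> `|derive1n j f x| <= e) ->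
      normc (T (fun x => (f x)%:C)) <= B * e].
Proof.
move=> [_ [K [B [N H]]]]; exists (`|K| + 1), (`|B| * N.+1%:R), N; split.
- by rewrite lerDr.
- by rewrite mulr_ge0.
move=> f e sf e0 He; rewrite (le_trans (H _ (smooth_real sf)))//.
rewrite (le_trans (ler_norm _))// normrM -mulrA ler_wpM2l//.
have sup_bnd j : (j <= N)%N ->
    `|sup [set normc (cderiven j (fun x => (f x)%:C) x) | x in `[- K, K]]| <= e.
  move=> jN; have E x : normc (cderiven j (fun x => (f x)%:C) x) = `|derive1n j f x|.
    rewrite /cderiven -normc_real; congr (normc (_ +i* _)).
    have d0 i y : (i < j)%N -> is_derive (y : R) (1 : R) (fun=> 0 : R) (0 : R).
      by move=> _; exact: isd_cst.
    by rewrite (@chain_derive1n _ j (fun _ _ => 0) d0 j (leqnn _)).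
  set S := [set _ | _ in _].
  have Sb z : S z -> 0 <= z <= e.
    move=> [x xK <-]; rewrite E; move: xK; rewrite /= in_itv/= -ler_norml => xK.
    by rewrite normr_ge0 He// (le_trans xK)// (le_trans (ler_norm K))// lerDl.
  (* For negative K the interval is empty and the supremum takes its default value 0. *)
  have [->|/set0P[z Sz]] := eqVneq S set0; first by rewrite sup0 normr0.
  have Sub : ubound S e by move=> y /Sb/andP[].
  rewrite ger0_norm; first by apply: ge_sup => //; exists z.
  have /andP[z0 _] := Sb z Sz; apply: (le_trans z0).
  by apply: ub_le_sup => //; exists e.
rewrite (le_trans (ler_norm_sum _ _ _))//.
rewrite (le_trans (ler_sum _ (G := fun=> e) _))//.
  by move=> j _; apply: sup_bnd; rewrite -ltnS.
by rewrite sumr_const card_ord mulr_natl.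
Qed.

Definition cnice (K : nat) u :=
  [/\ continuous (re u), continuous (im u) & forall x, K%:R <= `|x| -> u x = 0].

Lemma cts_lin c d f g : continuous f -> continuous g -> continuous (fun x => c * f x + d * g x).
Proof.
by move=> cf cg x; apply: cvgD; apply: cvgM; [exact: cvg_cst|exact: cf|exact: cvg_cst|exact: cg].
Qed.

Lemma cnice_mul K u v : cnice K u -> continuous (re v) -> continuous (im v) ->
  cnice K (fun x => u x * v x).
Proof.
move=> [c1 c2 u0] d1 d2; split=> [x|x|x /u0 ->]; last by rewrite mul0r.
  have -> : re (fun x => u x * v x) = (fun x => re u x * re v x - im u x * im v x).
    by apply/funext => y; rewrite /re cReM.
  by apply: cvgB; apply: cvgM; [exact: c1|exact: d1|exact: c2|exact: d2].
have -> : im (fun x => u x * v x) = (fun x => re u x * im v x + im u x * re v x).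
  by apply/funext => y; rewrite /im cImM.
by apply: cvgD; apply: cvgM; [exact: c1|exact: d2|exact: c2|exact: d1].
Qed.

Lemma cnice_int K u : cnice K u ->
  mu.-integrable setT (EFin \o re u) /\ mu.-integrable setT (EFin \o im u).
Proof.
move=> [c1 c2 u0]; split; apply: (@cs_integrable _ _ K%:R) => // x /ltW/u0.
  by rewrite /re => ->.
by rewrite /im => ->.
Qed.

Lemma Rintegral_lin c d f g : mu.-integrable setT (EFin \o f) ->
  mu.-integrable setT (EFin \o g) ->
  Rintegral mu setT (fun x => c * f x + d * g x) =
  c * Rintegral mu setT f + d * Rintegral mu setT g.
Proof.
move=> mf mg; rewrite -!RintegralZl// -RintegralD//.
  by have := integrableZl measurableT c mf.
by have := integrableZl measurableT d mg.
Qed.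

Lemma cintegral_lin K c u v : cnice K u -> cnice K v ->
  cintegral (fun x => c * u x + v x) = c * cintegral u + cintegral v.
Proof.
move=> nu nv; have [ru iu] := cnice_int nu; have [rv iv] := cnice_int nv.
apply: ReIm_eq; rewrite /cintegral.
  rewrite cReD cReM /=.
  have -> : re (fun x => c * u x + v x) = (fun x => 1 * (complex.Re c * re u x +
      (- complex.Im c) * im u x) + 1 * re v x).
    by apply/funext => y; rewrite /re /im cReD cReM; ring.
  rewrite Rintegral_lin// ?Rintegral_lin//; first by ring.
  have [c1 c2 u0] := nu.
  apply: (@cs_integrable _ _ K%:R); first exact: cts_lin.
  by move=> x /ltW/u0 h; rewrite /re /im h/=; ring.
rewrite cImD cImM /=.
have -> : im (fun x => c * u x + v x) = (fun x => 1 * (complex.Re c * im u x +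
    complex.Im c * re u x) + 1 * im v x).
  by apply/funext => y; rewrite /re /im cImD cImM; ring.
rewrite Rintegral_lin// ?Rintegral_lin//; first by ring.
have [c1 c2 u0] := nu.
apply: (@cs_integrable _ _ K%:R); first exact: cts_lin.
by move=> x /ltW/u0 h; rewrite /re /im h/=; ring.
Qed.

Lemma Rintegral_bound f (K e : R) : continuous f -> 0 < K -> (forall x, K < `|x| -> f x = 0) ->
  (forall x, `|x| <= K -> `|f x| <= e) -> `|Rintegral mu setT f| <= 2 * K * e.
Proof.
move=> cf K0 f0 fe; have [G dG ->] := cs_integral cf K0 f0.
rewrite (le_trans (@mvt_le _ G f (- K) K e _ _ _))//.
- by move=> x /andP[xK _]; exact: dG.
- by move=> x xK; rewrite fe// ler_norml.
- by lra.
- by rewrite le_eqVlt; apply/orP; left; apply/eqP; ring.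
Qed.

Lemma cintegral_bound K u e : (0 < K)%N -> cnice K u ->
  (forall x, `|x| <= K%:R -> normc (u x) <= e) -> normc (cintegral u) <= 4 * K%:R * e.
Proof.
move=> K0 [c1 c2 u0] ue; have KR : 0 < K%:R :> R by rewrite ltr0n.
rewrite (le_trans (normc_le_ReIm _))// /cintegral/=.
have h1 : `|Rintegral mu setT (re u)| <= 2 * K%:R * e.
  apply: Rintegral_bound => // x; first by move=> /ltW/u0; rewrite /re => ->.
  by move=> /ue; apply: le_trans; exact: normc_Re.
have h2 : `|Rintegral mu setT (im u)| <= 2 * K%:R * e.
  apply: Rintegral_bound => // x; first by move=> /ltW/u0; rewrite /im => ->.
  by move=> /ue; apply: le_trans; exact: normc_Im.
by lra.
Qed.

Lemma criemann_sum K u e : (0 < K)%N -> cnice K u -> 0 < e ->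
  exists N, forall n, (N <= n)%N ->
  normc ((2 ^- n)%:C * \sum_(k <- zr (2 ^ n * K)) u (2 ^- n * k%:~R) - cintegral u) <= e.
Proof.
move=> K0 [c1 c2 u0] e0; have e2 : 0 < e / 2 by rewrite divr_gt0.
have s1 x : K%:R <= `|x| -> re u x = 0 by move=> /u0; rewrite /re => ->.
have s2 x : K%:R <= `|x| -> im u x = 0 by move=> /u0; rewrite /im => ->.
have [N1 H1] := riemann_sum c1 K0 s1 e2; have [N2 H2] := riemann_sum c2 K0 s2 e2.
exists (maxn N1 N2) => n; rewrite geq_max => /andP[/H1 h1 /H2 h2].
rewrite (le_trans (normc_le_ReIm _))// !(cReD, cImD, cReM, cImM) Re_sum Im_sum /=.
by rewrite !mul0r subr0 addr0; move: h1 h2; rewrite /re /im; lra.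
Qed.

End Distribution.

Section Symbols.
Context {R : realType}.
Local Notation C := R[i].

Lemma symbolE s r (u : int -> 'M[C]_(s, r)) L xi : zsupp L u ->
  symbol u xi = \sum_(k <- zr L) cis (- (k%:~R * xi)) *: u k.
Proof. by move=> su; rewrite /symbol (@zsumE _ L)// => k /su ->; rewrite scaler0. Qed.

Lemma subdiv_supp r s (a : int -> 'M[C]_r) (v : int -> 'M[C]_(s, r)) A L :
  zsupp A a -> zsupp L v -> zsupp (2 * L + A) (subdiv a v).
Proof.
move=> sA sv j jL; rewrite (subdivE sA _ (leqnn _)) big1 ?scaler0// => k _.
have [kL|kL] := ltnP L `|k|; first by rewrite sv// mul0mx.
by rewrite sA ?mulmx0//; lia.
Qed.

Lemma symbol_subdiv r s (a : int -> 'M[C]_r) (v : int -> 'M[C]_(s, r)) A L xi :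
  zsupp A a -> zsupp L v ->
  symbol (subdiv a v) xi = 2%:R *: (symbol v (2%:R * xi) *m symbol a xi).
Proof.
move=> sA sv; rewrite (symbolE _ (subdiv_supp sA sv)) (symbolE _ sv) (symbolE _ sA).
have E j : subdiv a v j = 2%:R *: \sum_(k <- zr L) v k *m a (j - 2 * k).
  rewrite (subdivE sA v (B := (`|j| + A + L)%N)) ?leq_addr//; congr (_ *: _).
  by apply: zsum_widen; [rewrite leq_addl|move=> k kL; rewrite sv// mul0mx].
transitivity (\sum_(j <- zr (2 * L + A)) \sum_(k <- zr L)
    2%:R *: (cis (- (j%:~R * xi)) *: (v k *m a (j - 2 * k)))).
  apply: eq_bigr => j _; rewrite E scalerA mulrC -scalerA -scaler_sumr.
  by congr (_ *: _); rewrite scaler_sumr.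
rewrite exchange_big/= mulmx_suml scaler_sumr [LHS]big_seq [RHS]big_seq; apply: eq_bigr => k.
rewrite mem_zr => kL; rewrite -scaler_sumr; congr (_ *: _).
rewrite mulmx_sumr (@zsum_reindex _ (fun l => l + 2 * k) _ A); last 3 first.
- exact: addzI_bij.
- by move=> j jA; rewrite sA ?mulmx0 ?scaler0//; lia.
- by move=> j jA; rewrite /= sA ?mulmx0 ?scaler0//; lia.
apply: eq_bigr => l _; rewrite -scalemxAl -scalemxAr scalerA -cisD addrK.
by congr (cis _ *: _); rewrite rmorphD rmorphM/=; ring.
Qed.

End Symbols.

(** * Identification of the refinable distribution *)

Section Representation.
Context {R : realType}.
Local Notation C := R[i].
Variables (r : nat) (a : int -> 'M[C]_r) (A : nat).
Hypothesis sA : zsupp A a.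
Hypothesis A0 : (0 < A)%N.
Variable phi : 'I_r -> (R -> C) -> C.
Hypothesis hphi : forall l, compact_distribution (phi l).
Hypothesis hrefine : forall xi : R,
  fourier_vec phi (2%:R * xi) = symbol a xi *m fourier_vec phi xi.
Local Notation F := (fourier_vec phi).
Local Notation S := (Sn a).

(** The factor 2^-n compensates the factor 2 contained in each application of [subdiv]. *)
Lemma fourier_iter n xi : F (2 ^+ n * xi) = (2 ^- n)%:C *: (symbol (S n) xi *m F xi).
Proof.
elim: n xi => [|n IH] xi.
  have s0 : zsupp 0 (S 0) by apply: zsuppW (@Sn_supp0 _ _ _ _ sA 0).
  rewrite (symbolE _ s0) /zr/= big_seq1 subrr mul0r oppr0 cis0 !scale1r.
  by rewrite /Sn/= /diracI eqxx mul1mx expr0 invr1 mul1r rmorph1 scale1r.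
rewrite exprS -mulrA mulrCA IH hrefine.
have -> : symbol (S n.+1) xi = 2%:R *: (symbol (S n) (2%:R * xi) *m symbol a xi).
  exact: (symbol_subdiv _ sA (Sn_supp sA (n := n))).
rewrite -scalemxAl scalerA mulmxA; congr (_ *: _).
have -> : (2%:R : C) = (2%:R : R)%:C by rewrite rmorph_nat.
by rewrite -rmorphM; congr (_%:C); field; rewrite gt_eqF// exprn_gt0.
Qed.

Lemma T_lin l c f g : smoothR f -> smoothR g ->
  phi l (fun x => (c * f x + g x)%:C) = c%:C * phi l (fun x => (f x)%:C) + phi l (fun x => (g x)%:C).
Proof.
move=> sf sg; have [lin _] := hphi l.
rewrite -lin; [|exact: smooth_real|exact: smooth_real].
by congr (phi l _); apply/funext => x; rewrite rmorphD rmorphM.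
Qed.

Lemma T_ReIm l h : smooth h ->
  phi l h = phi l (fun x => (re h x)%:C) + 'i%C * phi l (fun x => (im h x)%:C).
Proof.
move=> /smooth_ReIm[sr si]; have [lin _] := hphi l.
rewrite addrC -lin; [|exact: smooth_real|exact: smooth_real].
congr (phi l _); apply/funext => x; apply: ReIm_eq.
  by rewrite /re /im; case: (h x) => u v /=; ring.
by rewrite /re /im; case: (h x) => u v /=; ring.
Qed.

(** For |t| <= 1 the function cos(t x + th) - cos th and its derivatives are at most |t| K on
    [-K, K], as K >= 1. *)
Lemma T_cos_cont l th (e : R) : 0 < e -> exists2 d : R, 0 < d & forall t, `|t| < d ->
  normc (phi l (fun x => (cos (t * x + th))%:C) - phi l (fun x => (cos th)%:C)) <= e.
Proof.
move=> e0; have [K [B [N [K1 B0 H]]]] := compact_distribution_bound (hphi l).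
have K0 : 0 < K by exact: lt_le_trans K1.
have D0 : 0 < (B + 1) * K by rewrite mulr_gt0// ltr_wpDl.
exists (Num.min 1 (e / ((B + 1) * K))); first by rewrite lt_min ltr01 divr_gt0.
move=> t; rewrite lt_min => /andP[t1 te].
have -> : phi l (fun x => (cos (t * x + th))%:C) - phi l (fun x => (cos th)%:C) =
    phi l (fun x => ((-1) * cos th + cos (t * x + th))%:C).
  rewrite T_lin; [|exact: smoothR_cst|exact: smoothR_cos].
  by rewrite rmorphN rmorph1 mulN1r addrC.
pose G (j : nat) x : R := (if j == 0%N then (-1) * cos th else 0) +
  t ^+ j * cos (t * x + (th + j%:R * (pi / 2))).
have dG j x : is_derive (x : R) (1 : R) (G j) (G j.+1 x).
  apply: (isd_eq (isdD (isd_cst x _) (chain_cos t th j x))).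
  by rewrite /G/=; case: j.
have GE : (fun x => (-1) * cos th + cos (t * x + th)) = G 0%N.
  by apply/funext => x; rewrite /G/= expr0 mul1r mul0r addr0.
have sG : smoothR (G 0%N) by exact: smoothR_chain.
have -> : (fun x => ((-1) * cos th + cos (t * x + th))%:C) = (fun x => (G 0%N x)%:C).
  by rewrite -GE.
rewrite (le_trans (H _ (`|t| * K) sG _ _))//.
- by rewrite mulr_ge0// ltW.
- move=> j x jN xK; rewrite (@chain_derive1n _ j G (fun i y _ => dG i y) j (leqnn _)).
  have cb y : `|cos y| <= 1 :> R by rewrite ler_norml cos_geN1 cos_le1.
  case: j jN => [|j] jN.
    have -> : G 0%N x = G 0%N x - G 0%N 0.
      by rewrite -GE/= mulr0 add0r mulN1r addNr subr0.
    rewrite (le_trans (@mvt_le_sym _ (G 0%N) (G 1%N) K `|t| 0 x _ _ _ _))//.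
    + move=> z zK; rewrite /G/= add0r expr1 normrM ler_piMr//.
    + by rewrite normr0 ltW.
    + by rewrite subr0 ler_wpM2l.
  have tj : 0 <= `|t| ^+ j.+1 by exact: exprn_ge0.
  rewrite /G/= add0r normrM normrX (le_trans (ler_piMr tj (cb _)))//.
  apply: (@le_trans _ _ `|t|); last by rewrite ler_peMr.
  by rewrite exprS ler_piMr// exprn_ile1// ltW.
rewrite mulrC -mulrA; move: te; rewrite ltr_pdivlMr// => te.
have : B * (`|t| * K) <= (B + 1) * (`|t| * K) by rewrite ler_wpM2r ?lerDl// mulr_ge0// ltW.
by nra.
Qed.

Lemma fourier_cont l (e : R) : 0 < e -> exists2 d : R, 0 < d & forall t, `|t| < d ->
  normc (F t l 0 - F 0 l 0) <= e.
Proof.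
move=> e0; have e2 : 0 < e / 2 by rewrite divr_gt0.
have [d1 d10 H1] := T_cos_cont l 0 e2.
have [d2 d20 H2] := T_cos_cont l (- (pi / 2)) e2.
exists (Num.min d1 d2); first by rewrite lt_min d10.
move=> t; rewrite lt_min => /andP[td1 td2].
have E s : F s l 0 = phi l (fun x => (cos ((- s) * x + 0))%:C) +
    'i%C * phi l (fun x => (cos ((- s) * x + - (pi / 2)))%:C).
  rewrite mxE /fourier T_ReIm; last exact: smooth_exp.
  congr (phi l _ + _ * phi l _); apply/funext => x; congr (_%:C).
    by rewrite /re/=; congr cos; ring.
  rewrite /im/= cosB cos_pihalf sin_pihalf mulr0 add0r mulr1.
  by congr sin; ring.
have E0 th : phi l (fun x => (cos ((- 0) * x + th))%:C) = phi l (fun x => (cos th)%:C).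
  by congr (phi l _); apply/funext => x; rewrite oppr0 mul0r add0r.
rewrite !E !E0 opprD addrACA -mulrBr (le_trans (normcD _ _))// normcM.
rewrite [normc 'i%C]/= expr0n/= expr1n add0r sqrtr1 mul1r [leRHS]splitr.
by rewrite lerD// ?H1 ?H2 ?normrN.
Qed.

Variable Phi : R -> 'M[C]_r.
Hypothesis cPhi : forall i j, continuous (re (fun x => Phi x i j)) /\
  continuous (im (fun x => Phi x i j)).
Hypothesis sPhi : forall x, A%:R <= `|x| -> Phi x = 0.
Hypothesis limS : forall e : R, 0 < e -> exists N, forall n, (N <= n)%N ->
  forall k : int, mnorm (S n k - Phi (2 ^- n * k%:~R)) <= e.

Local Notation rep l := (fun x : R => (Phi x *m F 0) l 0).

Lemma cts_sum I (s : seq I) (G : I -> R -> R) : (forall i, continuous (G i)) ->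
  continuous (fun x => \sum_(i <- s) G i x).
Proof.
move=> cG; elim: s => [|i s IH] x.
  by under eq_fun do rewrite big_nil; exact: cvg_cst.
have -> : (fun x => \sum_(j <- i :: s) G j x) = (fun x => G i x + \sum_(j <- s) G j x).
  by apply/funext => y; rewrite big_cons.
by apply: cvgD; [exact: cG|exact: IH].
Qed.

Lemma rep_nice l : cnice A (rep l).
Proof.
split=> [||x /sPhi ->]; last by rewrite mul0mx mxE.
  have -> : re (rep l) = (fun x => \sum_j (complex.Re (F 0 j 0) * re (fun x => Phi x l j) x +
      (- complex.Im (F 0 j 0)) * im (fun x => Phi x l j) x)).
    apply/funext => x; rewrite /re mxE Re_sum; apply: eq_bigr => j _.
    by rewrite cReM /im; ring.
  by apply: cts_sum => j; have [? ?] := cPhi l j; exact: cts_lin.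
have -> : im (rep l) = (fun x => \sum_j (complex.Im (F 0 j 0) * re (fun x => Phi x l j) x +
    complex.Re (F 0 j 0) * im (fun x => Phi x l j) x)).
  apply/funext => x; rewrite /im mxE Im_sum; apply: eq_bigr => j _.
  by rewrite cImM /re; ring.
by apply: cts_sum => j; have [? ?] := cPhi l j; exact: cts_lin.
Qed.

Lemma smooth_cts (h : R -> C) : smooth h -> continuous (re h) /\ continuous (im h).
Proof. by move=> /(_ 0%N)[[_ c1] [_ c2]]. Qed.

Lemma rep_smooth_nice l h : smooth h -> cnice A (fun x => rep l x * h x).
Proof. by move=> /smooth_cts[c1 c2]; apply: cnice_mul => //; exact: rep_nice. Qed.

Lemma fourier_cont_mx xi (e : R) : 0 < e -> exists N, forall n, (N <= n)%N ->
  mnorm (F (2 ^- n * xi) - F 0) <= e.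
Proof.
move=> e0; have e1 : 0 < e / r.+1%:R by rewrite divr_gt0.
have [d d0 H] : exists2 d : R, 0 < d & forall l t, `|t| < d -> normc (F t l 0 - F 0 l 0) <= e / r.+1%:R.
  apply: fin_min_pos => [l d d' dd' H t td|l]; last exact: fourier_cont.
  by apply: H; exact: lt_le_trans dd'.
have [N HN] := pow2_large ((`|xi| + 1) / d).
exists N => n Nn; have p2 : 0 < 2 ^+ n :> R by rewrite exprn_gt0.
rewrite (le_trans (mnorm_le (e := e / r.+1%:R) _))//.
  move=> i j; rewrite ord1.
  have -> : (F (2 ^- n * xi) - F 0) i 0 = F (2 ^- n * xi) i 0 - F 0 i 0.
    by move: (F _) (F 0) => X Y; rewrite !mxE.
  apply: H.
  rewrite normrM gtr0_norm ?invr_gt0// mulrC ltr_pdivrMr//.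
  have := HN n Nn; rewrite ler_pdivrMr// mulrC; apply: lt_le_trans.
  by rewrite ltrDl.
by rewrite muln1 mulrCA; apply: mul_frac_le; rewrite ?ler_nat//; exact: ltW.
Qed.

Lemma sum_zr_const (L : nat) (c : R) : \sum_(k <- zr L) c = (L.*2.+1)%:R * c.
Proof. by rewrite sum_zr_shift sumr_const_nat subn0 mulr_natl. Qed.

(** Taking xi = 2^n (2^-n xi) in [fourier_iter] gives a sum over the nodes 2^-n k. Replacing S_n(k)
    by Phi(2^-n k) and phihat(2^-n xi) by phihat(0) turns it into a Riemann sum. *)
Lemma fourier_rep l xi : F xi l 0 = cintegral (fun x => rep l x * cis (- (x * xi))).
Proof.
have [M [N1 [M0 HM]]] := S_bounded sA cPhi sPhi limS.
pose W := mnorm (F 0); have W0 : 0 <= W by exact: mnorm_ge0.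
(* The 2^(n+1) A + 1 nodes have total weight at most 2 A + 1, each replacement costs at most (M + W)
   e, and 1 accounts for the Riemann sum. *)
pose B := 1 + (2 * A%:R + 1) * (M + W).
apply: (@normc_eq_lim _ _ _ B) => e e0.
have [N2 H2] := limS e0; have [N3 H3] := fourier_cont_mx xi e0.
have nu : cnice A (fun x => rep l x * cis (- (x * xi))) by exact/rep_smooth_nice/smooth_exp.
have [N4 H4] := criemann_sum A0 nu e0.
pose n := maxn (maxn N1 N2) (maxn N3 N4).
have n1 : (N1 <= n)%N by rewrite /n !leq_max leqnn.
have n2 : (N2 <= n)%N by rewrite /n !leq_max leqnn orbT.
have n3 : (N3 <= n)%N by rewrite /n !leq_max leqnn !orbT.
have n4 : (N4 <= n)%N by rewrite /n !leq_max leqnn !orbT.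
have p2 : 0 < 2 ^+ n :> R by rewrite exprn_gt0.
have Fx : F xi l 0 = (2 ^- n)%:C * \sum_(k <- zr (2 ^ n * A))
    cis (- (2 ^- n * k%:~R * xi)) * (S n k *m F (2 ^- n * xi)) l 0.
  have {1}-> : xi = 2 ^+ n * (2 ^- n * xi) by rewrite mulrA mulfV ?mul1r// gt_eqF.
  rewrite fourier_iter mxE (symbolE _ (Sn_supp sA (n := n))) mulmx_suml summxE.
  congr (_ * _); apply: eq_bigr => k _; rewrite -scalemxAl mxE; congr (cis _ * _).
  by ring.
rewrite Fx.
set I := cintegral _; set Rs := \sum_(k <- zr _) _.
pose Q := \sum_(k <- zr (2 ^ n * A)) rep l (2 ^- n * k%:~R) * cis (- (2 ^- n * k%:~R * xi)).
have -> : (2 ^- n)%:C * Rs - I = (2 ^- n)%:C * (Rs - Q) + ((2 ^- n)%:C * Q - I) by ring.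
rewrite (le_trans (normcD _ _))// addrC /B mulrDl mul1r lerD//; first exact: H4.
rewrite normcM normc_real gtr0_norm ?invr_gt0// ler_pdivrMl// /Rs /Q -sumrB.
rewrite (le_trans (normc_sum _ _ _))//.
apply: (@le_trans _ _ (\sum_(k <- zr (2 ^ n * A)) (M + W) * e)).
  apply: ler_sum => k _; rewrite [rep l _ * _]mulrC -mulrBr normcM normc_cis mul1r.
  have -> : (S n k *m F (2 ^- n * xi)) l 0 - rep l (2 ^- n * k%:~R) =
    (S n k *m (F (2 ^- n * xi) - F 0) + (S n k - Phi (2 ^- n * k%:~R)) *m F 0) l 0.
    rewrite mulmxBr mulmxBl addrA subrK; move: (_ *m _) (_ *m _) => X Y; by rewrite !mxE.
  rewrite (le_trans (le_mnorm _ _ _))// (le_trans (mnormD _ _))// mulrDl lerD//.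
    by rewrite (le_trans (mnormM _ _))// ler_pM ?mnorm_ge0// ?HM ?H3.
  by rewrite (le_trans (mnormM _ _))// mulrC ler_wpM2l// H2.
have X0 : 0 <= (M + W) * e by rewrite mulr_ge0 ?addr_ge0// ltW.
rewrite sum_zr_const -[_ * (M + W) * e]mulrA [leRHS]mulrA ler_wpM2r//.
rewrite -natr1 -muln2 natrM natrM natrX mulrDr mulr1.
have : 1 <= 2 ^+ n :> R by rewrite exprn_ege1// ler1n.
by move: (2 ^+ n) => z; have := ler0n R A; nra.
Qed.

Lemma rep_bounded l : exists2 M : R, 0 <= M & forall x, normc (rep l x) <= M.
Proof.
have [c1 c2 u0] := rep_nice l.
have [M1 M10 H1] := cts_bounded A%:R c1; have [M2 M20 H2] := cts_bounded A%:R c2.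
exists (M1 + M2); first exact: addr_ge0.
move=> x; have [xA|/ltW/u0 ->] := leP `|x| A%:R; last by rewrite normc0 addr_ge0.
by rewrite (le_trans (normc_le_ReIm _))// lerD//; [exact: H1|exact: H2].
Qed.

(** The difference of the two functionals has finite order and vanishes on the exponentials, hence
    on all cosines, so [L_smooth0] applies to it. *)
Lemma rep_smooth l h : smooth h -> phi l h = cintegral (fun x => rep l x * h x).
Proof.
pose D h := phi l h - cintegral (fun x => rep l x * h x).
have Dlin c h1 h2 : smooth h1 -> smooth h2 ->
    D (fun x => c * h1 x + h2 x) = c * D h1 + D h2.
  move=> s1 s2; rewrite /D; have [lin _] := hphi l; rewrite lin//.
  have -> : (fun x => rep l x * (c * h1 x + h2 x)) =
      (fun x => c * (rep l x * h1 x) + rep l x * h2 x).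
    by apply/funext => x; ring.
  rewrite (cintegral_lin c (rep_smooth_nice l s1) (rep_smooth_nice l s2)); ring.
have s0 : smooth (fun=> 0 : C) by have := smooth_real (@smoothR_cst R 0).
have D0 : D (fun=> 0) = 0.
  have := Dlin 1 _ _ s0 s0.
  have -> : (fun x : R => 1 * (0 : C) + 0) = fun=> 0 by apply/funext => x; rewrite mulr0 addr0.
  by rewrite mul1r => /eqP; rewrite addrC -subr_eq subrr eq_sym => /eqP.
have Dscal c h1 : smooth h1 -> D (fun x => c * h1 x) = c * D h1.
  move=> s1; have := Dlin c h1 _ s1 s0; rewrite D0 addr0 => <-.
  by congr D; apply/funext => x; rewrite addr0.
have Dexp t : D (fun x => cis (- (x * t))) = 0.
  by rewrite /D -fourier_rep mxE subrr.
have [K [B [N [K1 B0 H]]]] := compact_distribution_bound (hphi l).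
have [M M0 HM] := rep_bounded l.
have Dreal f : smoothR f -> D (fun x => (f x)%:C) = 0.
  move=> sf; pose K' := Num.max K A%:R.
  apply: (@L_smooth0 R (fun f => D (fun x => (f x)%:C)) K' (B + 4 * A%:R * M) N) => //.
  - by rewrite le_max K1.
  - by rewrite addr_ge0// !mulr_ge0.
  - move=> c f1 f2 s1 s2; rewrite -Dlin; [|exact: smooth_real|exact: smooth_real].
    by congr D; apply/funext => x; rewrite rmorphD rmorphM.
  - move=> f1 e s1 e0 Hf; rewrite /D (le_trans (normcD _ _))// mulrDl lerD//.
      by apply: H => // j x jN xK; apply: Hf => //; rewrite le_max xK.
    rewrite normc_opp -mulrA; apply: cintegral_bound => //.
      exact/rep_smooth_nice/smooth_real.
    move=> x xA; rewrite normcM normc_real ler_pM ?normc_ge0//.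
    by apply: (Hf 0%N) => //; rewrite le_max xA orbT.
  move=> t th.
  have -> : (fun x => (cos (t * x + th))%:C) =
      (fun x => (cis th / 2%:R) * cis (- (x * (- t))) + (cis (- th) / 2%:R) * cis (- (x * t))).
    apply/funext => x.
    have -> : cis th / 2%:R * cis (- (x * - t)) + cis (- th) / 2%:R * cis (- (x * t)) =
       (cis (t * x + th) + cis (- (t * x + th))) / 2%:R.
      rewrite opprD !cisD mulrN opprK [x * t]mulrC; ring.
    have -> : cis (t * x + th) + cis (- (t * x + th)) = (cos (t * x + th))%:C * 2%:R.
      rewrite /cis cosN sinN mulr_natr mulr2n; apply: ReIm_eq => /=; ring.
    by rewrite mulfK// pnatr_eq0.
  have s2 : smooth (fun x => cis (- th) / 2%:R * cis (- (x * t)) : C).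
    have := smooth_lin (cis (- th) / 2%:R) (@smooth_exp R t) s0.
    by under eq_fun do rewrite addr0.
  rewrite (Dlin _ _ _ (@smooth_exp R (- t)) s2) (Dscal _ _ (@smooth_exp R t)) !Dexp.
  by rewrite !mulr0 addr0.
move=> sh; suff : D h = 0 by move=> /eqP; rewrite /D subr_eq0 => /eqP.
have [sr si] := (smooth_ReIm h).1 sh.
have hE : h = (fun x => 'i%C * (im h x)%:C + (re h x)%:C).
  by apply/funext => x; rewrite /re /im; case: (h x) => u v; apply: ReIm_eq; rewrite /=; ring.
by rewrite hE Dlin ?Dreal ?mulr0 ?addr0//; exact: smooth_real.
Qed.

End Representation.

(** * Hoelder continuity of the derivatives of the limit *)

Section ComplexDerivatives.
Context {R : realType}.
Local Notation C := R[i].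
Implicit Types (u v h : R -> C) (x y : R).
Local Notation isd f x d := (is_derive (x : R) (1 : R) (f : R -> R) (d : R)).

Lemma isd_Re_mul (c : C) (f g : R -> R) x a b : isd f x a -> isd g x b ->
  isd (fun t => complex.Re (c * (f t +i* g t))) x (complex.Re (c * (a +i* b))).
Proof.
move=> df dg; have -> : (fun t => complex.Re (c * (f t +i* g t))) =
    (fun t => complex.Re c * f t - complex.Im c * g t) by apply/funext => t; rewrite cReM.
by rewrite cReM; exact: (isdB (isdZ _ df) (isdZ _ dg)).
Qed.

Lemma isd_Im_mul (c : C) (f g : R -> R) x a b : isd f x a -> isd g x b ->
  isd (fun t => complex.Im (c * (f t +i* g t))) x (complex.Im (c * (a +i* b))).
Proof.
move=> df dg; have -> : (fun t => complex.Im (c * (f t +i* g t))) =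
    (fun t => complex.Re c * g t + complex.Im c * f t) by apply/funext => t; rewrite cImM.
by rewrite cImM; exact: (isdD (isdZ _ dg) (isdZ _ df)).
Qed.

(** The common source of derivatives of combinations of dilates and translates: the refinement
    equation, exponential sums and sums of translates of the limit are all instances. *)
Lemma cderiven_sum I (q : seq I) m (c : I -> C) (u : I -> R -> C) (s : R) (t : I -> R) :
  (forall i, Ck m (u i)) ->
  let h := fun x => \sum_(i <- q) c i * u i (s * x + t i) in
  Ck m h /\ forall j, (j <= m)%N ->
    cderiven j h = fun x => (s ^+ j)%:C * \sum_(i <- q) c i * cderiven j (u i) (s * x + t i).
Proof.
move=> Cu h.
pose W j x := (s ^+ j)%:C * \sum_(i <- q) c i * cderiven j (u i) (s * x + t i).
have WE j x : W j x = \sum_(i <- q) c i * (s ^+ j * derive1n j (re (u i)) (s * x + t i) +i*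
    (s ^+ j * derive1n j (im (u i)) (s * x + t i))).
  rewrite /W mulr_sumr; apply: eq_bigr => i _; rewrite mulrCA; congr (_ * _).
  by rewrite /cderiven; apply: ReIm_eq; rewrite /= !mul0r ?subr0 ?addr0.
have W0 : W 0%N = h.
  apply/funext => x; rewrite /W expr0 mul1r /h; apply: eq_bigr => i _; congr (_ * _).
  by rewrite /cderiven !derive1n0 /re /im; case: (u i _).
have dW j x : (j < m)%N -> isd (re (W j)) x (re (W j.+1) x) /\ isd (im (W j)) x (im (W j.+1) x).
  move=> jm.
  have d1 i : isd (fun x => s ^+ j * derive1n j (re (u i)) (s * x + t i)) x
     (s ^+ j.+1 * derive1n j.+1 (re (u i)) (s * x + t i)).
    rewrite exprSr -mulrA; apply: isdZ; apply: isd_lin.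
    by have [C1 _] := Cu i; exact: realCk_derive C1 jm.
  have d2 i : isd (fun x => s ^+ j * derive1n j (im (u i)) (s * x + t i)) x
     (s ^+ j.+1 * derive1n j.+1 (im (u i)) (s * x + t i)).
    rewrite exprSr -mulrA; apply: isdZ; apply: isd_lin.
    by have [_ C2] := Cu i; exact: realCk_derive C2 jm.
  split.
    have -> : re (W j) = (fun x => \sum_(i <- q) complex.Re (c i * (s ^+ j * derive1n j (re (u i)) (s * x + t i) +i*
      (s ^+ j * derive1n j (im (u i)) (s * x + t i))))).
      by apply/funext => y; rewrite /re WE Re_sum.
    rewrite /re WE Re_sum; apply: isd_sum => i; exact: isd_Re_mul.
  have -> : im (W j) = (fun x => \sum_(i <- q) complex.Im (c i * (s ^+ j * derive1n j (re (u i)) (s * x + t i) +i*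
    (s ^+ j * derive1n j (im (u i)) (s * x + t i))))).
    by apply/funext => y; rewrite /im WE Im_sum.
  rewrite /im WE Im_sum; apply: isd_sum => i; exact: isd_Im_mul.
have cW : continuous (re (W m)) /\ continuous (im (W m)).
  have ct f i : continuous f -> continuous (fun x => s ^+ m * f (s * x + t i)).
    move=> cf x; apply: cvgM; first exact: cvg_cst.
    apply: (@continuous_comp _ _ _ (fun y => s * y + t i) f); last exact: cf.
    exact: isd_cts (isd_affine _ _ _).
  have c1 i : continuous (fun x => s ^+ m * derive1n m (re (u i)) (s * x + t i)).
    by apply: ct; have [[_ C1] _] := Cu i.
  have c2 i : continuous (fun x => s ^+ m * derive1n m (im (u i)) (s * x + t i)).
    by apply: ct; have [_ [_ C2]] := Cu i.
  split.
    have -> : re (W m) = (fun x => \sum_(i <- q) (complex.Re (c i) * (s ^+ m * derive1n m (re (u i)) (s * x + t i)) +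
      (- complex.Im (c i)) * (s ^+ m * derive1n m (im (u i)) (s * x + t i)))).
      by apply/funext => y; rewrite /re WE Re_sum; apply: eq_bigr => i _; rewrite cReM /= mulNr.
    by apply: cts_sum => i; exact: cts_lin.
  have -> : im (W m) = (fun x => \sum_(i <- q) (complex.Re (c i) * (s ^+ m * derive1n m (im (u i)) (s * x + t i)) +
    complex.Im (c i) * (s ^+ m * derive1n m (re (u i)) (s * x + t i)))).
    by apply/funext => y; rewrite /im WE Im_sum; apply: eq_bigr => i _; rewrite cImM.
  by apply: cts_sum => i; exact: cts_lin.
split.
  rewrite -W0; split.
    apply: (@realCk_chain _ m (fun j => re (W j))); last by case: cW.
    by move=> j x jm; have [] := dW j x jm.
  apply: (@realCk_chain _ m (fun j => im (W j))); last by case: cW.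
  by move=> j x jm; have [] := dW j x jm.
move=> j jm; rewrite -W0; apply/funext => x; rewrite /cderiven.
rewrite (@chain_derive1n _ m (fun j => re (W j)) _ j jm); last first.
  by move=> k y km; have [] := dW k y km.
rewrite (@chain_derive1n _ m (fun j => im (W j)) _ j jm); last first.
  by move=> k y km; have [] := dW k y km.
by rewrite /re /im -/(W j x); case: (W j x).
Qed.

Lemma derive1n_zero (f : R -> R) (A : R) j : (forall x, A < `|x| -> f x = 0) ->
  forall x, A < `|x| -> derive1n j f x = 0.
Proof.
move=> f0; elim: j => [|j IH] x xA; first by rewrite derive1n0 f0.
rewrite derive1nS derive1E.
have [d d0 H] := (ctsP (fun x : R => `|x|) x).1 (@norm_continuous _ _ x) (`|x| - A)
   ltac:(by rewrite subr_gt0).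
have d1 : isd (derive1n j f) x 0.
  apply: (@isd_near _ (fun=> 0) _ _ _ d) => // y; rewrite distrC => /H; rewrite ltr_norml => /andP[_ h].
  by rewrite IH//; lra.
by rewrite derive_val.
Qed.

End ComplexDerivatives.

Section FiniteSpan.
Context {R : realType}.
Local Notation C := R[i].

(* Plays the role of a compactness argument: estimates for the finitely many f j
   pass to the whole family, up to the constant K. *)
Lemma finite_span (I : Type) p r (d : I -> 'M[C]_(p, r)) : exists (n : nat) (f : 'I_n -> I) (K : R),
  0 <= K /\ forall i, exists2 b : 'I_n -> C, d i = \sum_j b j *: d (f j) &
    \sum_j normc (b j) <= K * mnorm (d i).
Proof.
pose rows n (f : 'I_n -> I) : 'M[C]_(n, p * r) := \matrix_j mxvec (d (f j)).
pose P n := `[< exists f : 'I_n -> I, \rank (rows n f) = n >].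
have P0 : exists n, P n.
  exists 0%N; apply/asboolP; exists (fun j : 'I_0 => match j with Ordinal _ h => False_rect _ (notF h) end).
  by apply/eqP; rewrite -leqn0 rank_leq_row.
have Pb n : P n -> (n <= p * r)%N by move=> /asboolP[f <-]; exact: rank_leq_col.
have [n /asboolP[f fr] nmax] := ex_maxnP P0 Pb.
(* The coefficients over a maximal free family are read off with the pseudo-inverse of its matrix of
   rows, whose norm serves as K. *)
exists n, f, (mnorm (pinvmx (rows n f))); split; first exact: mnorm_ge0.
move=> i.
have sub : (mxvec (d i) <= rows n f)%MS.
  apply/negPn/negP => nsub.
  pose g (j : 'I_n.+1) := if unlift ord_max j is Some j' then f j' else i.
  have : P n.+1.
    apply/asboolP; exists g; apply/eqP; rewrite eqn_leq rank_leq_row ltnNge.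
    apply/negP => rk.
    have s1 : (rows n f <= rows n.+1 g)%MS.
      apply/row_subP => j; rewrite rowK.
      by have := row_sub (lift ord_max j) (rows n.+1 g); rewrite rowK /g liftK.
    have s2 : (mxvec (d i) <= rows n.+1 g)%MS.
      by have := row_sub ord_max (rows n.+1 g); rewrite rowK /g unlift_none.
    have : (rows n.+1 g <= rows n f)%MS.
      by rewrite -(geq_leqif (mxrank_leqif_sup s1)) fr.
    by move=> s3; case/negP: nsub; exact: submx_trans s2 s3.
  by move/nmax; rewrite ltnn.
exists (fun j => (mxvec (d i) *m pinvmx (rows n f)) 0 j).
  apply: (can_inj mxvecK); rewrite -[LHS](mulmxKpV sub) linear_sum/=.
  rewrite [LHS]mulmx_sum_row; apply: eq_bigr => j _; by rewrite linearZ/= rowK.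
have -> : \sum_j normc ((mxvec (d i) *m pinvmx (rows n f)) 0 j) = mnorm (mxvec (d i) *m pinvmx (rows n f)).
  by rewrite /mnorm big_ord1.
rewrite (le_trans (mnormM _ _))// mulrC ler_wpM2l ?mnorm_ge0//.
rewrite /mnorm big_ord1 (reindex _ (curry_mxvec_bij p r))/= pair_bigA/=.
by apply: ler_sum => -[k l] _; rewrite mxvecE.
Qed.

End FiniteSpan.

(** * A Hoelder estimate from self-similarity *)

Section Holder.
Context {R : realType}.
Local Notation C := R[i].
Variables (r : nat) (L : nat) (psi : R -> 'cV[C]_r).
Hypothesis L2 : (1 < L)%N.
Hypothesis cpsi : forall e : R, 0 < e -> exists2 d : R, 0 < d &
  forall x y, `|x - y| < d -> mnorm (psi x - psi y) <= e.
Hypothesis spsi : forall x, (L.-1)%:R <= `|x| -> psi x = 0.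
(* At every level N the values of psi on a dyadic cell are obtained from the
   values on the unit cells by a linear map independent of the point. *)
Variable T : nat -> nat -> int -> int -> 'M[C]_r.
Hypothesis psiT : forall N d k x, (d < 2 ^ N)%N -> 0 <= x <= 1 ->
  psi ((x + d%:R) / 2 ^+ N + k%:~R) = \sum_(q <- zr L) T N d k q *m psi (x + q%:~R).

Definition Dif (P : R * R) (q : int) := psi (P.1 + q%:~R) - psi (P.2 + q%:~R).
Definition nD (P : R * R) : R := \sum_(q <- zr L) mnorm (Dif P q).
Definition cell N d (P : R * R) : R * R :=
  ((P.1 + d%:R) / 2 ^+ N, (P.2 + d%:R) / 2 ^+ N).
Definition unitsq (P : R * R) := 0 <= P.1 <= 1 /\ 0 <= P.2 <= 1.

Lemma Dif_cell N d P k : (d < 2 ^ N)%N -> unitsq P ->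
  Dif (cell N d P) k = \sum_(q <- zr L) T N d k q *m Dif P q.
Proof.
move=> dN [P1 P2]; rewrite /Dif !psiT// -sumrB; apply: eq_bigr => q _.
by rewrite mulmxBr.
Qed.

(* On fine cells the finitely many spanning differences are small by uniform
   continuity, and psiT transfers the coefficients from the unit cells. *)
Lemma nD_contract : exists2 N, (1 < N)%N & forall d P, (d < 2 ^ N)%N -> unitsq P ->
  nD (cell N d P) <= 2^-1 * nD P.
Proof.
pose I := {P : R * R | unitsq P}.
pose W (P : I) : 'M[C]_(L.*2.+1, r) := \matrix_(k, i) Dif (sval P) (k%:Z - L%:Z) i 0.
have [n [f [K [K0 HK]]]] := finite_span W.
(* Small enough that the 2L + 1 entries of the window, each at most K e times [nD P], add up to at
   most half of [nD P]. *)
pose e := 2^-1 / (K * (L.*2.+1)%:R + 1).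
have D0 : 0 < K * (L.*2.+1)%:R + 1 by rewrite ltr_wpDl// mulr_ge0.
have e0 : 0 < e by rewrite divr_gt0.
have [s s0 Hs] := cpsi e0.
have [N0 HN0] := pow2_large (s^-1 + 1).
(* N >= 2 makes the exponent 1/N smaller than 1, as the definition of [sm_fun] demands. *)
pose N := maxn N0 2.
have pN : 0 < 2 ^+ N :> R by rewrite exprn_gt0.
have sN : 2 ^- N < s :> R.
  rewrite invf_plt ?posrE//; apply: lt_le_trans (HN0 N _); last by rewrite leq_maxl.
  by rewrite ltrDl.
exists N; first by rewrite leq_maxr.
move=> d P dN uP.
have [b Wb bK] := HK (exist _ P uP).
have Dq q : q \in zr L -> Dif P q = \sum_j b j *: Dif (sval (f j)) q.
  rewrite mem_zr => qL; have kL : (`|(q + L%:Z)%R| < L.*2.+1)%N by lia.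
  have qE : q = (Ordinal kL)%:Z - L%:Z by rewrite /=; lia.
  apply/matrixP => i j; rewrite ord1 summxE.
  have := congr1 (fun M : 'M[C]_(_, _) => M (Ordinal kL) i) Wb.
  rewrite mxE summxE/= -qE => ->; apply: eq_bigr => j' _; rewrite !mxE.
  by rewrite -qE.
have WnD : mnorm (W (exist _ P uP)) = nD P.
  rewrite /nD /zr big_map -[iota _ _]/(index_iota 0 L.*2.+1) big_mkord.
  by apply: eq_bigr => k _; apply: eq_bigr => i _; rewrite big_ord1 mxE.
have cellsmall j k : mnorm (Dif (cell N d (sval (f j))) k) <= e.
  apply: Hs; case: (sval (f j)) (svalP (f j)) => x y [/= /andP[x0 x1] /andP[y0 y1]].
  have -> : (x + d%:R) / 2 ^+ N + k%:~R - ((y + d%:R) / 2 ^+ N + k%:~R) = (x - y) / 2 ^+ N by ring.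
  rewrite normrM [`|_^-1|]gtr0_norm ?invr_gt0// (le_lt_trans _ sN)// ler_piMl ?invr_ge0 ?(ltW pN)//.
  by rewrite ler_norml; lra.
apply: (@le_trans _ _ (\sum_(q <- zr L) (K * nD P) * e)).
  apply: ler_sum => k _.
  have -> : Dif (cell N d P) k = \sum_j b j *: Dif (cell N d (sval (f j))) k.
    rewrite Dif_cell//.
    transitivity (\sum_(q <- zr L) \sum_j b j *: (T N d k q *m Dif (sval (f j)) q)).
      rewrite [LHS]big_seq [RHS]big_seq; apply: eq_bigr => q /Dq ->.
      by rewrite mulmx_sumr; apply: eq_bigr => j _; rewrite -scalemxAr.
    rewrite exchange_big/=; apply: eq_bigr => j _.
    by rewrite Dif_cell ?scaler_sumr//; exact: (svalP (f j)).
  rewrite (le_trans (mnorm_sum _ _ _))//.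
  apply: (@le_trans _ _ (\sum_j normc (b j) * e)).
    by apply: ler_sum => j _; rewrite mnormZ ler_wpM2l ?normc_ge0.
  by rewrite -mulr_suml ler_wpM2r ?(ltW e0)// (le_trans bK)// WnD.
rewrite sum_zr_const.
have n0 : 0 <= nD P by rewrite sumr_ge0// => q _; exact: mnorm_ge0.
have -> : (L.*2.+1)%:R * (K * nD P * e) = (2^-1 * nD P) * ((K * (L.*2.+1)%:R) / (K * (L.*2.+1)%:R + 1)).
  by rewrite /e; ring.
by apply: mul_frac_le => //; [rewrite mulr_ge0|rewrite lerDl].
Qed.

Lemma psi_bounded0 : exists2 B : R, 0 <= B & forall x, mnorm (psi x) <= B.
Proof.
have [d d0 Hd] := cpsi ltr01.
have [N HN] := pow2_large (d^-1 + 1).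
have p2 : 0 < 2 ^+ N :> R by rewrite exprn_gt0.
have sN : 2 ^- N < d :> R.
  by rewrite invf_plt ?posrE//; apply: lt_le_trans (HN N (leqnn _)); rewrite ltrDl.
pose B : R := 1 + \sum_(k <- zr (2 ^ N * L)) mnorm (psi (k%:~R / 2 ^+ N)).
have HB x : mnorm (psi x) <= B.
  pose k := Num.floor (2 ^+ N * x).
  have kx := floor_near N x.
  have xk : mnorm (psi x - psi (k%:~R / 2 ^+ N)) <= 1.
    apply: Hd; have -> : x - k%:~R / 2 ^+ N = - ((k%:~R - 2 ^+ N * x) / 2 ^+ N) by field; rewrite gt_eqF.
    rewrite normrN normrM [`|_^-1|]gtr0_norm ?invr_gt0//; apply: le_lt_trans sN.
    by rewrite ler_piMl// invr_ge0 ltW.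
  rewrite -(subrK (psi (k%:~R / 2 ^+ N)) (psi x)) (le_trans (mnormD _ _))// lerD//.
  have [kL|kL] := leqP `|k| (2 ^ N * L).
    rewrite (bigD1_seq k) ?mem_zr ?zr_uniq//= lerDl sumr_ge0// => l _; exact: mnorm_ge0.
  rewrite spsi ?mnorm0 ?sumr_ge0//; first by move=> l _; exact: mnorm_ge0.
  rewrite normrM [`|_^-1|]gtr0_norm ?invr_gt0// ler_pdivlMr// -natrX -natrM.
  rewrite (le_trans (_ : _ <= (2 ^ N * L)%:R)) ?ler_nat ?[(L.-1 * _)%N]mulnC ?leq_mul2l ?leq_pred ?orbT//.
  by rewrite leNgt -[`|k%:~R|]intr_norm pmulrn ltr_int; lia.
exists B => //; exact: le_trans (mnorm_ge0 (psi 0)) (HB 0).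
Qed.

Lemma psi_bounded : exists2 M : R, 0 <= M & forall P, unitsq P -> nD P <= M.
Proof.
have [B B0 HB] := psi_bounded0.
exists ((L.*2.+1)%:R * (B + B)); first by rewrite mulr_ge0// addr_ge0.
move=> P _; rewrite -sum_zr_const; apply: ler_sum => q _; rewrite /Dif.
by rewrite (le_trans (mnormD _ _))// mnormN lerD.
Qed.

(** Iterating the contraction bounds the oscillation on dyadic cells of level N t by a multiple of
    2^-t, which is the power 1/N of the cell width. *)
Lemma psi_holder : exists (N : nat) (K : R), [/\ (1 < N)%N, 0 < K &
  forall x y, mnorm (psi x - psi y) <= K * `|x - y| `^ (N%:R^-1)].
Proof.
have [N N1 HN] := nD_contract; have [M M0 HM] := psi_bounded.
have [B B0 HB] := psi_bounded0.
have N0 : (0 < N)%N by exact: ltnW.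
have cells t d P : (d < 2 ^ (N * t))%N -> unitsq P -> nD (cell (N * t) d P) <= 2 ^- t * M.
  elim: t d P => [|t IH] d P dt uP.
    rewrite muln0 expn0 ltnS leqn0 in dt; rewrite (eqP dt) muln0 expr0 invr1 mul1r.
    by rewrite /cell addr0 addr0 expr0 !divr1 -surjective_pairing; exact: HM.
  rewrite mulnS in dt *.
  pose d1 := (d %% 2 ^ (N * t))%N; pose d2 := (d %/ 2 ^ (N * t))%N.
  have d1t : (d1 < 2 ^ (N * t))%N by rewrite ltn_mod expn_gt0.
  have d2t : (d2 < 2 ^ N)%N by rewrite ltn_divLR ?expn_gt0// -expnD.
  have dE : d = (d2 * 2 ^ (N * t) + d1)%N by rewrite -divn_eq.
  have cE (x : R) : (x + d%:R) / 2 ^+ (N + N * t) = ((x + d1%:R) / 2 ^+ (N * t) + d2%:R) / 2 ^+ N.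
    rewrite dE natrD natrM natrX exprD; field.
    by rewrite !gt_eqF ?exprn_gt0.
  have -> : cell (N + N * t) d P = cell N d2 (cell (N * t) d1 P) by rewrite /cell !cE.
  have uc : unitsq (cell (N * t) d1 P).
    have H (x : R) : 0 <= x <= 1 -> 0 <= (x + d1%:R) / 2 ^+ (N * t) <= 1.
      move=> /andP[x0 x1]; rewrite divr_ge0 ?addr_ge0 ?exprn_ge0//= ler_pdivrMr ?exprn_gt0// mul1r.
      rewrite -natrX (le_trans (_ : _ <= d1.+1%:R)) ?ler_nat//.
      by rewrite -natr1 addrC lerD2l.
    by case: uP => u1 u2; split; exact: H.
  rewrite (le_trans (HN _ _ d2t uc))// exprS invfM -mulrA ler_pM2l ?invr_gt0//.
  exact: IH.
(* The global cell index splits as j = q 2^(N t) + d, with d locating a cell in the unit interval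
   and q the translate; for |q| > L both points lie outside the support. *)
have onecell t (j : int) (u v : R) : j%:~R <= 2 ^+ (N * t) * u <= j%:~R + 1 ->
    j%:~R <= 2 ^+ (N * t) * v <= j%:~R + 1 -> mnorm (psi u - psi v) <= 2 ^- t * M.
  move=> ju jv; pose m := (2 ^ (N * t))%N.
  have m0 : (0 < m)%N by rewrite expn_gt0.
  have mR : 2 ^+ (N * t) = m%:R :> R by rewrite natrX.
  have mR0 : 0 < m%:R :> R by rewrite ltr0n.
  pose q := (j %/ m%:Z)%Z; pose d := `|(j %% m%:Z)%Z|%N.
  have dm : (d < m)%N by rewrite /d; lia.
  have jE : j%:~R = q%:~R * m%:R + d%:R :> R.
    have -> : j = q * m%:Z + d%:Z by rewrite /q /d; lia.
    by rewrite rmorphD rmorphM/=.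
  rewrite mR in ju jv.
  pose x := m%:R * u - j%:~R; pose y := m%:R * v - j%:~R.
  have x01 : 0 <= x <= 1 by rewrite /x; lra.
  have y01 : 0 <= y <= 1 by rewrite /y; lra.
  have uE : u = (x + d%:R) / m%:R + q%:~R by rewrite /x jE; field; rewrite gt_eqF.
  have vE : v = (y + d%:R) / m%:R + q%:~R by rewrite /y jE; field; rewrite gt_eqF.
  have [qL|qL] := leqP `|q| L.
    apply: le_trans (cells t d (x, y) dm _); last by split.
    rewrite /nD (bigD1_seq q) ?mem_zr ?zr_uniq//= /Dif /cell/= mR -uE -vE lerDl sumr_ge0// => l _.
    exact: mnorm_ge0.
  have z0 (z w : R) : w = (z + d%:R) / m%:R + q%:~R -> 0 <= z <= 1 -> psi w = 0.
    move=> wE /andP[z0 z1]; apply: spsi.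
    have f0 : 0 <= (z + d%:R) / m%:R by rewrite divr_ge0 ?addr_ge0.
    have f1 : (z + d%:R) / m%:R <= 1.
      rewrite ler_pdivrMr// mul1r (le_trans (_ : _ <= d.+1%:R)) ?ler_nat//.
      by rewrite -natr1 addrC lerD2l.
    have LE : L%:R = (L.-1)%:R + 1 :> R by rewrite natr1 prednK// ltnW.
    have qb : L%:R + 1 <= `|q%:~R| :> R.
      by rewrite natr1 -intr_norm -abszE ler_nat.
    rewrite wE; have := lerB_normD (q%:~R : R) ((z + d%:R) / m%:R).
    by rewrite (ger0_norm f0) [(_ + _)%R in X in _ -> X]addrC; lra.
  rewrite (z0 _ _ uE x01) (z0 _ _ vE y01) subrr mnorm0 mulr_ge0// invr_ge0 exprn_ge0//.
(* Points no farther apart than one cell width lie in the same cell or in two adjacent ones; in the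
   latter case the common end c is inserted. *)
have close t (u v : R) : `|u - v| <= 2 ^- (N * t) -> mnorm (psi u - psi v) <= 2 * (2 ^- t * M).
  move=> uv; pose m : R := 2 ^+ (N * t); have m0 : 0 < m by rewrite exprn_gt0.
  wlog : u v uv / u <= v => [H|ulev].
    by have [/H|/ltW/H] := leP u v; [exact|rewrite mnormB; apply; rewrite distrC].
  have vu : m * v <= m * u + 1.
    move: uv; rewrite distrC ger0_norm ?subr_ge0// => uv.
    by rewrite -lerBlDl -mulrBr -(@mulfV _ m) ?gt_eqF// ler_pM2l.
  have muv : m * u <= m * v by rewrite ler_pM2l.
  pose j := Num.floor (m * u).
  have /andP[j1 j2] := floor_itv (m * u); rewrite -/j rmorphD/= in j1 j2.
  have t0 : 0 <= 2 ^- t * M by rewrite mulr_ge0// invr_ge0 exprn_ge0.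
  have [vj|vj] := leP (m * v) (j%:~R + 1).
    apply: (@le_trans _ _ (2 ^- t * M)); last by rewrite ler_peMl//; lra.
    by apply: (onecell t j); rewrite -/m; lra.
  pose c := (j%:~R + 1) / m.
  have mc : m * c = j%:~R + 1 by rewrite /c mulrC divfK// gt_eqF.
  have h1 : mnorm (psi u - psi c) <= 2 ^- t * M by apply: (onecell t j); rewrite -/m ?mc; lra.
  have h2 : mnorm (psi c - psi v) <= 2 ^- t * M.
    by apply: (onecell t (j + 1)); rewrite -/m ?mc rmorphD/=; lra.
  have -> : psi u - psi v = (psi u - psi c) + (psi c - psi v) by rewrite addrA subrK.
  by rewrite (le_trans (mnormD _ _))//; lra.
pose tau : R := N%:R^-1.
have tau0 : 0 < tau by rewrite invr_gt0 ltr0n.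
have pw t : (2 ^- (N * t)) `^ tau = 2 ^- t :> R.
  rewrite mulnC exprM -exprVn -[LHS]/((_ ^+ N) `^ _) -powR_mulrn ?invr_ge0 ?exprn_ge0// -powRrM.
  by rewrite divff ?powRr1 ?invr_ge0 ?exprn_ge0// pnatr_eq0 -lt0n.
have K0 : 0 <= 4 * M + 2 * B by rewrite addr_ge0 ?mulr_ge0.
exists N, (4 * M + 2 * B + 1); split => //; first exact: ltr_wpDl.
move=> x y; have [->|xy] := eqVneq x y.
  by rewrite subrr mnorm0 mulr_ge0 ?powR_ge0// addr_ge0.
have h0 : 0 < `|x - y| by rewrite normr_gt0 subr_eq0.
rewrite -/tau; have := fun t => close t x y; move: h0; set h : R := `|x - y| => h0 {}close.
have p0 : 0 <= h `^ tau by exact: powR_ge0.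
have [h1|h1] := ltP 1 h.
  have p1 : 1 <= h `^ tau by rewrite -[leLHS]/((fun=> 1) tau) -(@powR1 R) ge0_ler_powR ?nnegrE ?(ltW h0) ?(ltW h1) ?(ltW tau0).
  apply: (@le_trans _ _ (2 * B)).
    by rewrite (le_trans (mnormD _ _))// mnormN mulr_natl mulr2n lerD.
  apply: (@le_trans _ _ ((4 * M + 2 * B + 1) * 1)).
    by rewrite mulr1; have := mulr_ge0 (ler0n R 4) M0; lra.
  by apply: ler_wpM2l => //; exact: addr_ge0.
(* The least such t satisfies 2^(-N (t+1)) < h <= 2^(-N t), so 2^-t is at most twice the power 1/N
   of h. *)
have ex : exists t, 1 < 2 ^+ (N * t.+1) * h.
  have [n0 Hn0] := pow2_large (h^-1 + 1); exists n0.
  have := Hn0 (N * n0.+1)%N; rewrite (leq_trans (leqnSn n0)) ?leq_pmull// => /(_ isT) H.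
  by rewrite -ltr_pdivrMr// div1r (lt_le_trans _ H)// ltrDl.
case: (ex_minnP ex) => t Ht mt.
have ht : h <= 2 ^- (N * t).
  rewrite -[leRHS]div1r ler_pdivlMr ?exprn_gt0// mulrC.
  case: t Ht mt => [_ _|t _ mt]; first by rewrite muln0 expr0 mul1r.
  by rewrite leNgt; apply/negP => /mt; rewrite ltnn.
apply: le_trans (close _ ht) _.
have tp : 2 ^- t <= 2 * h `^ tau.
  have -> : 2 ^- t = 2 * 2 ^- t.+1 :> R by rewrite exprS invfM mulrA divff ?mul1r.
  rewrite ler_pM2l// -pw ge0_ler_powR ?nnegrE ?(ltW h0) ?(ltW tau0) ?invr_ge0 ?exprn_ge0//.
  by apply: ltW; rewrite -[ltLHS]div1r ltr_pdivrMr ?exprn_gt0// mulrC.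
apply: (@le_trans _ _ (4 * M * h `^ tau)).
  have -> : 4 * M * h `^ tau = 2 * ((2 * h `^ tau) * M) by ring.
  by rewrite ler_pM2l// ler_wpM2r.
by rewrite ler_wpM2r//; lra.
Qed.

End Holder.

(** * Lower bounds for the smoothness exponent of a function *)

Section Regularity.
Context {R : realType}.
Local Notation C := R[i].
Local Notation mu := (@lebesgue_measure R).
Local Notation isd f x d := (is_derive (x : R) (1 : R) (f : R -> R) (d : R)).
Implicit Types (f : R -> C).

(** The norm of exponent +oo unfolds to an essential supremum under the condition that the whole
    space has positive measure. *)
Lemma setT_mu_gt0 : (0 < mu [set: R])%E.
Proof.
apply: (@lt_le_trans _ _ (mu `[0, 1]%classic)).
  by rewrite lebesgue_measure_itv/= lte_fin ltr01 oppr0 addr0 lte_fin ltr01.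
by apply: le_measure; rewrite ?inE//=.
Qed.

Lemma Lfun_cts_bounded (h : R -> R) (M : R) : continuous h ->
  (forall x, `|h x| <= M) -> h \in Lfun mu +oo%E.
Proof.
move=> ch hM; apply/andP; split.
  by rewrite inE/=; exact: measurable_realfun.continuous_measurable_fun.
rewrite inE/= /finite_norm unlock setT_mu_gt0 (@le_lt_trans _ _ M%:E) ?ltry//.
by apply/ess_sup_inf.ess_supP; apply: nearW => x; rewrite /= lee_fin.
Qed.

Lemma Linfty_norm_le f (M : R) : (forall x, normc (f x) <= M) ->
  (Linfty_norm f <= M%:E)%E.
Proof.
move=> fM; rewrite /Linfty_norm unlock setT_mu_gt0.
apply/ess_sup_inf.ess_supP; apply: nearW => x; rewrite /= lee_fin ger0_norm//; exact: normc_ge0.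
Qed.

Lemma abs_continuous_lip f (M : R) : 0 <= M ->
  (forall x y, normc (f y - f x) <= M * `|y - x|) -> abs_continuous f.
Proof.
move=> M0 fM e e0; have M1 : 0 < M + 1 by rewrite ltr_wpDl.
exists (e / (M + 1)); first by rewrite divr_gt0.
move=> n x y xy _; rewrite ltr_pdivlMr// => H; apply: le_lt_trans H.
rewrite mulrC mulr_sumr; apply: ler_sum => i _.
rewrite (le_trans (fM _ _))// ger0_norm ?subr_ge0// ler_wpM2r ?subr_ge0//.
by rewrite lerDl.
Qed.

(** The classical derivatives form the Sobolev chain: they are bounded by compactness of the
    support, and those of order below m are Lipschitz, hence absolutely continuous. *)
Lemma sm_fun_ge (A m : nat) (tau K : R) f : Ck m f -> (forall x, A%:R <= `|x| -> f x = 0) ->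
  0 < tau -> tau < 1 -> 0 < K ->
  (forall x y, normc (cderiven m f x - cderiven m f y) <= K * `|x - y| `^ tau) ->
  ((m%:R + tau)%:E <= sm_fun f)%E.
Proof.
move=> [C1 C2] f0 t0 t1 K0 hol; apply: ereal_sup_ubound.
exists m, tau; split => //; first exact: ltW.
have z1 j : forall x, A%:R < `|x| -> derive1n j (re f) x = 0.
  by apply: derive1n_zero => x /ltW/f0; rewrite /re => ->.
have z2 j : forall x, A%:R < `|x| -> derive1n j (im f) x = 0.
  by apply: derive1n_zero => x /ltW/f0; rewrite /im => ->.
have bd (h : R -> R) : continuous h -> (forall x, A%:R < `|x| -> h x = 0) ->
    exists2 M : R, 0 <= M & forall x, `|h x| <= M.
  move=> ch h0; have [M M0 HM] := cts_bounded A%:R ch; exists M => // x.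
  by have [xA|xA] := leP `|x| A%:R; [exact: HM|rewrite h0// normr0].
have cR j : (j <= m)%N -> continuous (derive1n j (re f)) by exact: realCk_cts.
have cI j : (j <= m)%N -> continuous (derive1n j (im f)) by exact: realCk_cts.
exists (fun j => cderiven j f).
  split.
  - by apply/aeW => x; rewrite /cderiven !derive1n0 /re /im; case: (f x).
  - move=> j jm; split.
      by have [M _ HM] := bd _ (cR j jm) (z1 j); exact: (Lfun_cts_bounded (cR j jm) HM).
    by have [M _ HM] := bd _ (cI j jm) (z2 j); exact: (Lfun_cts_bounded (cI j jm) HM).
  - move=> j jm.
    have [M1 M10 H1] := bd _ (cR j.+1 jm) (z1 j.+1).
    have [M2 M20 H2] := bd _ (cI j.+1 jm) (z2 j.+1).
    apply: (@abs_continuous_lip _ (M1 + M2)); first exact: addr_ge0.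
    move=> x y; rewrite (le_trans (normc_le_ReIm _))// mulrDl.
    pose B := Num.max `|x| `|y|.
    have xB : `|x| <= B by rewrite le_max lexx.
    have yB : `|y| <= B by rewrite le_max lexx orbT.
    apply: lerD; rewrite /cderiven /=.
      exact: (@mvt_le_sym _ _ (derive1n j.+1 (re f)) B _ _ _ (fun z _ => realCk_derive z C1 jm) (fun z _ => H1 z) xB yB).
    exact: (@mvt_le_sym _ _ (derive1n j.+1 (im f)) B _ _ _ (fun z _ => realCk_derive z C2 jm) (fun z _ => H2 z) xB yB).
  - move=> j jm; apply/aeW => x; split; first exact: realCk_derive C1 jm.
    exact: realCk_derive C2 jm.
exists K => // t; apply: Linfty_norm_le => x.
by rewrite (le_trans (hol _ _))// opprB addrCA subrr addr0.
Qed.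

End Regularity.

Section LimitRegularity.
Context {R : realType}.
Local Notation C := R[i].
Variables (r m : nat) (a : int -> 'M[C]_r) (A : nat).
Hypothesis sA : zsupp A a.
Variable Phi : R -> 'M[C]_r.
Hypothesis CPhi : forall i j, Ck m (fun x => Phi x i j).
Hypothesis sPhi : forall x, A%:R <= `|x| -> Phi x = 0.
Hypothesis limS : forall e : R, 0 < e -> exists N, forall n, (N <= n)%N ->
  forall k : int, mnorm (Sn a n k - Phi (2 ^- n * k%:~R)) <= e.
Variable w : 'cV[C]_r.
Local Notation f := (fun (l : 'I_r) (x : R) => (Phi x *m w) l 0).
Local Notation S := (Sn a).

Let cPhi i j : continuous (re (fun x => Phi x i j)) /\ continuous (im (fun x => Phi x i j)).
Proof. by have [C1 C2] := CPhi i j; split; [exact: realCk_cts C1 (leq0n _)|exact: realCk_cts C2 (leq0n _)]. Qed.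

Lemma entry_Ck l : Ck m (f l).
Proof.
have [+ _] := @cderiven_sum R _ (index_enum 'I_r) m (fun i => w i 0) (fun i x => Phi x l i) 1 (fun=> 0) (CPhi l).
suff -> : (fun x : R => \sum_(i <- index_enum 'I_r) w i 0 * Phi (1 * x + 0) l i) = f l by [].
by apply/funext => x; rewrite mxE; apply: eq_bigr => i _; rewrite mul1r addr0 mulrC.
Qed.

Lemma refine_entry N l x : f l x =
  \sum_(q <- [seq (k, i) | k <- zr (2 ^ N * A), i <- index_enum 'I_r])
    S N q.1 l q.2 * f q.2 (2 ^+ N * x + - q.1%:~R).
Proof.
rewrite -[LHS]/((Phi x *m w) l 0) (Phi_refine sA cPhi sPhi limS N x) mulmx_suml summxE big_allpairs_dep/=.
by apply: eq_bigr => k _; rewrite -mulmxA mxE.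
Qed.

Definition psi (x : R) : 'cV[C]_r := \col_l cderiven m (f l) x.

(** The m-fold derivative of [refine_entry]. The growing factor does no harm, since the contraction
    is drawn from uniform continuity and not from the size of the coefficients. *)
Lemma psi_refine N x : psi x =
  (2 ^+ (N * m))%:C *: \sum_(k <- zr (2 ^ N * A)) S N k *m psi (2 ^+ N * x - k%:~R).
Proof.
apply/matrixP => l j; rewrite ord1 !mxE summxE.
have [_ /(_ m (leqnn _))] := cderiven_sum [seq (k, i) | k <- zr (2 ^ N * A), i <- index_enum 'I_r]
  (fun q => S N q.1 l q.2) (2 ^+ N) (fun q => - q.1%:~R) (fun q => entry_Ck q.2).
have <- : f l = (fun x0 : R => \sum_(i <- [seq (k, i) | k <- zr (2 ^ N * A),
    i <- index_enum 'I_r]) S N i.1 l i.2 * f i.2 (2 ^+ N * x0 + - i.1%:~R)).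
  by apply/funext => y; exact: refine_entry.
move=> ->; rewrite exprM; congr (_ * _); rewrite big_allpairs_dep/=.
by apply: eq_bigr => k _; rewrite mxE; apply: eq_bigr => i _; rewrite mxE.
Qed.

Lemma psi_supp x : A%:R < `|x| -> psi x = 0.
Proof.
move=> xA; apply/matrixP => l j; rewrite !mxE /cderiven.
have z y : A%:R < `|y| -> f l y = 0 by move=> /ltW/sPhi ->; rewrite mul0mx mxE.
by rewrite !(@derive1n_zero _ _ A%:R)// => y /z; rewrite /re /im => ->.
Qed.

(** Reindexing the refinement equation by q makes the coefficients independent of x; as x lies in
    [0, 1], translates with |q| >= A + 3 vanish. *)
Lemma psi_level N d k x : (d < 2 ^ N)%N -> 0 <= x <= 1 ->
  psi ((x + d%:R) / 2 ^+ N + k%:~R) =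
  \sum_(q <- zr A.+2) ((2 ^+ (N * m))%:C *: S N (d%:Z + 2 ^+ N * k - q)) *m psi (x + q%:~R).
Proof.
move=> dN x01; rewrite (psi_refine N) scaler_sumr.
pose c := d%:Z + 2 ^+ N * k.
have arg q : 2 ^+ N * ((x + d%:R) / 2 ^+ N + k%:~R) - (c - q)%:~R = x + q%:~R.
  rewrite /c rmorphB rmorphD rmorphM rmorphXn /=; field.
  by rewrite gt_eqF ?exprn_gt0.
rewrite (zsum_reindex (h := fun q => c - q) (L' := A.+2) (subzI_bij c)).
- by apply: eq_bigr => q _; rewrite arg -scalemxAl.
- by move=> j /(Sn_supp sA) ->; rewrite mul0mx scaler0.
- move=> q qA /=; rewrite arg psi_supp ?mulmx0 ?scaler0//.
  have qR : A.+3%:R <= `|q%:~R| :> R by rewrite -intr_norm -abszE ler_nat.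
  have AE : A.+3%:R = A%:R + 3 :> R by rewrite -[A.+3]addn3 natrD.
  move: x01 => /andP[x0 x1]; have := lerB_normD (q%:~R : R) x.
  by rewrite (ger0_norm x0) [(_ + x)%R]addrC; lra.
Qed.

Lemma psi_cts i j : continuous (re (fun x => psi x i j)) /\ continuous (im (fun x => psi x i j)).
Proof.
have [C1 C2] := entry_Ck i.
have -> : (fun x => psi x i j) = cderiven m (f i) by apply/funext => x; rewrite mxE.
by split; [exact: realCk_cts C1 (leqnn _)|exact: realCk_cts C2 (leqnn _)].
Qed.

Lemma entry_sm : exists2 tau : R, 0 < tau & forall l, ((m%:R + tau)%:E <= sm_fun (f l))%E.
Proof.
(* [psi_supp] needs |x| > A strictly; the closed condition expected by [psi_holder] holds from A + 1
   on. *)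
have s1 (x : R) : A.+1%:R <= `|x| -> psi x = 0.
  by move=> xA; apply: psi_supp; apply: lt_le_trans xA; rewrite ltr_nat.
have [N [K [N1 K0 H]]] := @psi_holder R r A.+2 psi isT
  (fun e => @mx_unif R r 1 psi A.+1%:R e psi_cts s1) s1
  (fun N d k q => (2 ^+ (N * m))%:C *: S N (d%:Z + 2 ^+ N * k - q)) psi_level.
have N0 : 0 < N%:R :> R by rewrite ltr0n ltnW.
exists N%:R^-1; first by rewrite invr_gt0.
move=> l; apply: (@sm_fun_ge _ A m N%:R^-1 K (f l) (entry_Ck l)) => //.
- by move=> x /sPhi ->; rewrite mul0mx mxE.
- by rewrite invr_gt0.
- by rewrite invf_lt1// ltr1n.
- move=> x y; apply: le_trans (H x y).
  by have := le_mnorm (psi x - psi y) l 0; rewrite !mxE.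
Qed.

End LimitRegularity.

Section ErealLimits.
Context {R : realType}.

Lemma ecvg0P (u : nat -> \bar R) : (forall n, (0 <= u n)%E) ->
  u n @[n --> \oo] --> 0%E <->
  forall e : R, 0 < e -> exists N, forall n, (N <= n)%N -> (u n <= e%:E)%E.
Proof.
move=> u0; split=> [H e e0|H P].
  have : nbhs (0%E : \bar R) [set y | (y <= e%:E)%E].
    rewrite /nbhs/= /filter_from/=; apply: (filterS (P := [set r : R | r < e])).
      by move=> r /= re; rewrite lee_fin ltW.
    exact: lt_nbhsl.
  by move=> /H[N _ HN]; exists N => n; exact: HN.
rewrite /nbhs/= => /nbhs_ballP[e /= e0 HP].
have e2 : 0 < e / 2 by rewrite divr_gt0.
have [N HN] := H (e / 2) e2.
exists N => // n /= /HN.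
case: (u n) (u0 n) => [x|//|//]; rewrite !lee_fin => x0 xe.
apply: HP; rewrite /ball/= sub0r normrN ger0_norm//; lra.
Qed.

End ErealLimits.

(** * Limit of the iterated masks of a convergent scheme *)

Section Lagrange.
Context {R : realType}.
Local Notation C := R[i].
Variables (r m : nat) (a : int -> 'M[C]_r) (A : nat).
Hypothesis sA : zsupp A a.

Lemma iter_row (i : 'I_r) n k :
  iter n (subdiv a) (fun k => row i (@diracI R r k)) k = row i (Sn a n k).
Proof.
rewrite (iter_subdivE sA _ n (leqnn _)) (@zsum_delta _ _ _ 0)//.
  by rewrite mulr0 subr0 /diracI eqxx -row_mul mul1mx.
by move=> l l0; rewrite /diracI (negbTE l0) raddf0 row0 mul0mx.
Qed.

(** The scheme is run on the rows of the Dirac sequence. Its convergence is local, but on |k| > 2^n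
    (A + 1) both S_n and the limit vanish, which makes it uniform over all integers. *)
Lemma lagrange_limit : lagrange_convergent m a ->
  exists Phi : R -> 'M[C]_r, [/\ forall i j, Ck m (fun x => Phi x i j),
    forall x, A.+1%:R <= `|x| -> Phi x = 0 &
    forall e : R, 0 < e -> exists N, forall n, (N <= n)%N ->
      forall k : int, mnorm (Sn a n k - Phi (2 ^- n * k%:~R)) <= e].
Proof.
move=> H; have {H} /choice[eta He] i := H (fun k => row i (@diracI R r k)).
have loc (K e : R) : 0 < K -> 0 < e -> exists N, forall n, (N <= n)%N -> forall (k : int) i l,
    `|k%:~R : R| <= 2 ^+ n * K -> normc (Sn a n k i l - eta i l (2 ^- n * k%:~R)) <= e.
  move=> K0 e0.
  have [N HN] : exists N, forall q : 'I_r * 'I_r, q \in index_enum _ -> forall n, (N <= n)%N -> forall k : int,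
      `|k%:~R : R| <= 2 ^+ n * K -> normc (Sn a n k q.1 q.2 - eta q.1 q.2 (2 ^- n * k%:~R)) <= e.
    apply: seq_max_nat => [q N N' NN' HN n nN|[i l]]; first by apply: HN; exact: leq_trans nN.
    have [_ /(_ K K0 l)] := He i.
    move/ecvg0P => H; have [|N HN] := H _ e e0.
      move=> n; apply: (@le_trans _ _ (normc (iter n (subdiv a) (fun k => row i (@diracI R r k)) 0 0 l -
                     eta i l (2%:R ^- n * 0%:~R)))%:E); first by rewrite lee_fin normc_ge0.
      apply: ereal_sup_ubound; exists 0 => //=.
      by rewrite normr0 mulr_ge0 ?exprn_ge0// ltW.
    exists N => n nN k kK /=; rewrite -lee_fin; apply: le_trans (HN n nN).
    by apply: ereal_sup_ubound; exists k => //; rewrite iter_row mxE.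
  by exists N => n nN k i l kK; exact: (HN (i, l) (mem_index_enum _) n nN k kK).
have ceta i l : continuous (re (eta i l)) /\ continuous (im (eta i l)).
  have [/(_ l)[C1 C2] _] := He i.
  by split; [exact: realCk_cts C1 (leq0n _)|exact: realCk_cts C2 (leq0n _)].
(* floor(2^n x) has modulus at least 2^n (A + 1) - 1, beyond the support of S_n for large n; the
   extra 1 in the radius pays for the floor. *)
have zero x i l : A.+1%:R <= `|x| -> eta i l x = 0.
  move=> xA; apply: (@normc_eq_lim _ _ _ 3) => e e0; rewrite subr0.
  have [c1 c2] := ceta i l.
  have [d1 d10 H1] := (ctsP _ _).1 (c1 x) e e0; have [d2 d20 H2] := (ctsP _ _).1 (c2 x) e e0.
  have [N1 HN1] := pow2_large (d1^-1 + d2^-1 + 1).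
  have K0 : 0 < `|x| + 1 by rewrite ltr_wpDl.
  have [N2 HN2] := loc _ e K0 e0.
  pose n := maxn N1 N2; pose k := Num.floor (2 ^+ n * x).
  have kn := floor_near n x; rewrite -/k in kn.
  have p0 : 0 < 2 ^+ n :> R by rewrite exprn_gt0.
  have := HN1 n (leq_maxl _ _); rewrite -/n => HN.
  have i1 : 0 < d1^-1 by rewrite invr_gt0.
  have i2 : 0 < d2^-1 by rewrite invr_gt0.
  have nx : `|2 ^+ n * x| = 2 ^+ n * `|x| by rewrite normrM (gtr0_norm p0).
  have k1 : 2 ^+ n * `|x| - 1 <= `|k%:~R|.
    have := lerB_normD (2 ^+ n * x) (k%:~R - 2 ^+ n * x); rewrite nx subrKC.
    by move: kn; lra.
  have k2 : `|k%:~R| <= 2 ^+ n * `|x| + 1.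
    have := ler_normD (2 ^+ n * x) (k%:~R - 2 ^+ n * x); rewrite nx subrKC.
    by move: kn; lra.
  have Sk : Sn a n k = 0.
    apply: (Sn_supp sA); rewrite ltnNge; apply/negP => kA.
    have : `|k%:~R| <= (2 ^ n * A)%:R :> R by rewrite normr_int_le.
    rewrite natrM natrX => kA'.
    have : 2 ^+ n * A.+1%:R <= 2 ^+ n * `|x| by rewrite ler_pM2l.
    have -> : 2 ^+ n * A.+1%:R = 2 ^+ n * A%:R + 2 ^+ n :> R by rewrite -[A.+1%:R]natr1; ring.
    lra.
  have := HN2 n (leq_maxr _ _) k i l; rewrite Sk mxE sub0r normc_opp => HH.
  set y := 2 ^- n * k%:~R in HH.
  have yx (d : R) : 0 < d -> d^-1 < 2 ^+ n -> `|x - y| < d.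
    move=> d0 dn; rewrite distrC; have -> : y - x = (k%:~R - 2 ^+ n * x) / 2 ^+ n by rewrite /y; field; rewrite gt_eqF.
    rewrite normrM [`|_^-1|]gtr0_norm ?invr_gt0// ltr_pdivrMr//.
    by apply: (le_lt_trans kn); rewrite -[ltLHS](mulfV (lt0r_neq0 d0)) ltr_pM2l.
  have h1 : `|re (eta i l) x - re (eta i l) y| < e by apply: H1; apply: yx => //; lra.
  have h2 : `|im (eta i l) x - im (eta i l) y| < e by apply: H2; apply: yx => //; lra.
  have h0 : normc (eta i l y) <= e.
    by apply: HH; rewrite mulrDr mulr1 (le_trans k2)// lerD2l; lra.
  have := normcD (eta i l x - eta i l y) (eta i l y); rewrite subrK.
  have := normc_le_ReIm (eta i l x - eta i l y).
  have -> : complex.Re (eta i l x - eta i l y) = re (eta i l) x - re (eta i l) y.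
    by rewrite /re; case: (eta i l x) => ? ?; case: (eta i l y).
  have -> : complex.Im (eta i l x - eta i l y) = im (eta i l) x - im (eta i l) y.
    by rewrite /im; case: (eta i l x) => ? ?; case: (eta i l y).
  by move: h0 h1 h2; lra.
exists (fun x => \matrix_(i, l) eta i l x); split.
- move=> i l; have [/(_ l)] := He i.
  by have -> : (fun x => (\matrix_(i, l) eta i l x) i l) = eta i l by apply/funext => x; rewrite mxE.
- by move=> x xA; apply/matrixP => i l; rewrite !mxE zero.
move=> e e0; have e1 : 0 < e / (r * r).+1%:R by rewrite divr_gt0.
have K0 : 0 < A.+1%:R :> R by rewrite ltr0n.
have [N HN] := loc A.+1%:R _ K0 e1; exists N => n nN k.
have p0 : 0 < 2 ^+ n :> R by rewrite exprn_gt0.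
rewrite (le_trans (mnorm_le (e := e / (r * r).+1%:R) _))//; last first.
  rewrite mulrCA; apply: mul_frac_le; rewrite ?ltr0n ?ler_nat//; exact: ltW.
move=> i l; rewrite !mxE; have [kA|kA] := leP `|k%:~R : R| (2 ^+ n * A.+1%:R); first exact: HN.
rewrite zero; last by rewrite normrM gtr0_norm ?invr_gt0// mulrC ler_pdivlMr// mulrC ltW.
rewrite (Sn_supp sA) ?mxE ?subrr; first by rewrite [normc 0](eqP (_ : _ == 0)) ?normc_eq0// ltW.
rewrite ltnNge; apply/negP => H; move: kA; apply/negP; rewrite -leNgt -natrX -natrM normr_int_le.
by rewrite (leq_trans H)// leq_mul2l leqnSn orbT.
Qed.

End Lagrange.

Section SmoothnessOfDistribution.
Context {R : realType}.
Local Notation C := R[i].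

Lemma lt_sm_vec r (f : 'I_r -> R -> C) (c : \bar R) : (c < +oo)%E ->
  (forall l, (c < sm_fun (f l))%E) -> (c < sm_vec f)%E.
Proof.
move=> c0 H; rewrite /sm_vec; elim/big_ind: _ => // x y cx cy.
by rewrite lt_min cx.
Qed.

Lemma sm_vec_lt r (f : 'I_r -> R -> C) (c : \bar R) :
  (c < sm_vec f)%E -> forall l, (c < sm_fun (f l))%E.
Proof.
move=> H l; apply: (lt_le_trans H); rewrite /sm_vec (bigD1 l)//= ge_min lexx//.
Qed.

Lemma lim_sm_distr r m (a : int -> 'M[C]_r) A (phi : 'I_r -> (R -> C) -> C) (Phi : R -> 'M[C]_r) :
  zsupp A a -> (0 < A)%N ->
  (forall l, compact_distribution (phi l)) ->
  (forall xi : R, fourier_vec phi (2%:R * xi) = symbol a xi *m fourier_vec phi xi) ->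
  (forall i j, Ck m (fun x => Phi x i j)) ->
  (forall x, A%:R <= `|x| -> Phi x = 0) ->
  (forall e : R, 0 < e -> exists N, forall n, (N <= n)%N ->
    forall k : int, mnorm (Sn a n k - Phi (2 ^- n * k%:~R)) <= e) ->
  sm_distr_gt phi m.
Proof.
move=> sA A0 hphi hrefine CPhi sPhi limS.
have cPhi i j : continuous (re (fun x => Phi x i j)) /\ continuous (im (fun x => Phi x i j)).
  have [C1 C2] := CPhi i j.
  by split; [exact: realCk_cts C1 (leq0n _)|exact: realCk_cts C2 (leq0n _)].
exists (fun l x => (Phi x *m fourier_vec phi 0) l 0); split.
  move=> l; split; last first.
    by move=> h [sh _]; exact: (rep_smooth sA A0 hphi hrefine cPhi sPhi limS).
  have [c1 c2 _] := rep_nice phi cPhi sPhi l.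
  have [M M0 HM] := rep_bounded phi cPhi sPhi l.
  split; apply: (@Lfun_cts_bounded _ _ M) => // x; apply: le_trans (HM x); first exact: normc_Re.
  exact: normc_Im.
apply: lt_sm_vec; first by rewrite ltry.
move=> l; have [tau t0 H] := entry_sm sA CPhi sPhi limS (fourier_vec phi 0).
by apply: lt_le_trans (H l); rewrite lte_fin ltrDl.
Qed.

End SmoothnessOfDistribution.

(** * Sum rules and moments *)

Section Moments.
Context {R : realType}.
Local Notation C := R[i].
Local Notation isd f x d := (is_derive (x : R) (1 : R) (f : R -> R) (d : R)).

(* This is (- i)^j. *)
Definition kap (j : nat) : C := cis (- (j%:R * (pi / 2))).

Lemma kap_neq0 j : kap j != 0.
Proof. by rewrite -normc_eq0 normc_cis oner_neq0. Qed.

Lemma cderiven_cis (t : R) j : cderiven j (fun x => cis (- (t * x))) 0 = (t ^+ j)%:C * kap j.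
Proof.
have cE (x : R) : cis (- (t * x)) = cos (t * x + 0) +i* cos (t * x + pi / 2).
  by rewrite /cis addr0 cosN sinN cosDpihalf.
have re1 : re (fun x => cis (- (t * x))) = (fun x => t ^+ 0 * cos (t * x + (0 + 0%:R * (pi / 2)))).
  by apply/funext => x; rewrite /re cE/= mul1r mul0r !addr0.
have im1 : im (fun x => cis (- (t * x))) = (fun x => t ^+ 0 * cos (t * x + (pi / 2 + 0%:R * (pi / 2)))).
  by apply/funext => x; rewrite /im cE/= mul1r mul0r !addr0.
rewrite /cderiven re1 im1.
rewrite (@chain_derive1n _ j (fun j x => t ^+ j * cos (t * x + (0 + j%:R * (pi / 2)))) _ j (leqnn _)); last first.
  by move=> k y _; exact: chain_cos.
rewrite (@chain_derive1n _ j (fun j x => t ^+ j * cos (t * x + (pi / 2 + j%:R * (pi / 2)))) _ j (leqnn _)); last first.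
  by move=> k y _; exact: chain_cos.
rewrite mulr0 !add0r [pi / 2 + _]addrC cosDpihalf /kap /cis cosN sinN.
by apply: ReIm_eq; rewrite /= !mul0r ?subr0 ?addr0.
Qed.

Lemma Ck_cis m (t : R) : Ck m (fun x => cis (- (t * x))).
Proof.
have -> : (fun x => cis (- (t * x))) = (fun x => cis (- (x * t)) : C) by apply/funext => x; rewrite mulrC.
exact: smooth_exp.
Qed.

Lemma cderiven_exp I (q : seq I) (c : I -> C) (t : I -> R) j :
  cderiven j (fun xi => \sum_(i <- q) c i * cis (- (t i * xi))) 0 =
  kap j * \sum_(i <- q) c i * (t i ^+ j)%:C.
Proof.
have [_ /(_ j (leqnn _))] := cderiven_sum q c 1 (fun=> 0) (fun i => Ck_cis j (t i)).
have -> : (fun x : R => \sum_(i <- q) c i * cis (- (t i * (1 * x + 0)))) =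
    (fun xi => \sum_(i <- q) c i * cis (- (t i * xi))).
  by apply/funext => x; apply: eq_bigr => i _; rewrite mul1r addr0.
move=> ->; rewrite expr1n -[1%:C]/(1 : C) mul1r [RHS]mulr_sumr; apply: eq_bigr => i _.
by rewrite mulr0 add0r cderiven_cis mulrA mulrC.
Qed.

(** Up to the nonzero factor [kap j], the j-th derivative at 0 of an exponential sum is its j-th
    moment; so all conditions of type O(|xi|^k) become finite algebraic identities. *)
Lemma eq_O_exp s r k (f g : R -> 'M[C]_(s, r)) I J (q1 : seq I) (q2 : seq J)
    (c1 : I -> 'M[C]_(s, r)) c2 (t1 : I -> R) (t2 : J -> R) :
  (forall xi, f xi = \sum_(i <- q1) cis (- (t1 i * xi)) *: c1 i) ->
  (forall xi, g xi = \sum_(i <- q2) cis (- (t2 i * xi)) *: c2 i) ->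
  eq_O k f g <-> forall j, (j < k)%N ->
    \sum_(i <- q1) (t1 i ^+ j)%:C *: c1 i = \sum_(i <- q2) (t2 i ^+ j)%:C *: c2 i.
Proof.
move=> fE gE.
have D I' (q : seq I') (h : R -> 'M[C]_(s, r)) c t : (forall xi, h xi = \sum_(i <- q) cis (- (t i * xi)) *: c i) ->
    forall j x y, cderiven j (fun xi => h xi x y) 0 = kap j * (\sum_(i <- q) (t i ^+ j)%:C *: c i) x y.
  move=> hE j x y; rewrite (_ : (fun xi => h xi x y) = (fun xi => \sum_(i <- q) c i x y * cis (- (t i * xi)))).
    by rewrite cderiven_exp summxE; congr (_ * _); apply: eq_bigr => i _; rewrite !mxE mulrC.
  by apply/funext => xi; rewrite hE summxE; apply: eq_bigr => i _; rewrite !mxE mulrC.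
split=> H j jk.
  apply/matrixP => x y; have := H j jk x y; rewrite (D _ _ _ _ _ fE) (D _ _ _ _ _ gE).
  exact: (mulfI (kap_neq0 j)).
by move=> x y; rewrite (D _ _ _ _ _ fE) (D _ _ _ _ _ gE) (H j jk).
Qed.

Variables (r : nat) (a : int -> 'M[C]_r) (A : nat).
Hypothesis sA : zsupp A a.

(* The sum rules of order s, as a quadrature condition on each of the two cosets
   of 2Z, tested against the polynomials of degree < s; only the parity of g
   matters. *)
Definition quadrature (v : int -> 'rV[C]_r) (L s : nat) := forall (g : int) (p : {poly C}), (size p <= s)%N ->
  2%:R *: (\sum_(k <- zr L) \sum_(l <- zr A)
     (if (2 %| l - g)%Z then p.[(2 * k + l)%:~R] else 0) *: (v k *m a l)) =
  \sum_(k <- zr L) p.[k%:~R] *: v k.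

Definition parity_sign (l : int) : C := if (2 %| l)%Z then 1 else -1.

Lemma parity_sign_cis l : cis (- (l%:~R * pi)) = parity_sign l.
Proof.
have E (k : int) : cis (- ((2 * k)%:~R * pi)) = 1 :> C.
  have N (n : nat) : cis (n%:R * pi *+ 2) = 1 :> C.
    elim: n => [|n IH]; first by rewrite mul0r mul0rn cis0.
    by rewrite -natr1 mulrDl mul1r mulrnDl cisD IH mul1r /cis cos2pi sin2pi.
  have M x : cis x = 1 -> cis (- x) = 1 :> C.
    by move=> H; have := cisD x (- x); rewrite subrr cis0 H mul1r.
  have -> : (2 * k)%:~R * pi = k%:~R * pi *+ 2 :> R by rewrite rmorphM/=; ring.
  case: k => n; first exact/M/N.
  by rewrite NegzE rmorphN mulNr mulNrn opprK; exact: N.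
rewrite /parity_sign; case: ifPn => [/dvdzP[k ->]|l2]; first by rewrite [k * 2]mulrC E.
have -> : l = 2 * (l %/ 2)%Z + 1 by lia.
rewrite rmorphD/= mulrDl mul1r opprD cisD E mul1r /cis cosN sinN cospi sinpi oppr0.
by apply: ReIm_eq; rewrite /= ?oppr0.
Qed.

Lemma parity_sign_ind l g : (if (2 %| l - g)%Z then 2%:R else 0) = 1 + parity_sign g * parity_sign l :> C.
Proof.
rewrite /parity_sign; case: ifPn; case: ifPn; case: ifPn; rewrite ?mulrNN ?mulrN1 ?mulr1 ?mulN1r ?subrr ?mul1r//; lia.
Qed.

Lemma horner_monomials s (p : {poly C}) (x : C) : (size p <= s)%N -> p.[x] = \sum_(j < s) p`_j * x ^+ j.
Proof. exact: horner_coef_wide. Qed.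

(** Let X, Y, Z be the moments of v(2 xi) a(xi), v(2 xi) a(xi + pi) and v. The sum rules say X = Z
    and Y = 0. Twice the indicator of the coset of g is 1 + (-1)^g (-1)^l, so the quadrature
    conditions say X + Y = Z and X - Y = Z. *)
Lemma has_sum_rulesP (v : int -> 'rV[C]_r) L s : zsupp L v ->
  has_sum_rules a s v <-> symbol v 0 != 0 /\ quadrature v L s.
Proof.
move=> sv.
pose q := [seq (k, l) | k <- zr L, l <- zr A].
have e1 xi : symbol v (2%:R * xi) *m symbol a xi =
    \sum_(i <- q) cis (- ((2 * i.1 + i.2)%:~R * xi)) *: (v i.1 *m a i.2).
  rewrite (symbolE _ sv) (symbolE _ sA) big_allpairs_dep/= mulmx_suml; apply: eq_bigr => k _.
  rewrite mulmx_sumr; apply: eq_bigr => l _; rewrite -scalemxAl -scalemxAr scalerA -cisD.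
  by congr (cis _ *: _); rewrite rmorphD rmorphM/=; ring.
have e2 xi : symbol v xi = \sum_(k <- zr L) cis (- (k%:~R * xi)) *: v k by exact: symbolE.
have e3 xi : symbol v (2%:R * xi) *m symbol a (xi + pi) =
    \sum_(i <- q) cis (- ((2 * i.1 + i.2)%:~R * xi)) *: (parity_sign i.2 *: (v i.1 *m a i.2)).
  rewrite (symbolE _ sv) (symbolE _ sA) big_allpairs_dep/= mulmx_suml; apply: eq_bigr => k _.
  rewrite mulmx_sumr; apply: eq_bigr => l _; rewrite -scalemxAl -scalemxAr !scalerA -parity_sign_cis -!cisD.
  by congr (cis _ *: _); rewrite rmorphD rmorphM/=; ring.
have e4 (xi : R) : (fun=> 0 : 'rV[C]_r) xi = \sum_(i <- [::] : seq int) cis (- ((i%:~R : R) * xi)) *: (0 : 'rV[C]_r).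
  by rewrite big_nil.
have P1 := eq_O_exp s e1 e2; have P2 := eq_O_exp s e3 e4.
pose X j : 'rV[C]_r := \sum_(i <- q) (((2 * i.1 + i.2)%:~R : R) ^+ j)%:C *: (v i.1 *m a i.2).
pose Y j : 'rV[C]_r := \sum_(i <- q) (((2 * i.1 + i.2)%:~R : R) ^+ j)%:C *: (parity_sign i.2 *: (v i.1 *m a i.2)).
pose Z j : 'rV[C]_r := \sum_(k <- zr L) ((k%:~R : R) ^+ j)%:C *: v k.
have main (g : int) (p : {poly C}) : (size p <= s)%N ->
    2%:R *: (\sum_(k <- zr L) \sum_(l <- zr A)
     (if (2 %| l - g)%Z then p.[(2 * k + l)%:~R] else 0) *: (v k *m a l)) =
    \sum_(j < s) p`_j *: (X j + parity_sign g *: Y j).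
  move=> ps.
  transitivity (\sum_(i <- q) \sum_(j < s) p`_j *: (((2 * i.1 + i.2)%:~R ^+ j * (1 + parity_sign g * parity_sign i.2)) *: (v i.1 *m a i.2))).
    rewrite big_allpairs_dep/= scaler_sumr; apply: eq_bigr => k _.
    rewrite scaler_sumr; apply: eq_bigr => l _; rewrite -parity_sign_ind.
    under eq_bigr do rewrite scalerA.
    rewrite -scaler_suml scalerA; congr (_ *: _); rewrite (horner_monomials _ ps).
    case: ifP => _; last by rewrite mulr0 big1// => j _; rewrite !mulr0.
    by rewrite mulr_sumr; apply: eq_bigr => j _; ring.
  rewrite exchange_big/=; apply: eq_bigr => j _; rewrite -scaler_sumr; congr (_ *: _).
  rewrite /X /Y scaler_sumr -big_split/=; apply: eq_bigr => i _.
  by rewrite !scalerA -scalerDl rmorphXn/= rmorph_int; congr (_ *: _); ring.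
have mainZ (p : {poly C}) : (size p <= s)%N ->
    \sum_(k <- zr L) p.[k%:~R] *: v k = \sum_(j < s) p`_j *: Z j.
  move=> ps; transitivity (\sum_(k <- zr L) \sum_(j < s) p`_j *: (k%:~R ^+ j *: v k)).
    apply: eq_bigr => k _; rewrite (horner_monomials _ ps) scaler_suml.
    by apply: eq_bigr => j _; rewrite scalerA.
  rewrite exchange_big/=; apply: eq_bigr => j _; rewrite -scaler_sumr; congr (_ *: _).
  by apply: eq_bigr => k _; rewrite rmorphXn/= rmorph_int.
split=> [[_ v0 H1 H2]|[v0 H]].
  split=> // g p ps; rewrite (main _ _ ps) (mainZ _ ps); apply: eq_bigr => j _.
  have := P1.1 H1 j (ltn_ord j); have := P2.1 H2 j (ltn_ord j); rewrite big_nil.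
  by rewrite -/(X j) -/(Y j) -/(Z j) => -> ->; rewrite scaler0 addr0.
have XY (g : int) j : (j < s)%N -> X j + parity_sign g *: Y j = Z j.
  move=> js; have ps : (size ('X^j : {poly C}) <= s)%N by rewrite size_polyXn.
  have := H g 'X^j ps; rewrite (main _ _ ps) (mainZ _ ps).
  rewrite (bigD1 (Ordinal js))//= [X in _ + X]big1; last first.
    by move=> i ij; rewrite coefXn [_ == _](negbTE ij) scale0r.
  rewrite (bigD1 (Ordinal js))//= [X in _ = _ + X]big1; last first.
    by move=> i ij; rewrite coefXn [_ == _](negbTE ij) scale0r.
  by rewrite coefXn eqxx !scale1r !addr0.
have YZ j : (j < s)%N -> Y j = 0 /\ X j = Z j.
  move=> js; have h0 := XY 0 j js; have h1 := XY 1 j js.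
  rewrite /parity_sign/= scale1r in h0; rewrite /parity_sign/= scaleN1r in h1.
  have Y0 : Y j = 0.
    apply/eqP; have : Y j *+ 2 == 0.
      rewrite mulr2n; have : (X j + Y j) - (X j - Y j) = 0 by rewrite h0 h1 subrr.
      by rewrite opprB addrC addrA subrK => ->.
    by rewrite -scaler_nat scaler_eq0 pnatr_eq0.
  by split=> //; rewrite -h0 Y0 addr0.
split=> //; first by apply/fin_suppP; exists L.
  by apply/P1 => j /YZ[_ XZ]; exact: XZ.
by apply/P2 => j /YZ[Y0 _]; rewrite big_nil; exact: Y0.
Qed.

(** The moment against p of the scalar sequence v convolved with u. *)
Definition mom (v : int -> 'rV[C]_r) (L : nat) (u : int -> 'cV[C]_r) (K : nat) (p : {poly C}) : C :=
  \sum_(k <- zr L) \sum_(l <- zr K) p.[(k + l)%:~R] * (v k *m u l) 0 0.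

Lemma VspaceP (v : int -> 'rV[C]_r) L u K j : zsupp L v -> zsupp K u ->
  Vspace j v u <-> forall p : {poly C}, (size p <= j)%N -> mom v L u K p = 0.
Proof.
move=> sv su; pose q := [seq (k, l) | k <- zr L, l <- zr K].
have e1 xi : symbol v xi *m symbol u xi =
    \sum_(i <- q) cis (- ((i.1 + i.2)%:~R * xi)) *: (v i.1 *m u i.2).
  rewrite (symbolE _ sv) (symbolE _ su) big_allpairs_dep/= mulmx_suml; apply: eq_bigr => k _.
  rewrite mulmx_sumr; apply: eq_bigr => l _; rewrite -scalemxAl -scalemxAr scalerA -cisD.
  by congr (cis _ *: _); rewrite rmorphD/=; ring.
have e4 (xi : R) : (fun=> 0 : 'M[C]_1) xi = \sum_(i <- [::] : seq int) cis (- ((i%:~R : R) * xi)) *: (0 : 'M[C]_1).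
  by rewrite big_nil.
have P1 := eq_O_exp j e1 e4.
have main i : (\sum_(k <- q) (((k.1 + k.2)%:~R : R) ^+ i)%:C *: (v k.1 *m u k.2)) = (mom v L u K 'X^i)%:M.
  apply/matrixP => x y; rewrite !ord1 mxE eqxx mulr1n summxE /mom big_allpairs_dep/=.
  apply: eq_bigr => k _; apply: eq_bigr => l _; rewrite hornerXn mxE rmorphXn/= rmorph_int//.
split=> [[_ H] p ps|H].
  rewrite /mom; transitivity (\sum_(i < j) p`_i * mom v L u K 'X^i).
    transitivity (\sum_(k <- zr L) \sum_(i < j) \sum_(l <- zr K) p`_i * ((k + l)%:~R ^+ i * (v k *m u l) 0 0)).
      apply: eq_bigr => k _; rewrite exchange_big/=; apply: eq_bigr => l _.
      by rewrite (horner_monomials _ ps) mulr_suml; apply: eq_bigr => i _; rewrite mulrA.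
    rewrite exchange_big/=; apply: eq_bigr => i _; rewrite /mom mulr_sumr; apply: eq_bigr => k _.
    by rewrite mulr_sumr; apply: eq_bigr => l _; rewrite hornerXn.
  rewrite big1// => i _; have := P1.1 H i (ltn_ord i); rewrite main big_nil.
  by move/matrixP/(_ 0 0); rewrite !mxE eqxx mulr1n => ->; rewrite mulr0.
split; first by apply/fin_suppP; exists K.
apply/P1 => i ij; rewrite main big_nil H ?size_polyXn//.
by apply/matrixP => x y; rewrite !mxE mul0rn.
Qed.

End Moments.

Lemma int_parity (k : int) : exists l, k = 2 * l + 0 \/ k = 2 * l + 1.
Proof. by exists (k %/ 2)%Z; lia. Qed.

(** * Action of the coset operators on moments *)

Section VanishingMoments.
Context {R : realType}.
Local Notation C := R[i].
Variables (r : nat) (a : int -> 'M[C]_r) (A : nat).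
Hypothesis sA : zsupp A a.
Implicit Types (u : int -> 'cV[C]_r) (p q : {poly C}).
Variables (v : int -> 'rV[C]_r) (L s : nat).
Hypothesis sv : zsupp L v.
Hypothesis hv : quadrature a A v L s.

(** The adjoint of [Tg g] on polynomials is p(x) -> p((x - g)/2) = P(x). For each l the contribution
    of u(l) is the quadrature condition on the coset of g - l, applied to P(x + l). *)
Lemma mom_Tg (g : int) u K p : (`|g| <= 1)%N -> zsupp K u -> (size p <= s)%N ->
  mom v L (Tg a g u) ((K + A).+1)./2 p = mom v L u K (p \Po (2^-1 *: ('X - (g%:~R)%:P))).
Proof.
move=> g1 su ps; set P := p \Po _.
have PE (x : C) : P.[2 * x + g%:~R] = p.[x].
  by rewrite /P horner_comp hornerZ hornerXsubC addrK mulrA mulVf ?mul1r// pnatr_eq0.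
have sP : (size P <= s)%N.
  by rewrite size_comp_poly2// size_scale ?size_XsubC// invr_neq0// pnatr_eq0.
have key (l : int) : \sum_(k <- zr L) \sum_(m <- zr ((K + A).+1)./2)
     p.[(k + m)%:~R] *: (v k *m (2%:R *: a (2 * m + g - l))) *m u l =
   (\sum_(k <- zr L) P.[(k + l)%:~R] *: v k) *m u l.
  have [lK|lK] := leqP `|l| K; last first.
    by rewrite su// mulmx0 big1// => k _; rewrite big1// => m _; rewrite mulmx0.
  have sPl : (size (P \Po ('X + (l%:~R)%:P)) <= s)%N by rewrite size_comp_poly2// size_XaddC.
  have := hv (g - l) sPl.
  have -> : \sum_(k <- zr L) (P \Po ('X + (l%:~R)%:P)).[k%:~R] *: v k = \sum_(k <- zr L) P.[(k + l)%:~R] *: v k.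
    by apply: eq_bigr => k _; rewrite horner_comp hornerD hornerX hornerC rmorphD.
  move=> <-; rewrite scaler_sumr mulmx_suml; apply: eq_bigr => k _.
  rewrite -mulmx_suml; congr (_ *m _).
  pose F t : 'rV[C]_r := P.[(2 * k + t)%:~R] *: (v k *m (2%:R *: a (t - l))).
  transitivity (\sum_(m <- zr ((K + A).+1)./2) F (2 * m + g)).
    apply: eq_bigr => m _; rewrite /F; congr (_ *: _).
    have -> : (2 * k + (2 * m + g))%:~R = 2 * (k + m)%:~R + g%:~R :> C by rewrite !rmorphD !rmorphM/=; ring.
    by rewrite PE.
  have sF : zsupp (K + A) F.
    by move=> t tK; rewrite /F sA ?scaler0 ?mulmx0 ?scaler0//; lia.
  rewrite (zsum_parity sF); last by move=> m mK; apply: sF; lia.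
  rewrite (zsum_reindex (h := fun t => t + l) (L' := A) (addzI_bij l)).
  - rewrite scaler_sumr; apply: eq_bigr => t _; rewrite opprB addrA /F addrK.
    case: ifP => _; last by rewrite scale0r scaler0.
    rewrite -scalemxAr !scalerA mulrC; congr (_ * _ *: _).
    by rewrite [RHS]horner_comp hornerD hornerX hornerC addrA rmorphD.
  - by move=> t /sF ->; case: ifP.
  - by move=> t tA /=; rewrite /F addrK sA// scaler0 mulmx0 scaler0; case: ifP.
transitivity (\sum_(l <- zr K) ((\sum_(k <- zr L) P.[(k + l)%:~R] *: v k) *m u l) 0 0).
  under [RHS]eq_bigr do rewrite -key summxE.
  rewrite [RHS]exchange_big/= /mom; apply: eq_bigr => k _.
  under [RHS]eq_bigr do rewrite summxE.
  rewrite exchange_big/=; apply: eq_bigr => m _.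
  rewrite /Tg (seq_convE _ _ su) -scalemxAr mulmx_sumr mxE summxE mulrA mulr_sumr.
  by apply: eq_bigr => l _; rewrite mulmxA -scalemxAr -!scalemxAl scalerA [RHS]mxE.
rewrite /mom exchange_big/=; apply: eq_bigr => l _; rewrite mulmx_suml summxE.
by apply: eq_bigr => k _; rewrite -scalemxAl mxE.
Qed.

Lemma mom_widen u K K' p : (K <= K')%N -> zsupp K u -> mom v L u K' p = mom v L u K p.
Proof.
move=> KK' su; apply: eq_bigr => k _; apply: (zsum_widen KK') => l /su ->.
by rewrite mulmx0 mxE mulr0.
Qed.

Lemma mom_lin u u' K c p :
  mom v L (fun k => u k + c *: u' k) K p = mom v L u K p + c * mom v L u' K p.
Proof.
rewrite /mom mulr_sumr -big_split/=; apply: eq_bigr => k _; rewrite mulr_sumr -big_split.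
by apply: eq_bigr => l _; rewrite mulmxDr -scalemxAr !mxE mulrDr mulrCA.
Qed.

Lemma mom_linp u K p q (c : C) : mom v L u K (p + c *: q) = mom v L u K p + c * mom v L u K q.
Proof.
rewrite /mom mulr_sumr -big_split/=; apply: eq_bigr => k _; rewrite mulr_sumr -big_split.
by apply: eq_bigr => l _; rewrite hornerD hornerZ mulrDl mulrA.
Qed.

Lemma Vspace_supp j u : Vspace j v u -> exists K, zsupp K u.
Proof. by move=> [/fin_suppP]. Qed.

Lemma Vspace_Tg (g : int) j u : (`|g| <= 1)%N -> (j <= s)%N ->
  Vspace j v u -> Vspace j v (Tg a g u).
Proof.
move=> g1 js uV; have [K su] := Vspace_supp uV.
apply/(VspaceP _ sv (Tg_supp sA g1 su)) => p pj.
rewrite mom_Tg// ?(leq_trans pj)//; apply: (VspaceP _ sv su).1 uV _ _.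
by rewrite size_comp_poly2// size_scale ?size_XsubC// invr_neq0// pnatr_eq0.
Qed.

(** The substitution multiplies the coefficient of degree j by 2^-j, so the top terms cancel. *)
Lemma size_comp_diff (g : int) j (p : {poly C}) : (size p <= j.+1)%N ->
  (size (p \Po (2^-1 *: ('X - (g%:~R)%:P)) + (- (2^-1) ^+ j) *: p)%R <= j)%N.
Proof.
move=> pj; set q := 2^-1 *: _.
have i20 : (2^-1 : C) != 0 by rewrite invr_neq0// pnatr_eq0.
have sq : size q = 2%N by rewrite /q size_scale ?size_XsubC.
have sc : (size (p \Po q + (- (2^-1) ^+ j) *: p)%R <= j.+1)%N.
  rewrite (leq_trans (size_polyD _ _))// geq_max size_comp_poly2// pj/=.
  by rewrite (leq_trans (size_scale_leq _ _)).
have [pj'|pj'] := leqP (size p) j.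
  rewrite (leq_trans (size_polyD _ _))// geq_max size_comp_poly2// pj'/=.
  by rewrite (leq_trans (size_scale_leq _ _)).
have pE : size p = j.+1 by apply/eqP; rewrite eqn_leq pj.
apply/leq_sizeP => i; rewrite leq_eqVlt => /orP[/eqP <-|ji]; last by rewrite nth_default// (leq_trans sc).
rewrite coefD coefZ.
have -> : (p \Po q)`_j = lead_coef (p \Po q) by rewrite lead_coefE size_comp_poly2// pE.
rewrite lead_coef_comp ?sq// lead_coefE pE /q lead_coefZ lead_coefXsubC mulr1 /=; ring.
Qed.

(** For either coset, [Tg g] acts on the quotient of [Vspace j] by [Vspace j.+1] as multiplication
    by 2^-j. *)
Lemma Vspace_descent (g : int) j u : (`|g| <= 1)%N -> (j < s)%N -> Vspace j v u ->
  Vspace j.+1 v (fun m => Tg a g u m + (- (2^-1) ^+ j) *: u m).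
Proof.
move=> g1 js uV; have [K su] := Vspace_supp uV.
have sT := Tg_supp sA g1 su; set KT := ((K + A).+1)./2 in sT.
have sM : zsupp (maxn K KT) (fun m => Tg a g u m + (- (2^-1) ^+ j) *: u m).
  by move=> k kM; rewrite sT ?su ?scaler0 ?addr0// (leq_ltn_trans _ kM)// (leq_maxl, leq_maxr).
apply/(VspaceP _ sv sM) => p pj.
rewrite mom_lin (mom_widen _ (leq_maxr _ _) sT) (mom_widen _ (leq_maxl _ _) su).
rewrite mom_Tg//; last exact: leq_trans js.
by rewrite -mom_linp; apply: (VspaceP _ sv su).1 uV _ (size_comp_diff _ pj).
Qed.

Lemma Vspace1P u K : zsupp K u ->
  Vspace 1 v u <-> (\sum_(k <- zr L) v k) *m (\sum_(l <- zr K) u l) = 0.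
Proof.
move=> su.
have E (c : C) : mom v L u K c%:P = c * ((\sum_(k <- zr L) v k) *m (\sum_(l <- zr K) u l)) 0 0.
  rewrite mulmx_suml summxE mulr_sumr; apply: eq_bigr => k _.
  by rewrite mulmx_sumr summxE mulr_sumr; apply: eq_bigr => l _; rewrite hornerC.
split=> [/(VspaceP _ sv su) H|H].
  apply/matrixP => x y; rewrite !ord1 [RHS]mxE -[LHS]mul1r -E; apply: H.
  by rewrite size_polyC; case: eqP.
by apply/(VspaceP _ sv su) => p /size1_polyC ->; rewrite E H mxE mulr0.
Qed.

Lemma phase_parity (g : int) : (`|g| <= 1)%N ->
  phase a A g = 2%:R *: \sum_(l <- zr A) (if (2 %| l - g)%Z then a l else 0).
Proof. by move=> g1; rewrite /phase (zsum_parity sA)// => k kA /=; apply: sA; lia. Qed.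

Lemma quadrature_phase (g : int) : (`|g| <= 1)%N -> (0 < s)%N ->
  (\sum_(k <- zr L) v k) *m phase a A g = \sum_(k <- zr L) v k.
Proof.
move=> g1 s0; rewrite (phase_parity g1) -scalemxAr.
have s1 : (size (1%R : {poly C}) <= s)%N by rewrite size_poly1.
have := hv g s1; under [in RHS]eq_bigr do rewrite hornerC scale1r.
move=> E; rewrite -[RHS]E; congr (_ *: _); rewrite mulmx_suml; apply: eq_bigr => k _.
rewrite mulmx_sumr; apply: eq_bigr => l _; rewrite hornerC.
by case: ifP; rewrite ?scale1r// scale0r mulmx0.
Qed.

End VanishingMoments.

(** * Decay of the iterated masks on vanishing moments *)

Section Decay.
Context {R : realType}.
Local Notation C := R[i].
Variables (r : nat) (a : int -> 'M[C]_r) (A : nat).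
Hypothesis sA : zsupp A a.

Definition decay p (u : int -> 'M[C]_(r, p)) := exists B th : R, [/\ 0 <= B, 0 < th, th < 1 &
  forall n k, mnorm (yn a u n k) <= B * th ^+ n].

Lemma zsupp_bounded p q K (F : int -> 'M[C]_(p, q)) : zsupp K F ->
  exists2 B : R, 0 <= B & forall k, mnorm (F k) <= B.
Proof.
move=> sF; exists (\sum_(k <- zr K) mnorm (F k)); first by rewrite sumr_ge0// => k _; exact: mnorm_ge0.
move=> k; have [kK|kK] := leqP `|k| K.
  rewrite (bigD1_seq k) ?mem_zr ?zr_uniq//= lerDl sumr_ge0// => l _; exact: mnorm_ge0.
by rewrite sF// mnorm0 sumr_ge0// => l _; exact: mnorm_ge0.
Qed.

Lemma yn_bounded p K (u : int -> 'M[C]_(r, p)) n : zsupp K u ->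
  exists2 B : R, 0 <= B & forall k, mnorm (yn a u n k) <= B.
Proof.
move=> su; have [B B0 HB] := zsupp_bounded (seq_conv_supp (@Sn_supp _ _ _ _ sA n) su).
by exists B.
Qed.

Lemma yn_lin p K (u u' : int -> 'M[C]_(r, p)) c n k : zsupp K u -> zsupp K u' ->
  yn a (fun m => u m + c *: u' m) n k = yn a u n k + c *: yn a u' n k.
Proof.
move=> su su'; have sU : zsupp K (fun m => u m + c *: u' m).
  by move=> l lK; rewrite su ?su' ?scaler0 ?addr0.
rewrite /yn (seq_convE _ _ sU) (seq_convE _ _ su) (seq_convE _ _ su') scaler_sumr -big_split.
by apply: eq_bigr => l _; rewrite mulmxDr scalemxAr.
Qed.

(* Tg g - 2^-j maps V_j to V_(j+1), so that the norms Y_n of yn u n satisfy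
   Y_(n+1) <= 2^-j Y_n + O(th^n). *)
Lemma decay_descent (v : int -> 'rV[C]_r) L s j : zsupp L v -> quadrature a A v L s ->
  (0 < j)%N -> (j < s)%N ->
  (forall u, Vspace j.+1 v u -> decay u) -> forall u, Vspace j v u -> decay u.
Proof.
move=> sv hv j0 js H u uV; have [K su] := Vspace_supp uV.
have [B0 B00 HB0] := yn_bounded 0 su.
have D g : (`|g| <= 1)%N -> decay (fun m => Tg a g u m + (- (2^-1) ^+ j) *: u m).
  by move=> g1; apply: H; exact: (Vspace_descent sA sv hv g1 js uV).
have [C0 [t0 [C00 t00 t01 H0]]] := D 0 isT.
have [C1 [t1 [C10 t10 t11 H1]]] := D 1 isT.
pose th : R := Num.max (Num.max t0 t1) (3 / 4).
have th34 : 3 / 4 <= th by rewrite le_max lexx orbT.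
have th0 : 0 < th by lra.
have th1 : th < 1 by rewrite !gt_max t01 t11/=; lra.
have t0t : t0 <= th by rewrite !le_max lexx.
have t1t : t1 <= th by rewrite !le_max lexx orbT.
(* With th >= 3/4 the recursion closes once C0 + C1 + B/2 <= 3B/4, that is, B >= 4 (C0 + C1); the
   term B0 starts the induction. *)
pose B := 4 * (C0 + C1) + B0.
have B_ge0 : 0 <= B by rewrite /B; lra.
exists B, th; split=> //; elim=> [|n IH] k.
  by rewrite expr0 mulr1 (le_trans (HB0 k))// /B; lra.
have step g l : (`|g| <= 1)%N -> mnorm (yn a (fun m => Tg a g u m + (- (2^-1) ^+ j) *: u m) n l) <=
    (C0 + C1) * th ^+ n -> mnorm (yn a u n.+1 (2 * l + g)) <= B * th ^+ n.+1.
  move=> g1 Hd; rewrite (ynS sA _ _ su g1).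
  have sT := Tg_supp sA g1 su; set KT := ((K + A).+1)./2 in sT.
  have sT' := zsuppW (leq_maxr K KT) sT; have su' := zsuppW (leq_maxl K KT) su.
  move: Hd; rewrite (yn_lin _ _ _ sT' su') => Hd.
  rewrite -[yn a (Tg a g u) n l](addrK ((- (2^-1) ^+ j) *: yn a u n l)).
  rewrite (le_trans (mnormD _ _))// mnormN mnormZ.
  have c2 : normc (- (2^-1) ^+ j : C) <= 2^-1.
    rewrite normc_opp normcX; have -> : (2^-1 : C) = (2^-1 : R)%:C by rewrite fmorphV rmorph_nat.
    rewrite normc_real ger0_norm ?invr_ge0//.
    by rewrite -[leRHS]expr1; apply: ler_wiXn2l; rewrite ?invr_ge0//; lra.
  have tn0 : 0 < th ^+ n by rewrite exprn_gt0.
  have h2 : normc (- (2^-1) ^+ j : C) * mnorm (yn a u n l) <= 2^-1 * (B * th ^+ n).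
    by apply: ler_pM; rewrite ?normc_ge0 ?mnorm_ge0.
  apply: (le_trans (lerD Hd h2)).
  rewrite mulrA -mulrDl exprS mulrA ler_wpM2r ?(ltW tn0)//.
  have : B * (3 / 4) <= B * th by rewrite ler_wpM2l.
  by rewrite /B; lra.
have [l [->|->]] := int_parity k.
  apply: step => //; rewrite (le_trans (H0 n _))//.
  apply: ler_pM; rewrite ?exprn_ge0 ?(ltW t00)//; first by lra.
  by apply: lerXn2r; rewrite ?nnegrE ?(ltW t00) ?(ltW th0).
apply: step => //; rewrite (le_trans (H1 n _))//.
apply: ler_pM; rewrite ?exprn_ge0 ?(ltW t10)//; first by lra.
by apply: lerXn2r; rewrite ?nnegrE ?(ltW t10) ?(ltW th0).
Qed.

End Decay.

(** * The exponent of the mask and geometric decay *)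

Section SpectralRadius.
Context {R : realType}.
Local Notation C := R[i].
Variables (r : nat) (a : int -> 'M[C]_r) (A : nat).
Hypothesis sA : zsupp A a.
Implicit Types (u : int -> 'cV[C]_r).

Lemma sm_mask_gt0 : (0 < sm_mask a)%E = (rho (sr a) a (sr_filter a) < 1)%E.
Proof.
have c0 : 0 < (ln 2%:R)^-1 :> R by rewrite invr_gt0 ln_gt0// ltr1n.
by rewrite /sm_mask oppe_gt0 pmule_llt0 ?lte_fin// lne_lt0.
Qed.

Lemma sup_norm_ge u k i : ((normc (u k i 0))%:E <= sup_norm u)%E.
Proof. by apply: ereal_sup_ubound; exists (k, i). Qed.

Lemma sup_norm_le u (B : R) : (forall k, mnorm (u k) <= B) -> (sup_norm u <= B%:E)%E.
Proof.
move=> uB; apply: ge_ereal_sup => _ [[k i] _ <-] /=; rewrite lee_fin.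
exact: le_trans (le_mnorm _ _ _) (uB k).
Qed.

(** The rate has to be common to all u, as [rho] is a supremum over them. The individual constants
    are absorbed by the slightly larger rate (th + 1) / 2. *)
Lemma rho_lt1 j (v : int -> 'rV[C]_r) (th : R) : 0 < th -> th < 1 -> (0 < r)%N ->
  (forall u, Vspace j v u -> exists2 B : R, 0 <= B &
     forall n k, mnorm (yn a u n k) <= B * th ^+ n) ->
  (rho j a v < 1)%E.
Proof.
move=> th0 th1 r0 H; pose th' := (th + 1) / 2.
have t1 : th' < 1 by rewrite /th'; lra.
have t0 : th < th' by rewrite /th'; lra.
have t00 : 0 < th' by lra.
apply: (@le_lt_trans _ _ th'%:E); last by rewrite lte_fin.
apply: ge_ereal_sup => _ [u uV <-]; have [B B0 HB] := H u uV.
have [N HN] : exists N, forall n, (N <= n)%N -> B * th ^+ n <= th' ^+ n.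
  have q0 : 0 < th' / th - 1 by rewrite subr_gt0 ltr_pdivlMr// mul1r.
  exists (Num.truncn (B / (th' / th - 1))).+1 => n Nn.
  have H1 : B / (th' / th - 1) <= n%:R.
    rewrite (le_trans (ltW (Num.Theory.truncnS_gt _)))// ler_nat//.
  rewrite ler_pdivrMr// in H1.
  (* Bernoulli's inequality: the powers of th' / th outgrow B. *)
  have H2 : 1 + n%:R * (th' / th - 1) <= (th' / th) ^+ n.
    elim: (n) => [|k IH]; first by rewrite mul0r addr0 expr0.
    have q1 : 1 <= th' / th by lra.
    rewrite exprS -natr1; apply: (@le_trans _ _ (th' / th * (1 + k%:R * (th' / th - 1)))).
      set q := th' / th in q0 q1 *; have : 0 <= k%:R * (q - 1) * (q - 1) by rewrite !mulr_ge0// ltW.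
      have -> : q * (1 + k%:R * (q - 1)) = 1 + (k%:R + 1) * (q - 1) + k%:R * (q - 1) * (q - 1) by ring.
      by lra.
    by rewrite ler_wpM2l//; lra.
  have : th' ^+ n = (th' / th) ^+ n * th ^+ n by rewrite -exprMn divfK ?gt_eqF.
  move=> ->; rewrite ler_wpM2r ?exprn_ge0 ?(ltW th0)//; lra.
rewrite /limn_esup /limf_esup.
apply: (@le_trans _ _ (ereal_sup ((fun n : nat =>
           poweR (sup_norm (seq_conv (iter n (subdiv a) (@diracI R r)) u)) (n%:R^-1)) @` [set n | (N.+1 <= n)%N]))).
  by apply: ereal_inf_lbound; exists [set n | (N.+1 <= n)%N] => //; exists N.+1.
apply: ge_ereal_sup => _ [n /= Nn <-].
have n0 : (0 < n)%N by apply: leq_trans Nn.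
have s0 : (0 <= sup_norm (yn a u n))%E.
  apply: le_trans (sup_norm_ge (yn a u n) 0 (Ordinal r0)); rewrite lee_fin; exact: normc_ge0.
have sB : (sup_norm (yn a u n) <= (th' ^+ n)%:E)%E.
  by apply: sup_norm_le => k; exact: le_trans (HB n k) (HN n (ltnW Nn)).
have -> : th'%:E = poweR (th' ^+ n)%:E n%:R^-1.
  by rewrite poweR_EFin -powR_mulrn ?ltW// -powRrM divff ?powRr1 ?ltW// pnatr_eq0 -lt0n.
have n1 : 0 <= n%:R^-1 :> R by rewrite invr_ge0.
have h1 : sup_norm (yn a u n) \in `[0%E, +oo%E] by rewrite in_itv/= s0 leey.
have h2 : ((th' ^+ n)%:E : \bar R) \in `[0%E, +oo%E].
  by rewrite in_itv/= leey lee_fin exprn_ge0// ltW.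
exact: (gt0_ler_poweR n1 h1 h2 sB).
Qed.

Lemma decay_eventually u K N (th B0 : R) : zsupp K u -> 0 < th -> 0 <= B0 ->
  (forall n, (N < n)%N -> forall k, mnorm (yn a u n k) <= B0 * th ^+ n) ->
  exists2 B : R, 0 <= B & forall n k, mnorm (yn a u n k) <= B * th ^+ n.
Proof.
move=> su th0 B00 big.
have small : exists2 B : R, 0 <= B & forall n, (n <= N)%N -> forall k, mnorm (yn a u n k) <= B * th ^+ n.
  elim: N {big} => [|N [B B1 HB]].
    have [B B1 HB] := yn_bounded sA 0 su; exists B => // n; rewrite leqn0 => /eqP -> k.
    by rewrite expr0 mulr1.
  have [B' B'0 HB'] := yn_bounded sA N.+1 su.
  have tN : 0 < th ^+ N.+1 by rewrite exprn_gt0.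
  exists (B + B' / th ^+ N.+1); first by rewrite addr_ge0// divr_ge0// ltW.
  move=> n; rewrite leq_eqVlt => /orP[/eqP ->|nN] k.
    by rewrite mulrDl divfK ?gt_eqF// (le_trans (HB' k))// lerDr mulr_ge0// ltW.
  rewrite (le_trans (HB n nN k))// ler_wpM2r ?exprn_ge0 ?(ltW th0)// lerDl divr_ge0// ltW//.
have [B B1 HB] := small.
exists (B + B0); first exact: addr_ge0.
move=> n k; have tn : 0 <= th ^+ n by rewrite exprn_ge0// ltW.
have [nN|nN] := leqP n N.
  by rewrite (le_trans (HB n nN k))// ler_wpM2r// lerDl.
by rewrite (le_trans (big n nN k))// ler_wpM2r// lerDr.
Qed.

(** A limit superior below 1 gives a rate below 1 from some index on; [decay_eventually] enlarges
    the constant to cover the earlier ones. *)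
Lemma rho_decay j (v : int -> 'rV[C]_r) : (rho j a v < 1)%E ->
  forall u, Vspace j v u -> decay a u.
Proof.
move=> H u uV.
have {}H : (limn_esup (fun n : nat => poweR (sup_norm (yn a u n)) (n%:R^-1)) < 1)%E.
  by apply: le_lt_trans H; apply: ereal_sup_ubound; exists u.
have [_ [V [N _ HN] <-] {}H] := ereal_inf_lt H.
have [th th0 [th1 Hth]] : exists2 th : R, 0 < th & th < 1 /\ forall n, (N <= n)%N ->
    (poweR (sup_norm (yn a u n)) (n%:R^-1) <= th%:E)%E.
  have ub n : (N <= n)%N -> (poweR (sup_norm (yn a u n)) (n%:R^-1) <=
      ereal_sup ((fun n : nat => poweR (sup_norm (yn a u n)) (n%:R^-1)) @` V))%E.
    by move=> nN; apply: ereal_sup_ubound; exists n => //; exact: HN.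
  move: H ub; case: (ereal_sup _) => [x| |] //; last first.
    by move=> _ ub; have := ub N (leqnn _); rewrite leeNy_eq => /eqP E; have := poweR_ge0 (sup_norm (yn a u N)) N%:R^-1; rewrite E.
  (* The maximum with 1/2 keeps the rate positive. *)
  rewrite lte_fin => x1 ub; exists (Num.max x (1 / 2)); first by rewrite lt_max; apply/orP; right; lra.
  split; first by rewrite gt_max x1/=; lra.
  by move=> n /ub h; apply: le_trans h _; rewrite lee_fin le_max lexx.
have big n : (N.+1 <= n)%N -> forall k, mnorm (yn a u n k) <= r%:R * th ^+ n.
  move=> nN k; have n0 : (0 < n)%N by exact: leq_trans nN.
  rewrite (le_trans (mnorm_le (e := th ^+ n) _)) ?muln1//.
  move=> i l; rewrite ord1.
  have := Hth n (ltnW nN); have := sup_norm_ge (yn a u n) k i.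
  case: (sup_norm _) => [x| |] //=.
    rewrite !lee_fin => nx xth; have x0 : 0 <= x by exact: le_trans (normc_ge0 _) nx.
    apply: (le_trans nx); have -> : x = (x `^ n%:R^-1) ^+ n.
      by rewrite -powR_mulrn ?powR_ge0// -powRrM mulVf ?powRr1// pnatr_eq0 -lt0n.
    by apply: lerXn2r; rewrite ?nnegrE ?powR_ge0 ?(ltW th0).
  by move=> _; rewrite ifF// invr_eq0 pnatr_eq0; apply/negbTE; rewrite -lt0n.
have [K su] : exists K, zsupp K u by have [/fin_suppP] := uV.
have [B B0 HB] := decay_eventually su th0 (ler0n _ _) big.
by exists B, th; split.
Qed.

End SpectralRadius.

(** * The orders of sum rules are bounded *)

Section SumRuleOrder.
Context {R : realType}.
Local Notation C := R[i].
Variables (r : nat) (a : int -> 'M[C]_r) (A : nat).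
Hypothesis sA : zsupp A a.
Implicit Types (p q : {poly C}).

(** The restriction of p to the integers, convolved with v: under sum rules subdivision acts on such
    sequences by dilating p. *)
Definition pconv (v : int -> 'rV[C]_r) (L : nat) p : int -> 'rV[C]_r :=
  fun j => \sum_(m <- zr L) p.[(j - m)%:~R] *: v m.

Definition halve p : {poly C} := p \Po (2^-1 *: 'X).

Lemma halveE p x : (halve p).[2 * x] = p.[x].
Proof. by rewrite horner_comp hornerZ hornerX mulrA mulVf ?mul1r// pnatr_eq0. Qed.

Lemma size_halve p : size (halve p) = size p.
Proof. by rewrite size_comp_poly2// size_scale ?size_polyX// invr_neq0// pnatr_eq0. Qed.

(** For fixed j this is the quadrature condition on the coset of j, for the polynomial p((j - x)/2)
    in x. *)
Lemma subdiv_pconv (v : int -> 'rV[C]_r) L s p : quadrature a A v L s -> (size p <= s)%N ->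
  subdiv a (pconv v L p) = pconv v L (halve p).
Proof.
move=> hv ps; apply/funext => j; rewrite (subdivE sA _ (leqnn _)).
pose P := halve p \Po (j%:~R%:P - 'X).
have PE (x : C) : P.[x] = (halve p).[j%:~R - x] by rewrite horner_comp hornerD hornerC hornerN hornerX.
have sP : (size P <= s)%N.
  rewrite size_comp_poly2 ?size_halve// -opprB size_polyN size_XsubC//.
have -> : pconv v L (halve p) j = \sum_(k <- zr L) P.[k%:~R] *: v k.
  by apply: eq_bigr => k _; rewrite PE rmorphB.
rewrite -(hv j P sP); congr (_ *: _).
under eq_bigr do rewrite mulmx_suml.
rewrite exchange_big/=; apply: eq_bigr => m _.
pose F (t : int) : 'rV[C]_r := P.[(2 * m - t)%:~R] *: (v m *m a (- t)).
transitivity (\sum_(k <- zr (`|j| + A)) F (2 * k + - j)).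
  apply: eq_bigr => k _; rewrite /F PE -rmorphB/= -scalemxAl.
  have -> : j - (2 * m - (2 * k - j)) = 2 * (k - m) by ring.
  by rewrite rmorphM/= halveE; congr (_ *: (_ *m a _)); ring.
have sF : zsupp A F by move=> t tA; rewrite /F sA ?mulmx0 ?scaler0// abszN.
rewrite (zsum_parity sF); last by move=> k kA; apply: sF; lia.
rewrite (zsum_reindex (h := fun t => 0 - t) (L' := A) (subzI_bij 0)).
- apply: eq_bigr => l _; rewrite /F sub0r !opprK.
  have -> : (2 %| - l + j)%Z = (2 %| l - j)%Z by lia.
  by case: ifP => _; rewrite ?scale0r.
- by move=> t /sF ->; case: ifP.
- by move=> t tA /=; rewrite sF ?if_same// sub0r abszN.
Qed.

Lemma iter_pconv (v : int -> 'rV[C]_r) L s n p : quadrature a A v L s -> (size p <= s)%N ->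
  iter n (subdiv a) (pconv v L p) = pconv v L (iter n halve p).
Proof.
move=> hv; elim: n p => // n IH p ps.
by rewrite iterSr (subdiv_pconv hv ps) IH ?size_halve// -iterSr.
Qed.

(* Subdivision reproduces polynomials of degree < s. If s were larger than the number
   of entries in a window, a nonzero polynomial would vanish on the window, hence,
   after s steps, at 2^s points. *)
Lemma sum_rules_bounded (v : int -> 'rV[C]_r) L s : quadrature a A v L s ->
  \sum_(k <- zr L) v k != 0 -> (s <= A.+1.*2.+1 * r)%N.
Proof.
move=> hv v0; rewrite leqNgt; apply/negP => sbig.
(* The dilation by 2^s is undone by the s halvings, so that [p] becomes [q] after s subdivision
   steps. *)
pose e d : {poly C} := 'X^d \Po (2 ^+ s *: 'X).
pose D (d : 'I_s) : 'M[C]_(A.+1.*2.+1, r) := \matrix_(t, i) pconv v L (e d) (t%:Z - A.+1%:Z) 0 i.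
pose M : 'M[C]_(s, A.+1.*2.+1 * r) := \matrix_d mxvec (D d).
have [y yM y0] : exists2 y : 'rV[C]_s, y *m M = 0 & y != 0.
  have : kermx M != 0.
    rewrite kermx_eq0 /row_free neq_ltn; apply/orP; left.
    by apply: leq_ltn_trans sbig; exact: rank_leq_col.
  by case/rowV0Pn => y /sub_kermxP yM y0; exists y.
pose q : {poly C} := \sum_(d < s) y 0 d *: 'X^d.
pose p : {poly C} := q \Po (2 ^+ s *: 'X).
have qc (d : 'I_s) : q`_d = y 0 d.
  rewrite coef_sum (bigD1 d)//= big1 ?addr0; last first.
    by move=> f fd; rewrite coefZ coefXn (_ : _ == _ = false) ?mulr0//; apply/negbTE; rewrite eq_sym.
  by rewrite coefZ coefXn eqxx mulr1.
have q0 : q != 0.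
  by apply: contra_neq y0 => qE; apply/rowP => d; rewrite -qc qE coef0 mxE.
have qs : (size q <= s)%N.
  by apply: (leq_trans (size_sum _ _ _)); apply/bigmax_leqP => d _; rewrite (leq_trans (size_scale_leq _ _))// size_polyXn.
have ps : (size p <= s)%N.
  by rewrite size_comp_poly2// size_scale ?size_polyX// expf_neq0// pnatr_eq0.
have pq : iter s halve p = q.
  have H n : iter n halve (q \Po (2 ^+ n *: 'X)) = q.
    elim: n => [|n IH]; first by rewrite expr0 scale1r comp_polyXr.
    rewrite iterSr -[RHS]IH; congr iter; rewrite /halve -comp_polyA; congr (_ \Po _).
    rewrite comp_polyZ comp_polyX scalerA exprSr -mulrA divff ?mulr1// pnatr_eq0.
  exact: H.
have w0 (k : int) : (`|k| <= A.+1)%N -> pconv v L p k = 0.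
  move=> kA; apply/rowP => i.
  have tA : (`|(k + A.+1%:Z)%R| < A.+1.*2.+1)%N by lia.
  have kE : k = (Ordinal tA)%:Z - A.+1%:Z by rewrite /=; lia.
  have D0 : \sum_d y 0 d *: D d = 0.
    apply: (can_inj mxvecK); rewrite linear0 linear_sum/= -[RHS]yM mulmx_sum_row.
    by apply: eq_bigr => d _; rewrite linearZ rowK.
  have := congr1 (fun X : 'M[C]_(_, _) => X (Ordinal tA) i) D0.
  rewrite summxE !mxE => H; rewrite -[RHS]H.
  rewrite /pconv summxE; under [RHS]eq_bigr do rewrite !mxE -kE summxE mulr_sumr.
  rewrite exchange_big/=; apply: eq_bigr => m _; rewrite mxE /p /q.
  rewrite raddf_sum/= horner_sum mulr_suml; apply: eq_bigr => d _.
  by rewrite comp_polyZ hornerZ mxE mulrA.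
have z (j : nat) : (j < s)%N -> pconv v L q j%:Z = 0.
  (* The values at |j| <= 2^s after s steps depend only on the initial window |k| <= A + 1, where
     the sequence is 0. *)
  move=> js; rewrite -pq -(iter_pconv s hv ps) (iter_subdivE sA _ s (leqnn _)).
  rewrite big1// => k _; have [kA|kA] := leqP `|k| A.+1; first by rewrite w0// mul0mx.
  apply: (@zsupp_w _ _ _ _ sA _ (pconv v L p) 1) => //; rewrite mulr1 -natrX normr_int_le absz_nat.
  by rewrite ltnW// (ltn_trans js)// ltn_expl.
have [i0 i00] : exists i, (\sum_(k <- zr L) v k) 0 i != 0.
  apply: contrapT => H; move/eqP: v0; apply; apply/rowP => i; rewrite [RHS]mxE.
  by apply/eqP/negPn/negP => Hi; apply: H; exists i.
(* The polynomial behind the i0-th component of [pconv v L q]: its leading coefficient is that of q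
   times a nonzero entry of vhat(0), yet it has s roots and degree < s. *)
pose Q : {poly C} := \sum_(m <- zr L) v m 0 i0 *: (q \Po ('X - (m%:~R)%:P)).
have Qs : (size Q <= size q)%N.
  rewrite /Q; elim/big_rec: _ => [|m x _ IH]; first by rewrite size_poly0.
  rewrite (leq_trans (size_polyD _ _))// geq_max IH andbT (leq_trans (size_scale_leq _ _))//.
  by rewrite size_comp_poly2// size_XsubC.
have Q0 : Q != 0.
  suff : Q`_(size q).-1 != 0 by apply: contra_neq => ->; rewrite coef0.
  have -> : Q`_(size q).-1 = (\sum_(k <- zr L) v k) 0 i0 * lead_coef q.
    rewrite /Q coef_sum summxE mulr_suml; apply: eq_bigr => m _; rewrite coefZ; congr (_ * _).
    rewrite -[in LHS](@size_comp_poly2 _ q ('X - (m%:~R)%:P)) ?size_XsubC//.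
    by rewrite -lead_coefE lead_coef_comp ?size_XsubC// lead_coefXsubC expr1n mulr1.
  by rewrite mulf_neq0// lead_coef_eq0.
pose rs : seq C := [seq j%:R | j <- iota 0 s].
have := @max_poly_roots _ Q rs Q0; rewrite size_map size_iota => H.
have {H} : (s < size Q)%N.
  apply: H; last by rewrite map_inj_uniq ?iota_uniq// => x y0' /eqP; rewrite eqr_nat => /eqP.
  apply/allP => _ /mapP[j + ->]; rewrite mem_iota => /andP[_ js].
  have := z j js; move/rowP/(_ i0); rewrite [RHS]mxE /pconv summxE => H.
  rewrite /root /Q horner_sum -[X in _ == X]H; apply/eqP; apply: eq_bigr => m _.
  by rewrite hornerZ horner_comp hornerXsubC mxE mulrC rmorphB.
by rewrite ltnNge (leq_trans Qs).
Qed.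

End SumRuleOrder.

Section SumRuleFilter.
Context {R : realType}.
Local Notation C := R[i].
Variables (r : nat) (a : int -> 'M[C]_r) (A : nat).
Hypothesis sA : zsupp A a.
Lemma symbol0E s (v : int -> 'M[C]_(s, r)) L : zsupp L v -> symbol v (0 : R) = \sum_(k <- zr L) v k.
Proof.
by move=> sv; rewrite (symbolE _ sv); apply: eq_bigr => k _; rewrite mulr0 oppr0 cis0 scale1r.
Qed.

Lemma zsupp_delta s (v : 'M[C]_(s, r)) : zsupp 0 (fun k : int => (k == 0)%:R *: v).
Proof. by move=> k k0; rewrite (_ : _ == _ = false) ?scale0r//; apply/negbTE; move: k0; lia. Qed.

Hypothesis r0 : (0 < r)%N.

Lemma has_sum_rules0 : exists v, has_sum_rules a 0 v.
Proof.
pose v (k : int) : 'rV[C]_r := (k == 0)%:R *: delta_mx 0 (Ordinal r0).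
exists v; apply/(has_sum_rulesP sA 0 (zsupp_delta _)); split.
  rewrite (symbol0E (zsupp_delta _)) (@zsum_delta _ _ _ 0)// ?scale1r; last first.
    by move=> k k0; rewrite (negbTE k0) scale0r.
  by apply/eqP => /rowP/(_ (Ordinal r0)) /eqP; rewrite !mxE !eqxx mulr1n oner_eq0.
move=> g p; rewrite leqn0 size_poly_eq0 => /eqP ->.
rewrite [RHS]big1 => [|k _]; last by rewrite horner0 scale0r.
rewrite big1 ?scaler0// => k _; rewrite big1// => l _.
by rewrite horner0 if_same scale0r.
Qed.

(** Order 0 is always available and the orders are bounded, so a largest one exists and the default
    value in [sr] does not occur. *)
Lemma sr_is_sr : is_sr a (sr a).
Proof.
pose P k := `[< exists v, has_sum_rules a k v >].
have P0 : exists k, P k by exists 0%N; apply/asboolP; exact: has_sum_rules0.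
have Pb k : P k -> (k <= A.+1.*2.+1 * r)%N.
  move=> /asboolP[v hv]; have [/fin_suppP[L sv] _ _ _] := hv.
  have [v0 quad_v] := (has_sum_rulesP sA k sv).1 hv.
  by apply: (sum_rules_bounded sA quad_v); rewrite -(symbol0E sv).
have [k /asboolP Pk kmax] := ex_maxnP P0 Pb.
apply: (@xgetPex _ 0%N (is_sr a)); exists k; split=> // k' H; apply: kmax; exact/asboolP.
Qed.

Lemma sr_filterP : has_sum_rules a (sr a) (sr_filter a).
Proof. by apply: (@xgetPex _ (fun=> 0)); have [] := sr_is_sr. Qed.

Lemma sr_max k v : has_sum_rules a k v -> (k <= sr a)%N.
Proof. by move=> hv; have [_] := sr_is_sr; apply; exists v. Qed.

End SumRuleFilter.

(** * Uniform geometric decay on sequences of vanishing moment *)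

Section Contraction.
Context {R : realType}.
Local Notation C := R[i].
Variables (r : nat) (a : int -> 'M[C]_r) (A : nat).
Hypothesis sA : zsupp A a.
Variables (v : int -> 'rV[C]_r) (L s : nat).
Hypothesis sv : zsupp L v.
Hypothesis hv : quadrature a A v L s.
Hypothesis s0 : (0 < s)%N.
Implicit Types (u : int -> 'cV[C]_r).
Hypothesis yn_to0 : forall u, Vspace 1 v u -> forall e : R, 0 < e -> exists N, forall n, (N <= n)%N ->
  forall k, mnorm (yn a u n k) <= e.

(** For 0 <= d < 2^N, the composition of N operators [Tg] along the binary digits of d, the lowest
    digit acting first. *)
Definition TT N (d : int) u : int -> 'cV[C]_r := fun m => yn a u N (2 ^+ N * m + d).
Local Notation L0 := (A.+1).

Lemma yn0 u K : zsupp K u -> yn a u 0 = u.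
Proof.
move=> su; apply/funext => k; rewrite /yn (seq_convE _ _ (zsuppW (leq_addr `|k| K) su)).
rewrite (@zsum_delta _ _ _ k); first by rewrite subrr /Sn /= /diracI eqxx mul1mx.
  by rewrite leq_addl.
move=> l lk; rewrite /Sn/= /diracI (_ : _ == _ = false) ?raddf0 ?mul0mx//.
by apply/negbTE; rewrite subr_eq0 eq_sym.
Qed.

(** Each step halves the excess D of the radius over A + 1, so an excess below 2^N is used up after
    N steps. *)
Lemma TT_spec N (d D : nat) u : (d < 2 ^ N)%N -> (D < 2 ^ N)%N ->
  Vspace 1 v u -> zsupp (L0 + D) u ->
  [/\ Vspace 1 v (TT N d u), zsupp L0 (TT N d u) &
     forall n k, yn a u (N + n) (2 ^+ N * k + d%:Z) = yn a (TT N d u) n k].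
Proof.
elim: N d D u => [|N IH] d D u dN DN uV su.
  move: dN DN; rewrite !expn0 !ltnS !leqn0 => /eqP -> /eqP D0; rewrite D0 addn0 in su.
  have -> : TT 0 0%N u = u by apply/funext => m; rewrite /TT expr0 mul1r addr0 (yn0 su).
  by split=> // n k; rewrite expr0 mul1r addr0.
have d2 : (d./2 < 2 ^ N)%N by move: dN; rewrite expnS; lia.
have D2 : (D./2 < 2 ^ N)%N by move: DN; rewrite expnS; lia.
have g1 : (`|(odd d)%:Z|%N <= 1)%N by case: (odd d).
have uV' := Vspace_Tg sA sv hv g1 s0 uV.
have su' : zsupp (L0 + D./2) (Tg a (odd d) u).
  by apply: zsuppW (Tg_supp sA g1 su); lia.
have [V' s' E'] := IH d./2 D./2 _ d2 D2 uV' su'.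
have dE (k : int) : 2 ^+ N.+1 * k + d%:Z = 2 * (2 ^+ N * k + (d./2)%:Z) + (odd d)%:Z.
  have dd : d%:Z = 2 * (d./2)%:Z + (odd d)%:Z by lia.
  by rewrite dd exprS; ring.
have TE : TT N.+1 d u = TT N d./2 (Tg a (odd d) u).
  by apply/funext => m; rewrite /TT dE (ynS sA _ _ su g1).
rewrite TE; split=> // n k; rewrite -E' dE addSn; exact: (ynS sA _ _ su g1).
Qed.

Definition nu u : R := \sum_(k <- zr L0) mnorm (u k).

Lemma le_nu u k : zsupp L0 u -> mnorm (u k) <= nu u.
Proof.
move=> su; have [kL|kL] := leqP `|k| L0.
  rewrite /nu (bigD1_seq k) ?mem_zr ?zr_uniq//= lerDl sumr_ge0// => l _; exact: mnorm_ge0.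
by rewrite su// mnorm0 sumr_ge0// => l _; exact: mnorm_ge0.
Qed.

Lemma nu_le u B : (forall k, mnorm (u k) <= B) -> nu u <= (L0.*2.+1)%:R * B.
Proof. by move=> uB; rewrite -sum_zr_const; apply: ler_sum => k _. Qed.

Lemma nu_ge0 u : 0 <= nu u.
Proof. by rewrite sumr_ge0// => k _; exact: mnorm_ge0. Qed.

Lemma yn_sum n (I : Type) (q : seq I) (b : I -> C) (f : I -> int -> 'cV[C]_r) k :
  (forall i, zsupp L0 (f i)) ->
  yn a (fun m => \sum_(i <- q) b i *: f i m) n k = \sum_(i <- q) b i *: yn a (f i) n k.
Proof.
move=> sf; have sU : zsupp L0 (fun m => \sum_(i <- q) b i *: f i m).
  by move=> m mL; rewrite big1// => i _; rewrite sf// scaler0.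
rewrite /yn (seq_convE _ _ sU).
under eq_bigr do rewrite mulmx_sumr.
rewrite exchange_big/=; apply: eq_bigr => i _; rewrite (seq_convE _ _ (sf i)) scaler_sumr.
by apply: eq_bigr => l _; rewrite scalemxAr.
Qed.

(** The sequences of [Vspace 1 v] supported in the window lie in a finite dimensional space:
    convergence to 0 on a finite spanning family gives one level at which all of them are halved. *)
Lemma nu_contract : exists2 N, (0 < N)%N & forall u, Vspace 1 v u -> zsupp L0 u ->
  forall d, (d < 2 ^ N)%N -> nu (TT N d u) <= 2^-1 * nu u.
Proof.
pose I := {u | Vspace 1 v u /\ zsupp L0 u}.
pose W (x : I) : 'M[C]_(L0.*2.+1, r) := \matrix_(t, i) sval x (t%:Z - L0%:Z) i 0.
have [n [f [K [K0 HK]]]] := finite_span W.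
pose e := 2^-1 / ((L0.*2.+1)%:R * K + 1).
have D0 : 0 < (L0.*2.+1)%:R * K + 1 by rewrite ltr_wpDl// mulr_ge0.
have e0 : 0 < e by rewrite divr_gt0.
have [N HN] : exists N, forall j : 'I_n, j \in index_enum _ -> forall N', (N <= N')%N ->
    forall k, mnorm (yn a (sval (f j)) N' k) <= e.
  apply: seq_max_nat => [j N1 N2 N12 H N' N'2|j]; first by apply: H; exact: leq_trans N'2.
  have [V _] := svalP (f j); exact: yn_to0.
exists N.+1 => // u uV su d dN.
have uI : Vspace 1 v u /\ zsupp L0 u by [].
have [b Wb bK] := HK (exist _ u uI).
have uE : u = fun m => \sum_(j <- index_enum 'I_n) b j *: sval (f j) m.
  apply/funext => m; have [mL|mL] := leqP `|m| L0; last first.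
    by rewrite su// big1// => j _; have [_ ->] := svalP (f j); rewrite ?scaler0.
  have tL : (`|(m + L0%:Z)%R| < L0.*2.+1)%N by lia.
  have mE : m = (Ordinal tL)%:Z - L0%:Z by rewrite /=; lia.
  apply/matrixP => i j; rewrite ord1 summxE.
  have := congr1 (fun X : 'M[C]_(_, _) => X (Ordinal tL) i) Wb.
  rewrite mxE summxE/= -mE => ->; apply: eq_bigr => j' _; rewrite !mxE.
  by rewrite -mE.
have Wnu : mnorm (W (exist _ u uI)) = nu u.
  rewrite /nu /zr big_map -[iota _ _]/(index_iota 0 L0.*2.+1) big_mkord.
  by apply: eq_bigr => k _; apply: eq_bigr => i _; rewrite big_ord1 mxE.
have bnd k : mnorm (TT N.+1 d u k) <= K * nu u * e.
  rewrite /TT uE yn_sum; last by move=> j; have [] := svalP (f j).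
  rewrite -uE (le_trans (mnorm_sum _ _ _))//.
  apply: (@le_trans _ _ (\sum_j normc (b j) * e)).
    apply: ler_sum => j _; rewrite mnormZ ler_wpM2l ?normc_ge0//.
    by apply: HN; rewrite ?mem_index_enum.
  by rewrite -mulr_suml ler_wpM2r ?(ltW e0)// (le_trans bK)// Wnu.
rewrite (le_trans (nu_le bnd))//.
have -> : (L0.*2.+1)%:R * (K * nu u * e) = (2^-1 * nu u) * (((L0.*2.+1)%:R * K) / ((L0.*2.+1)%:R * K + 1)).
  by rewrite /e; ring.
by apply: mul_frac_le => //; [rewrite mulr_ge0 ?nu_ge0|rewrite lerDl].
Qed.

(** Iterating the halving gives the rate 2^(-1/N), the same for all u; only the constant depends on
    the initial support. *)
Lemma uniform_decay : exists2 th : R, 0 < th & th < 1 /\ forall u, Vspace 1 v u ->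
  exists2 B : R, 0 <= B & forall n k, mnorm (yn a u n k) <= B * th ^+ n.
Proof.
have [N N0 HN] := nu_contract.
pose th : R := 2^-1 `^ N%:R^-1.
have thN : th ^+ N = 2^-1.
  by rewrite -powR_mulrn ?powR_ge0// -powRrM mulVf ?powRr1 ?invr_ge0// pnatr_eq0 -lt0n.
have th0 : 0 < th by rewrite powR_gt0// invr_gt0.
have th1 : th < 1.
  rewrite ltNge; apply/negP => H; have := exprn_ege1 N H; rewrite thN; lra.
exists th => //; split=> // u uV.
have [K su] := Vspace_supp uV.
have suD : zsupp (L0 + K) u by apply: zsuppW su; rewrite leq_addl.
have cells t w : Vspace 1 v w -> zsupp L0 w -> forall k, mnorm (yn a w (N * t) k) <= 2^-1 ^+ t * nu w.
  elim: t w => [|t IH] w wV sw k; first by rewrite muln0 expr0 mul1r (yn0 sw) le_nu.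
  pose d := `|(k %% (2 ^ N)%N%:Z)%Z|%N.
  have p0 : (0 < 2 ^ N)%N by rewrite expn_gt0.
  have dN : (d < 2 ^ N)%N by rewrite /d; lia.
  have kE : k = 2 ^+ N * (k %/ (2 ^ N)%N%:Z)%Z + d%:Z by rewrite expz2 /d; lia.
  have sw0 : zsupp (L0 + 0) w by rewrite addn0.
  have [V' s' E'] := TT_spec dN p0 wV sw0.
  rewrite kE mulnS E' (le_trans (IH _ V' s' _))// exprSr -mulrA ler_wpM2l ?exprn_ge0 ?invr_ge0//.
  exact: HN.
have Bs (n : nat) : exists B : R, 0 <= B /\ forall k, mnorm (yn a u n k) <= B.
  by have [B B0 HB] := yn_bounded sA n su; exists B.
have {Bs} /choice[B HB] := Bs.
pose B' := (L0.*2.+1)%:R * \sum_(s < N) B (K + s)%N.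
have B'0 : 0 <= B' by rewrite mulr_ge0// sumr_ge0// => i _; have [] := HB (K + i)%N.
have thK : 0 < th ^+ (K + N) by rewrite exprn_gt0.
apply: (decay_eventually (N := K) sA su th0 (B0 := B' / th ^+ (K + N))) => [|n nK k].
  by rewrite divr_ge0// ltW.
(* n = K + s' + N t: the first K + s' steps bring the support into the window, the remaining ones
   are t contractions. *)
pose t := ((n - K) %/ N)%N; pose s' := ((n - K) %% N)%N.
have s'N : (s' < N)%N by rewrite ltn_mod.
have nE : n = (K + s' + N * t)%N by rewrite -addnA mulnC addnC [(s' + _)%N]addnC -divn_eq subnK// ltnW.
pose M := (K + s')%N.
pose d := `|(k %% (2 ^ M)%N%:Z)%Z|%N.
have p0 : (0 < 2 ^ M)%N by rewrite expn_gt0.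
have dN : (d < 2 ^ M)%N by rewrite /d; lia.
have KM : (K < 2 ^ M)%N by rewrite (leq_trans (@ltn_expl 2 K isT))// leq_exp2l// leq_addr.
have kE : k = 2 ^+ M * (k %/ (2 ^ M)%N%:Z)%Z + d%:Z by rewrite expz2 /d; lia.
have [V' s'' E'] := TT_spec dN KM uV suD.
rewrite nE kE E' (le_trans (cells _ _ V' s'' _))//.
have nuB : nu (TT M d u) <= B'.
  apply: (le_trans (nu_le (B := B M) _)).
    by move=> j; rewrite /TT; have [_] := HB M; apply.
  rewrite ler_wpM2l// (bigD1 (Ordinal s'N))//= lerDl sumr_ge0// => i _.
  by have [] := HB (K + i)%N.
have -> : th ^+ (K + s' + N * t) = th ^+ (K + s') * 2^-1 ^+ t by rewrite exprD exprM thN.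
have q : 1 <= th ^+ (K + s') / th ^+ (K + N).
  by rewrite ler_pdivlMr// mul1r; apply: ler_wiXn2l; rewrite ?(ltW th0) ?(ltW th1)// leq_add2l ltnW.
have t0 : 0 <= 2^-1 ^+ t :> R by rewrite exprn_ge0// invr_ge0.
rewrite mulrC; apply: (@le_trans _ _ (B' * 2^-1 ^+ t)); first by rewrite ler_wpM2r.
have -> : B' / th ^+ (K + N) * (th ^+ (K + s') * 2^-1 ^+ t) = (B' * 2^-1 ^+ t) * (th ^+ (K + s') / th ^+ (K + N)) by ring.
by rewrite ler_peMr// mulr_ge0.
Qed.

End Contraction.

(** * Convergence and the smoothness exponent of the mask *)

Section PositiveExponent.
Context {R : realType}.
Local Notation C := R[i].
Variables (r : nat) (a : int -> 'M[C]_r) (A : nat).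
Hypothesis r0 : (0 < r)%N.
Hypothesis sA : zsupp A a.
Hypothesis A0 : (0 < A)%N.
Hypothesis hsimple : mup 1 (char_poly (symbol a 0)) = 1%N.
Variable phi : 'I_r -> (R -> C) -> C.
Hypothesis hphi : forall l, compact_distribution (phi l).
Hypothesis hrefine : forall xi : R,
  fourier_vec phi (2%:R * xi) = symbol a xi *m fourier_vec phi xi.
Hypothesis hphi0 : fourier_vec phi 0 != 0.
Variable Phi : R -> 'M[C]_r.
Hypothesis cPhi : forall i j, continuous (re (fun x => Phi x i j)) /\
  continuous (im (fun x => Phi x i j)).
Hypothesis sPhi : forall x, A%:R <= `|x| -> Phi x = 0.
Hypothesis limS : forall e : R, 0 < e -> exists N, forall n, (N <= n)%N ->
  forall k : int, mnorm (Sn a n k - Phi (2 ^- n * k%:~R)) <= e.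
Local Notation w := (fourier_vec phi 0).

Lemma fixed_right : symbol a 0 *m w = w.
Proof. by rewrite -hrefine mulr0. Qed.

Lemma symbol_phase : symbol a (0 : R) = 2^-1 *: (phase a A 0 + phase a A 1).
Proof.
rewrite !(phase_parity sA)// -scalerDr scalerA mulVf ?pnatr_eq0// scale1r -big_split/=.
rewrite (symbol0E sA); apply: eq_bigr => l _; rewrite subr0.
case: ifPn => h1; case: ifPn => h2; rewrite ?addr0 ?add0r//; exfalso; move: h1 h2; clear; lia.
Qed.

Lemma phase_fixed (v : 'rV[C]_r) : (forall g : int, (`|g| <= 1)%N -> v *m phase a A g = v) ->
  v *m symbol a 0 = v.
Proof.
move=> H; rewrite symbol_phase -scalemxAr mulmxDr !H//.
have -> : v + v = 2%:R *: v by rewrite scaler_nat mulr2n.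
by rewrite scalerA mulVf ?scale1r// pnatr_eq0.
Qed.

Lemma row_phase i x (g : int) : (`|g| <= 1)%N -> row i (Phi x) *m phase a A g = row i (Phi x).
Proof. by move=> g1; rewrite -row_mul -(Phi_phase sA cPhi sPhi limS x g1). Qed.

(** The rows of Phi(x) are fixed by both phases, hence by their average, the symbol at 0. Pairing
    with w computes the factor. *)
Lemma Phi_row (v : 'rV[C]_r) i x : v != 0 -> v *m symbol a 0 = v ->
  row i (Phi x) = ((Phi x *m w) i 0 / (v *m w) 0 0) *: v.
Proof.
move=> v0 va; rewrite -[(Phi x *m w) i 0](_ : (row i (Phi x) *m w) 0 0 = _); last by rewrite -row_mul mxE.
apply: (@simple_eig_line _ _ (symbol a 0) 1) => //; rewrite ?scale1r//.
  by apply: phase_fixed => g; exact: row_phase.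
exact: fixed_right.
Qed.

(** By [fourier_rep] at 0, phihat(0) is the integral of Phi phihat(0), and it is not zero. *)
Lemma Phi_neq0 : exists x i, row i (Phi x) != 0.
Proof.
apply: contrapT => H.
have P0 x : Phi x = 0.
  apply/row_matrixP => i; rewrite row0; apply/eqP/negPn/negP => Hx; apply: H; by exists x, i.
move/eqP: hphi0; apply; apply/matrixP => l j; rewrite ord1 [RHS]mxE.
rewrite (fourier_rep sA A0 hphi hrefine cPhi sPhi limS).
apply/eqP; rewrite -normc_eq0 eq_le normc_ge0 andbT.
have nice : cnice A (fun x => (Phi x *m w) l 0 * cis (- (x * 0))).
  apply: (rep_smooth_nice phi cPhi sPhi l); exact: smooth_exp.
rewrite (le_trans (cintegral_bound (e := 0) A0 nice _)) ?mulr0// => x _.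
by rewrite P0 mul0mx mxE mul0r (eqP (_ : normc 0 == 0))// normc_eq0.
Qed.

(** (S_n conv u)(k) is close to Phi(2^-n k) times the sum of u, and this product vanishes because
    the rows of Phi are multiples of vhat(0). *)
Lemma yn_lim0 (v : int -> 'rV[C]_r) L s u : zsupp L v -> quadrature a A v L s -> (0 < s)%N ->
  \sum_(k <- zr L) v k != 0 -> Vspace 1 v u ->
  forall e : R, 0 < e -> exists N, forall n, (N <= n)%N -> forall k, mnorm (yn a u n k) <= e.
Proof.
move=> sv hv s0 v0 uV e e0; have [K su] := Vspace_supp uV.
set V := \sum_(k <- zr L) v k in v0.
have Va : V *m symbol a 0 = V by apply: phase_fixed => g g1; exact: (quadrature_phase sA hv g1 s0).
have Vu : V *m (\sum_(l <- zr K) u l) = 0 by apply/(Vspace1P sv su).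
have Pu x : Phi x *m (\sum_(l <- zr K) u l) = 0.
  apply/row_matrixP => i; rewrite row0 row_mul (Phi_row i x v0 Va) -scalemxAl Vu scaler0//.
pose B : R := \sum_(l <- zr K) mnorm (u l).
have B0 : 0 <= B by rewrite sumr_ge0// => l _; exact: mnorm_ge0.
have B1 : 0 < B + 1 by rewrite ltr_wpDl.
have e1 : 0 < e / (B + 1) by rewrite divr_gt0.
have [N HN] := limS_near cPhi sPhi limS K e1; exists N => n nN k.
have -> : yn a u n k = \sum_(l <- zr K) (Sn a n (k - l) - Phi (2 ^- n * k%:~R)) *m u l.
  rewrite /yn (seq_convE _ _ su); under [RHS]eq_bigr do rewrite mulmxBl.
  by rewrite sumrB -mulmx_sumr Pu subr0.
apply: (@le_trans _ _ (\sum_(l <- zr K) (e / (B + 1)) * mnorm (u l))).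
  rewrite (le_trans (mnorm_sum _ _ _))// !big_seq; apply: ler_sum => l; rewrite mem_zr => lK.
  rewrite (le_trans (mnormM _ _))// ler_wpM2r ?mnorm_ge0//; apply: HN => //.
  rewrite mulrA mulfV ?mul1r ?expf_neq0 ?pnatr_eq0// rmorphB/= addrAC subrr add0r normrN normr_int_le//.
rewrite -mulr_sumr -/B mulrAC -mulrA; apply: mul_frac_le => //; [exact: ltW|by rewrite lerDl].
Qed.

Lemma lim_sm_mask : (0 < sm_mask a)%E.
Proof.
rewrite sm_mask_gt0.
have sr1 : (0 < sr a)%N.
  have [x [i v0]] := Phi_neq0; set v := row i (Phi x) in v0.
  (* A nonzero row of Phi, placed at the origin, is a matching filter of order 1, since both phases
     fix it. *)
  have sv := zsupp_delta v; apply: (@sr_max _ _ _ _ sA r0 1 (fun k => (k == 0)%:R *: v)).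
  have sE : \sum_(k <- zr 0) (k == 0)%:R *: v = v.
    by rewrite (@zsum_delta _ _ _ 0)// ?scale1r// => k k0; rewrite (negbTE k0) scale0r.
  apply/(has_sum_rulesP sA 1 sv); split; first by rewrite (symbol0E sv) sE.
  move=> g p /size1_polyC ->; set c := p`_0.
  rewrite [RHS](@zsum_delta _ _ _ 0)//; last by move=> k k0; rewrite (negbTE k0) scale0r scaler0.
  rewrite [X in _ *: X](@zsum_delta _ _ _ 0)//; last first.
    by move=> k k0; rewrite big1// => l _; rewrite (negbTE k0) scale0r mul0mx scaler0.
  rewrite hornerC eqxx scale1r.
  (* The quadrature condition concerns all g, [row_phase] only |g| <= 1; the parity alone counts. *)
  have g1 : (`|(g %% 2)%Z|%N <= 1)%N by lia.
  have pv := row_phase i x g1; rewrite -/v in pv.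
  rewrite -[X in _ = c *: X]pv (phase_parity sA g1) -scalemxAr mulmx_sumr scalerA [c * _]mulrC -scalerA.
  congr (_ *: _); rewrite scaler_sumr; apply: eq_bigr => l _; rewrite hornerC.
  have -> : (2 %| l - (g %% 2)%Z)%Z = (2 %| l - g)%Z by lia.
  by case: ifP; rewrite ?scale0r ?mulmx0 ?scaler0.
have hf := sr_filterP sA r0; set v := sr_filter a in hf *.
have [/fin_suppP[L sv] _ _ _] := hf.
have [v0 hv] := (has_sum_rulesP sA _ sv).1 hf; rewrite (symbol0E sv) in v0.
have [th th0 [th1 H]] := uniform_decay sA sv hv sr1 (fun u => @yn_lim0 v L _ u sv hv sr1 v0).
apply: (rho_lt1 (th := th)) => // u [fu uV]; apply: H; split=> // j j1.
by apply: uV; exact: leq_trans sr1.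
Qed.

End PositiveExponent.

Section GeometricLimits.
Context {R : realType}.
Local Notation C := R[i].

(** The intervals of radius B th^n / (1 - th) around x_n are nested; the limit is the supremum of
    their left ends. *)
Lemma geom_limit (x : nat -> R) (B th : R) : 0 <= B -> 0 < th -> th < 1 ->
  (forall n, `|x n.+1 - x n| <= B * th ^+ n) ->
  exists l, forall n, `|x n - l| <= B / (1 - th) * th ^+ n.
Proof.
move=> B0 t0 t1 H; pose D := B / (1 - th).
have t1' : 0 < 1 - th by lra.
have DE : D - D * th = B by rewrite /D; field; rewrite gt_eqF.
have step n : x n - D * th ^+ n <= x n.+1 - D * th ^+ n.+1 /\ x n.+1 + D * th ^+ n.+1 <= x n + D * th ^+ n.
  have := H n; rewrite ler_norml => /andP[h1 h2].
  have E : D * th ^+ n - D * th ^+ n.+1 = B * th ^+ n by rewrite -DE exprS; ring.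
  by split; lra.
have lo m n : (m <= n)%N -> x m - D * th ^+ m <= x n - D * th ^+ n.
  move=> /subnK <-; elim: (n - m)%N => [|k IH]; first by rewrite add0n.
  by rewrite addSn (le_trans IH)//; have [] := step (k + m)%N.
have hi m n : (m <= n)%N -> x n + D * th ^+ n <= x m + D * th ^+ m.
  move=> /subnK <-; elim: (n - m)%N => [|k IH]; first by rewrite add0n.
  by rewrite addSn (le_trans _ IH)//; have [] := step (k + m)%N.
have Dp n : 0 <= D * th ^+ n by rewrite mulr_ge0 ?divr_ge0 ?exprn_ge0// ltW.
pose E := [set y | exists n, y = x n - D * th ^+ n].
have cross m n : x m - D * th ^+ m <= x n + D * th ^+ n.
  have h1 := lo m (maxn m n) (leq_maxl _ _); have h2 := hi n (maxn m n) (leq_maxr _ _).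
  by have := Dp (maxn m n); lra.
have E0 : E !=set0 by exists (x 0%N - D * th ^+ 0); exists 0%N.
have Eb n : ubound E (x n + D * th ^+ n) by move=> _ [m ->]; exact: cross.
exists (sup E) => n; rewrite ler_norml; apply/andP; split.
  have : sup E <= x n + D * th ^+ n by apply: ge_sup => // y [m ->]; exact: cross.
  by rewrite -/D; lra.
have : x n - D * th ^+ n <= sup E.
  by apply: ub_le_sup; [exists (x 0%N + D * th ^+ 0); exact: Eb|exists n].
by rewrite -/D; lra.
Qed.

Lemma geom_limit_mx p q (F : nat -> 'M[C]_(p, q)) (B th : R) : 0 <= B -> 0 < th -> th < 1 ->
  (forall n, mnorm (F n.+1 - F n) <= B * th ^+ n) ->
  exists L, forall n, mnorm (F n - L) <= (p * q)%:R * (2 * (B / (1 - th))) * th ^+ n.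
Proof.
move=> B0 t0 t1 H.
have dR (x y : C) : complex.Re (x - y) = complex.Re x - complex.Re y by case: x; case: y.
have dI (x y : C) : complex.Im (x - y) = complex.Im x - complex.Im y by case: x; case: y.
have He i j n : normc (F n.+1 i j - F n i j) <= B * th ^+ n.
  by apply: le_trans (H n); have := le_mnorm (F n.+1 - F n) i j; rewrite !mxE.
have Rl (ij : 'I_p * 'I_q) : exists l, forall n, `|complex.Re (F n ij.1 ij.2) - l| <= B / (1 - th) * th ^+ n.
  by apply: geom_limit => // n; rewrite -dR (le_trans (normc_Re _)).
have Il (ij : 'I_p * 'I_q) : exists l, forall n, `|complex.Im (F n ij.1 ij.2) - l| <= B / (1 - th) * th ^+ n.
  by apply: geom_limit => // n; rewrite -dI (le_trans (normc_Im _)).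
have [lR HR] := choice Rl; have [lI HI] := choice Il.
exists (\matrix_(i, j) (lR (i, j) +i* lI (i, j))) => n; rewrite -mulrA; apply: mnorm_le => i j.
rewrite !mxE (le_trans (normc_le_ReIm _))// dR dI/=.
by have := HR (i, j) n; have := HI (i, j) n; rewrite /=; lra.
Qed.

Lemma geom_small (c th e : R) : 0 <= c -> 0 < th -> th < 1 -> 0 < e ->
  exists N, forall n, (N <= n)%N -> c * th ^+ n <= e.
Proof.
move=> c0 t0 t1 e0; have := @cvg_expr R th; rewrite ger0_norm ?(ltW t0)// => /(_ t1) ct.
have : (fun n => th ^+ n * c) @ \oo --> 0 * c by apply: cvgM => //; exact: cvg_cst.
rewrite mul0r => /cvgrPdist_lt/(_ _ e0)[N _ HN]; exists N => n nN.
have /= := HN n nN; rewrite sub0r normrN mulrC => /ltW; apply: le_trans; exact: ler_norm.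
Qed.

End GeometricLimits.

(** * Convergence of the iterated masks from a positive exponent *)

Section Convergence.
Context {R : realType}.
Local Notation C := R[i].
Variables (r : nat) (a : int -> 'M[C]_r) (A : nat).
Hypothesis r0 : (0 < r)%N.
Hypothesis sA : zsupp A a.
Hypothesis A0 : (0 < A)%N.
Variable w : 'cV[C]_r.
Hypothesis aw : symbol a 0 *m w = w.
Hypothesis w0 : w != 0.

Lemma zsupp_dirac : zsupp 0 (@diracI R r).
Proof. by move=> k k0; rewrite /diracI (_ : _ == _ = false) ?raddf0//; apply/negbTE; move: k0; lia. Qed.

Lemma yn_col p (U : int -> 'M[C]_(r, p)) K n k i : zsupp K U ->
  col i (yn a U n k) = yn a (fun m => col i (U m)) n k.
Proof.
move=> sU; have sc : zsupp K (fun m => col i (U m)) by move=> m /sU ->; rewrite col0.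
rewrite /yn (seq_convE _ _ sU) (seq_convE _ _ sc) linear_sum/=.
by apply: eq_bigr => l _; rewrite !colE mulmxA.
Qed.

Lemma decay_cols p (U : int -> 'M[C]_(r, p)) K : zsupp K U ->
  (forall i, decay a (fun m => col i (U m))) -> decay a U.
Proof.
move=> sU H.
have mE (M : 'M[C]_(r, p)) : mnorm M = \sum_i mnorm (col i M).
  rewrite /mnorm exchange_big/=; apply: eq_bigr => j _; apply: eq_bigr => i _.
  by rewrite big_ord1 mxE.
have {H} /choice[Bt H] i : exists Bt : R * R, [/\ 0 <= Bt.1, 0 < Bt.2, Bt.2 < 1 &
    forall n k, mnorm (yn a (fun m => col i (U m)) n k) <= Bt.1 * Bt.2 ^+ n].
  by have [B [th hB]] := H i; exists (B, th).
(* The neutral value 1/2 keeps the common rate strictly between 0 and 1. *)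
pose th : R := \big[Num.max/2^-1]_i (Bt i).2.
have th_ge i : (Bt i).2 <= th by exact: le_bigmax.
have th0 : 0 < th.
  rewrite /th; elim/big_ind: _ => [|x y x0 y0|i _]; rewrite ?invr_gt0//; first by rewrite lt_max x0.
  by have [] := H i.
have th1 : th < 1.
  rewrite /th; elim/big_ind: _ => [|x y x0 y0|i _]; first by lra.
    by rewrite gt_max x0.
  by have [] := H i.
exists (\sum_i (Bt i).1), th; split=> //.
  by rewrite sumr_ge0// => i _; have [] := H i.
move=> n k; rewrite mE mulr_suml; apply: ler_sum => i _; rewrite (yn_col _ _ _ sU).
have [B0 t0 _ Hi] := H i; rewrite (le_trans (Hi n k))// ler_wpM2l//.
by apply: lerXn2r; rewrite ?nnegrE ?(ltW t0) ?(ltW th0).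
Qed.

Lemma symbol_Sn n : symbol (Sn a n) (0 : R) *m w = (2 ^+ n)%:C *: w.
Proof.
elim: n => [|n IH].
  rewrite (symbol0E zsupp_dirac) (@zsum_delta _ _ _ 0)//; last first.
    by move=> k k0; rewrite /diracI (negbTE k0) raddf0.
  by rewrite /diracI eqxx mul1mx scale1r.
rewrite /Sn iterS -/(Sn a n) (symbol_subdiv 0 sA (@Sn_supp _ _ _ _ sA n)) mulr0.
rewrite -scalemxAl -mulmxA aw IH scalerA; congr (_ *: _).
by rewrite exprS rmorphM/= rmorph_nat.
Qed.

Lemma yn_dirac n : yn a (@diracI R r) n = Sn a n.
Proof.
apply/funext => k; rewrite /yn (seq_convE _ _ zsupp_dirac) (@zsum_delta _ _ _ 0)//.
  by rewrite subr0 /diracI eqxx mulmx1.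
by move=> l l0; rewrite /diracI (negbTE l0) raddf0 mulmx0.
Qed.

(* If there were no sum rules, the iterated masks would tend to 0 uniformly, while
   their values, applied to w, add up to 2^n w over O(2^n) indices. *)
Lemma sr_gt0 : (0 < sm_mask a)%E -> (0 < sr a)%N.
Proof.
rewrite sm_mask_gt0 lt0n => H; apply/negP => /eqP s0; rewrite s0 in H.
have D : decay a (@diracI R r).
  apply: (decay_cols zsupp_dirac) => i; apply: (rho_decay sA H).
  split=> //; apply/fin_suppP; exists 0%N => k /zsupp_dirac ->; by rewrite col0.
have [B [th [B0 th0 th1 HB]]] := D.
have n0 : 0 < mnorm w by rewrite lt_neqAle mnorm_ge0 eq_sym mnorm_eq0 w0.
have bnd n : mnorm w <= ((A.*2.+1)%:R * B * mnorm w) * th ^+ n.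
  have p0 : 0 < 2 ^+ n :> R by rewrite exprn_gt0.
  have : mnorm (symbol (Sn a n) (0 : R) *m w) <= (2 ^ n * A).*2.+1%:R * (B * th ^+ n * mnorm w).
    rewrite (symbol0E (@Sn_supp _ _ _ _ sA n)) mulmx_suml (le_trans (mnorm_sum _ _ _))//.
    rewrite -sum_zr_const; apply: ler_sum => k _; rewrite (le_trans (mnormM _ _))//.
    by rewrite ler_wpM2r ?mnorm_ge0// -yn_dirac.
  rewrite symbol_Sn mnormZ normc_real gtr0_norm// => h.
  rewrite -(ler_pM2l p0) (le_trans h)//.
  have -> : 2 ^+ n * ((A.*2.+1)%:R * B * mnorm w * th ^+ n) = (2 ^ n * A.*2.+1)%:R * (B * th ^+ n * mnorm w).
    by rewrite natrM natrX; ring.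
  rewrite ler_wpM2r//; first by rewrite !mulr_ge0 ?mnorm_ge0 ?exprn_ge0// ltW.
  rewrite ler_nat; have : (0 < 2 ^ n)%N by rewrite expn_gt0.
  by rewrite mulnS -muln2 -mulnA -muln2; lia.
have c0 : 0 <= (A.*2.+1)%:R * B * mnorm w by rewrite !mulr_ge0// ltW.
pose c := (A.*2.+1)%:R * B * mnorm w; rewrite -/c in c0.
have e0 : 0 < mnorm w / 2 by rewrite divr_gt0.
have [N HN] := geom_small c0 th0 th1 e0.
by have := bnd N; have := HN N (leqnn _); rewrite -/c; lra.
Qed.

(* S_n(floor(2^n x)) is a Cauchy sequence, since the differences
   S_(n+1)(2k+g) - S_n(k) and S_n(k+1) - S_n(k) are values of yn u n for sequences
   u whose columns satisfy the moment condition of order 1. *)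
Lemma mask_limit : (0 < sm_mask a)%E ->
  exists Phi : R -> 'M[C]_r, [/\ forall i j, continuous (re (fun x => Phi x i j)) /\
      continuous (im (fun x => Phi x i j)),
    forall x, A%:R <= `|x| -> Phi x = 0 &
    forall e : R, 0 < e -> exists N, forall n, (N <= n)%N ->
      forall k : int, mnorm (Sn a n k - Phi (2 ^- n * k%:~R)) <= e].
Proof.
move=> H; have sr1 := sr_gt0 H; rewrite sm_mask_gt0 in H.
have hf := sr_filterP sA r0; set v := sr_filter a in hf H.
have [/fin_suppP[L sv] _ _ _] := hf.
have [_ hv] := (has_sum_rulesP sA _ sv).1 hf.
have D1 u : Vspace 1 v u -> decay a u.
  (* Induction on the distance d from the maximal order, where the hypothesis on [rho] applies. *)
  have D d : (d < sr a)%N -> forall u, Vspace (sr a - d) v u -> decay a u.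
    elim: d => [|d IH] ds; first by rewrite subn0; exact: (rho_decay sA H).
    apply: (decay_descent sA sv hv); [by rewrite subn_gt0|by rewrite ltn_subrL sr1|].
    by rewrite subnSK; [apply: IH; exact: ltnW|exact: ltnW].
  have := D (sr a).-1; rewrite prednK// leqnn => /(_ isT u).
  by rewrite -subn1 subKn.
pose V := \sum_(k <- zr L) v k.
have Dmx (U : int -> 'M[C]_r) : zsupp A.+1 U -> V *m (\sum_(l <- zr A.+1) U l) = 0 -> decay a U.
  move=> sU U0; apply: (decay_cols sU) => i; apply: D1.
  have sc : zsupp A.+1 (fun m => col i (U m)) by move=> m /sU ->; rewrite col0.
  apply/(Vspace1P sv sc); rewrite -/V -linear_sum/=.
  by rewrite colE mulmxA U0 mul0mx.
have sd : zsupp A.+1 (@diracI R r) by exact: zsuppW zsupp_dirac.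
have sumd : \sum_(l <- zr A.+1) @diracI R r l = 1%:M.
  by rewrite (@zsum_delta _ _ _ 0)// => k k0; rewrite /diracI (negbTE k0) raddf0.
have sumdN : \sum_(l <- zr A.+1) (-1) *: @diracI R r l = - 1%:M.
  by rewrite -scaler_sumr sumd scaleN1r.
have sT g : (`|g| <= 1)%N -> zsupp A.+1 (Tg a g (@diracI R r)).
  by move=> g1; apply: zsuppW (Tg_supp sA g1 zsupp_dirac); lia.
have TE g m : Tg a g (@diracI R r) m = 2%:R *: a (2 * m + g).
  rewrite /Tg (seq_convE _ _ zsupp_dirac) (@zsum_delta _ _ _ 0)//; first by rewrite subr0 /diracI eqxx mulmx1.
  by move=> k k0; rewrite /diracI (negbTE k0) raddf0 mulmx0.
(* The coset sequence of the Dirac sequence sums to [phase a A g], which fixes V, and the Dirac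
   sequence to the identity, so V annihilates the sum of the difference. *)
have DT g : (`|g| <= 1)%N -> decay a (fun m => Tg a g (@diracI R r) m + (-1) *: @diracI R r m).
  move=> g1; apply: Dmx.
    by move=> m mA; rewrite sT// sd// scaler0 addr0.
  rewrite big_split/=.
  have -> : \sum_(l <- zr A.+1) Tg a g (@diracI R r) l = phase a A g.
    by rewrite /phase scaler_sumr; apply: eq_bigr => l _; rewrite TE.
  rewrite sumdN mulmxDr mulmxN mulmx1.
  by rewrite (quadrature_phase sA hv g1 sr1) subrr.
have sd1 : zsupp A.+1 (fun m => @diracI R r (m + 1)).
  by move=> m mA; apply: zsupp_dirac; lia.
have DS : decay a (fun m => @diracI R r (m + 1) + (-1) *: @diracI R r m).
  apply: Dmx; first by move=> m mA; rewrite sd1// sd// scaler0 addr0.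
  rewrite big_split/= sumdN mulmxDr mulmxN mulmx1.
  rewrite (@zsum_delta _ _ _ (-1))//; first by rewrite addNr /diracI eqxx mulmx1 subrr.
  by move=> k k0; rewrite /diracI (_ : _ == _ = false) ?raddf0// -[1]opprK subr_eq0; exact: negbTE.
have [B0 [t0 [B00 t00 t01 H0]]] := DT 0 isT.
have [B1 [t1 [B10 t10 t11 H1]]] := DT 1 isT.
have [B2 [t2 [B20 t20 t21 H2]]] := DS.
pose th := Num.max t0 (Num.max t1 t2); pose B := B0 + B1 + B2.
have t0t : t0 <= th by rewrite le_max lexx.
have t1t : t1 <= th by rewrite !le_max lexx orbT.
have t2t : t2 <= th by rewrite !le_max lexx !orbT.
have th0 : 0 < th by exact: lt_le_trans t0t.
have th1 : th < 1 by rewrite !gt_max t01 t11.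
have B_ge0 : 0 <= B by rewrite /B !addr_ge0.
have weak (b t : R) n : 0 <= b -> b <= B -> 0 < t -> t <= th -> b * t ^+ n <= B * th ^+ n.
  move=> b0 bB tt0 tth; apply: ler_pM => //; first by rewrite exprn_ge0// ltW.
  by apply: lerXn2r; rewrite ?nnegrE ?(ltW tt0) ?(ltW th0).
have hT n k g : g = 0 \/ g = 1 -> mnorm (Sn a n.+1 (2 * k + g) - Sn a n k) <= B * th ^+ n.
  move=> g01; have g1 : (`|g| <= 1)%N by case: g01 => ->.
  have -> : Sn a n.+1 (2 * k + g) - Sn a n k = yn a (fun m => Tg a g (@diracI R r) m + (-1) *: @diracI R r m) n k.
    rewrite (yn_lin _ _ _ _ (sT g g1) sd) scaleN1r yn_dirac -(ynS sA _ _ zsupp_dirac g1).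
    by rewrite yn_dirac.
  case: g01 => ->.
    by rewrite (le_trans (H0 n k))// weak// /B; lra.
  by rewrite (le_trans (H1 n k))// weak// /B; lra.
have hE n k : mnorm (Sn a n (k + 1) - Sn a n k) <= B * th ^+ n.
  have -> : Sn a n (k + 1) - Sn a n k = yn a (fun m => @diracI R r (m + 1) + (-1) *: @diracI R r m) n k.
    rewrite (yn_lin _ _ _ _ sd1 sd) scaleN1r yn_dirac; congr (_ - _).
    rewrite /yn (seq_convE _ _ sd1) (@zsum_delta _ _ _ (-1))//; first by rewrite addNr opprK /diracI eqxx mulmx1.
    by move=> l l0; rewrite /diracI (_ : _ == _ = false) ?raddf0 ?mulmx0// -[1]opprK subr_eq0; exact: negbTE.
  by rewrite (le_trans (H2 n k))// weak// /B; lra.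
pose F n (x : R) := Sn a n (Num.floor (2 ^+ n * x)).
have Fstep n x : mnorm (F n.+1 x - F n x) <= B * th ^+ n.
  rewrite /F; have [l Hl] := int_parity (Num.floor (2 ^+ n.+1 * x)).
  have /andP[f1 f2] := floor_itv (2 ^+ n.+1 * x).
  have [g [g01 fE]] : exists g, (g = 0 \/ g = 1) /\ Num.floor (2 ^+ n.+1 * x) = 2 * l + g.
    by case: Hl => E; [exists 0|exists 1]; split; [left| |right|].
  have -> : Num.floor (2 ^+ n * x) = l.
    apply: floor_def; move: f1 f2; rewrite fE exprS -mulrA !rmorphD rmorphM/=.
    by case: g01 => -> /=; lra.
  by rewrite fE; exact: hT.
have /choice[Phi HPhi] x := geom_limit_mx B_ge0 th0 th1 (Fstep^~ x).
set K := (r * r)%:R * (2 * (B / (1 - th))) in HPhi.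
have K0 : 0 <= K by rewrite !mulr_ge0// invr_ge0; lra.
(* At a level n with small error, points closer than 2^-n have floors that differ by at most 1,
   which [hE] controls. *)
have Phi_u (e : R) : 0 < e -> exists2 d : R, 0 < d & forall x y, `|x - y| < d -> mnorm (Phi x - Phi y) <= e.
  move=> e0; have c0 : 0 <= 2 * K + B by apply: addr_ge0 => //; exact: mulr_ge0 (ler0n _ 2) K0.
  have [n /(_ n (leqnn _)) Hn] := geom_small c0 th0 th1 e0.
  have p0 : 0 < 2 ^+ n :> R by rewrite exprn_gt0.
  exists (2 ^- n); first by rewrite invr_gt0.
  move=> x y xy; have FF : mnorm (F n x - F n y) <= B * th ^+ n.
    have Bt0 : 0 <= B * th ^+ n by rewrite mulr_ge0 ?exprn_ge0 ?(ltW th0).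
    have : `|2 ^+ n * x - 2 ^+ n * y| < 1.
      by rewrite -mulrBr normrM gtr0_norm// -[ltRHS](mulfV (lt0r_neq0 p0)) ltr_pM2l.
    rewrite /F; have := floor_itv (2 ^+ n * x); have := floor_itv (2 ^+ n * y).
    set i := Num.floor (2 ^+ n * x); set j := Num.floor (2 ^+ n * y).
    rewrite !rmorphD/= => /andP[j1 j2] /andP[i1 i2]; rewrite ltr_norml => /andP[h1 h2].
    have ij : (i < j + 2)%R by rewrite -(ltr_int R) rmorphD/=; lra.
    have ji : (j < i + 2)%R by rewrite -(ltr_int R) rmorphD/=; lra.
    have : i = j \/ i = j + 1 \/ j = i + 1 by move: ij ji; clear; lia.
    case=> [->|[->|->]]; [by rewrite subrr mnorm0|exact: hE|by rewrite mnormB; exact: hE].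
  have -> : Phi x - Phi y = (Phi x - F n x) + ((F n x - F n y) + (F n y - Phi y)).
    by rewrite !subrKA.
  apply: le_trans (mnormD _ _) _; rewrite mnormB.
  have := mnormD (F n x - F n y) (F n y - Phi y).
  by have := HPhi x n; have := HPhi y n; move: FF Hn; lra.
exists Phi; split.
- move=> i j; have L1 (T : C -> R) : (forall z, `|T z| <= normc z) -> (forall z z', T (z - z') = T z - T z') ->
      continuous (fun x => T (Phi x i j)).
    move=> T1 T2 x; apply/ctsP => e e0; have e2 : 0 < e / 2 by rewrite divr_gt0.
    have [d d0 Hd] := Phi_u _ e2; exists d => // y xy.
    rewrite -T2 (le_lt_trans (T1 _))//; apply: (@le_lt_trans _ _ (e / 2)); last by lra.
    by apply: le_trans (Hd x y xy); have := le_mnorm (Phi x - Phi y) i j; rewrite !mxE.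
  split; [apply: (L1 (@complex.Re R)); [exact: normc_Re|by case=> ? ?; case]|].
  by apply: (L1 (@complex.Im R)); [exact: normc_Im|case=> ? ?; case].
- move=> x xA; have F0 n : F n x = 0.
    apply: (Sn_supp0 sA); have n2 : (0 < 2 ^ n)%N by rewrite expn_gt0.
    have lt : ((2 ^ n).-1 * A < 2 ^ n * A)%N by rewrite ltn_mul2r A0/= ltn_predL.
    apply: leq_trans lt _.
    have p0 : 0 < 2 ^+ n :> R by rewrite exprn_gt0.
    have [x0|x0] := leP 0 x.
      have : (2 ^ n * A)%:Z <= Num.floor (2 ^+ n * x).
        by rewrite floor_ge_int -pmulrn natrM natrX ler_pM2l// -(ger0_norm x0).
      by clear; lia.
    have /andP[f1 _] := floor_itv (2 ^+ n * x).
    have : Num.floor (2 ^+ n * x) <= - (2 ^ n * A)%:Z.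
      rewrite -(ler_int R) (le_trans f1)// rmorphN/= -pmulrn natrM natrX -mulrN ler_pM2l//.
      by rewrite lerNr -(ltr0_norm x0).
    by clear; lia.
  apply: (@mx_eq_lim _ _ _ _ _ 1) => e e0; have [n /(_ n (leqnn _)) Hn] := geom_small K0 th0 th1 e0.
  by rewrite mul1r mnormB -(F0 n) (le_trans (HPhi x n)).
- move=> e e0; have [N HN] := geom_small K0 th0 th1 e0; exists N => n nN k.
  rewrite (le_trans _ (HN n nN))//; have := HPhi (2 ^- n * k%:~R) n; rewrite /F.
  by rewrite mulrA mulfV ?mul1r ?expf_neq0 ?pnatr_eq0// intrKfloor.
Qed.

End Convergence.

(** * Smoothness of the limit functions *)

Section LocalSmoothness.
Context {R : realType}.
Local Notation C := R[i].
Local Notation isd f x d := (is_derive (x : R) (1 : R) (f : R -> R) (d : R)).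

Lemma isd_val (f : R -> R) (x d : R) : isd f x d -> 'D_1 f x = d.
Proof. by move=> h; rewrite derive_val. Qed.

Lemma isd_unique (f : R -> R) (x d d' : R) : isd f x d -> isd f x d' -> d = d'.
Proof. by move=> h1 h2; rewrite -(isd_val h1) -(isd_val h2). Qed.

(** Local versions agree where both are valid, and so do their derivatives; the j-th derivative at x
    is taken from the version on a ball of radius N(x) > |x|. *)
Lemma realCk_local m (f : R -> R) :
  (forall K : nat, exists h, realCk m h /\ forall x, `|x| < K%:R -> f x = h x) -> realCk m f.
Proof.
move=> /choice[h H].
have agree j K K' x : (j <= m)%N -> `|x| < K%:R -> `|x| < K'%:R ->
    derive1n j (h K) x = derive1n j (h K') x.
  elim: j x => [|j IH] x jm xK xK'.
    by rewrite !derive1n0 -(H K).2// -(H K').2.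
  have d1 := realCk_derive x (H K).1 jm; have d2 := realCk_derive x (H K').1 jm.
  pose s := Num.min (K%:R - `|x|) (K'%:R - `|x|).
  have s0 : 0 < s by rewrite lt_min !subr_gt0 xK.
  have d3 := @isd_near _ _ (derive1n j (h K')) x _ s s0 _ d1.
  apply: (isd_unique (d3 _) d2) => y; rewrite lt_min => /andP[y1 y2].
  have := ler_normD (y - x) x; rewrite subrK => yx.
  by apply: IH; rewrite ?(ltnW jm)//; [move: y1|move: y2]; lra.
pose N (x : R) := (Num.truncn `|x|).+1.
have Nx x : `|x| < (N x)%:R by exact: Num.Theory.truncnS_gt.
pose G j x := derive1n j (h (N x)) x.
have G0 : G 0%N = f by apply/funext => x; rewrite /G derive1n0 -(H (N x)).2.
have GE j x y : (j <= m)%N -> `|y - x| < (N x)%:R - `|x| -> derive1n j (h (N x)) y = G j y.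
  move=> jm yx; apply: agree => //; have := ler_normD (y - x) x; rewrite subrK; lra.
have s0 x : 0 < (N x)%:R - `|x| by rewrite subr_gt0.
rewrite -G0; apply: realCk_chain => [j x jm|x].
  apply: (@isd_near _ (derive1n j (h (N x))) _ _ _ _ (s0 x)); last exact: realCk_derive (H _).1 jm.
  by move=> y; apply: GE; exact: ltnW.
apply/ctsP => e e0.
have cN := realCk_cts (H (N x)).1 (leqnn m).
have [d d0 Hd] := (ctsP _ _).1 (cN x) e e0.
exists (Num.min d ((N x)%:R - `|x|)); first by rewrite lt_min d0 s0.
move=> y; rewrite lt_min => /andP[/Hd h1 h2].
by rewrite -(@GE m x y)// 1?distrC//.
Qed.

Lemma Ck_local m (f : R -> C) :
  (forall K : nat, exists h, Ck m h /\ forall x, `|x| < K%:R -> f x = h x) -> Ck m f.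
Proof.
move=> H; split; apply: realCk_local => K; have [h [[C1 C2] fh]] := H K.
  by exists (re h); split=> // x /fh; rewrite /re => ->.
by exists (im h); split=> // x /fh; rewrite /im => ->.
Qed.

Lemma Ck_scale m (c : C) (f : R -> C) : Ck m f -> Ck m (fun x => c * f x).
Proof.
move=> Cf; have [+ _] := @cderiven_sum R _ [:: tt] m (fun=> c) (fun=> f) 1 (fun=> 0) (fun=> Cf).
suff -> : (fun x : R => \sum_(i <- [:: tt]) c * f (1 * x + 0)) = (fun x => c * f x) by [].
by apply/funext => x; rewrite big_seq1 mul1r addr0.
Qed.

End LocalSmoothness.

Section LagrangeFromLimit.
Context {R : realType}.
Local Notation C := R[i].
Variables (r m : nat) (a : int -> 'M[C]_r) (A : nat).
Hypothesis sA : zsupp A a.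
Variable Phi : R -> 'M[C]_r.
Hypothesis CPhi : forall i j, Ck m (fun x => Phi x i j).
Hypothesis sPhi : forall x, A%:R <= `|x| -> Phi x = 0.
Hypothesis limS : forall e : R, 0 < e -> exists N, forall n, (N <= n)%N ->
  forall k : int, mnorm (Sn a n k - Phi (2 ^- n * k%:~R)) <= e.

(** The limit is a sum over all integers. Near a bounded set a fixed finite part of it suffices, but
    that part grows with the set; hence smoothness is checked locally. *)
Lemma limit_lagrange : lagrange_convergent m a.
Proof.
move=> w0; pose eta (l : 'I_r) x := (\sum_(k \in [set: int]) w0 k *m Phi (x - k%:~R)) 0 l.
have etaE (K : nat) x : `|x| <= K%:R ->
    \sum_(k \in [set: int]) w0 k *m Phi (x - k%:~R) = \sum_(k <- zr (K + A)) w0 k *m Phi (x - k%:~R).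
  move=> xK; apply: zsumE => k kA; rewrite sPhi ?mulmx0//.
  have kR : K%:R + A%:R <= `|k%:~R| :> R by rewrite -natrD -intr_norm -abszE ler_nat ltnW.
  by have := lerB_normD (k%:~R : R) (- x); rewrite normrN distrC; lra.
exists eta; split=> [l|K K0 l].
  apply: Ck_local => K.
  pose q := [seq (k, i) | k <- zr (K + A), i <- index_enum 'I_r].
  exists (fun x => \sum_(p <- q) w0 p.1 0 p.2 * Phi (1 * x + (- p.1%:~R)) p.2 l); split.
    have [+ _] := cderiven_sum q (fun p => w0 p.1 0 p.2) 1 (fun p => - p.1%:~R) (fun p => CPhi p.2 l).
    exact.
  move=> x /ltW xK; rewrite /eta (etaE _ _ xK) summxE big_allpairs_dep/=.
  by apply: eq_bigr => k _; rewrite mxE; apply: eq_bigr => i _; rewrite mul1r.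
apply/ecvg0P.
  move=> n; apply: (@le_trans _ _ (normc (iter n (subdiv a) w0 0 0 l - eta l (2%:R ^- n * 0%:~R)))%:E).
    by rewrite lee_fin normc_ge0.
  by apply: ereal_sup_ubound; exists 0 => //=; rewrite normr0 mulr_ge0 ?exprn_ge0// ltW.
move=> e e0; pose K' := (Num.truncn K).+1.
have KK' : K <= K'%:R by exact/ltW/Num.Theory.truncnS_gt.
have [N HN] := lim_iter sA limS w0 K' e0; exists N => n nN.
apply: ge_ereal_sup => _ [k /= kK <-]; rewrite lee_fin.
have p0 : 0 < 2 ^+ n :> R by rewrite exprn_gt0.
have kK' : `|k%:~R : R| <= 2 ^+ n * K'%:R by rewrite (le_trans kK)// ler_pM2l.
have xK : `|2 ^- n * k%:~R : R| <= K'%:R.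
  by rewrite normrM gtr0_norm ?invr_gt0// mulrC ler_pdivrMr// mulrC.
apply: le_trans (HN n nN k kK'); rewrite /eta (etaE _ _ xK).
by have := le_mnorm (iter n (subdiv a) w0 k - \sum_(k0 <- zr (K' + A)) w0 k0 *m Phi (2 ^- n * k%:~R - k0%:~R)) 0 l; rewrite !mxE.
Qed.

End LagrangeFromLimit.

(** * Smoothness of a continuous representative *)

Section RepresentativeSmoothness.
Context {R : realType}.
Local Notation C := R[i].
Local Notation mu := (@lebesgue_measure R).
Local Notation isd f x d := (is_derive (x : R) (1 : R) (f : R -> R) (d : R)).

Lemma bump_test (b : R -> R) (K : R) : smoothR b -> (forall x, K < `|x| -> b x = 0) ->
  test_function (fun x => (b x)%:C).
Proof.
move=> sb b0; split; first exact: smooth_real.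
apply: (@subclosed_compact _ _ `[- K, K]%classic).
- exact: closed_closure.
- exact: segment_compact.
have cl : closed (`[- K, K]%classic : set R) by exact: interval_closed.
rewrite [X in _ `<=` X](closure_id _).1//; apply: closureS => x /= bx.
rewrite in_itv/= -ler_norml leNgt; apply/negP => /b0 E; move/eqP: bx; apply; by rewrite E.
Qed.

Lemma ae_integral_eq (f g : R -> R) : measurable_fun [set: R] f -> measurable_fun [set: R] g ->
  {ae mu, forall x, f x = g x} -> Rintegral mu setT f = Rintegral mu setT g.
Proof.
move=> mf mg fg; rewrite /Rintegral; congr fine; apply: ae_eq_integral => //.
- exact/measurable_realfun.measurable_EFinP.
- exact/measurable_realfun.measurable_EFinP.
- apply: (@aeS R (fun x => f x = g x) (fun x => [set: R] x -> (f x)%:E = (g x)%:E) fg).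
  by move=> x -> .
Qed.

(** The Sobolev representative of f is of class C^m by [sobolev_realCk]. It is continuous, as is u,
    and both give the same integrals against test functions, so they coincide. *)
Lemma sobolev_Ck m (f u : R -> C) : (0 < m)%N -> Linfty f ->
  continuous (re u) -> continuous (im u) ->
  (forall (b : R -> R) (K : R), smoothR b -> (forall x, K < `|x| -> b x = 0) ->
     cintegral (fun x => f x * (b x)%:C) = cintegral (fun x => u x * (b x)%:C)) ->
  ((m%:R)%:E < sm_fun f)%E -> Ck m u.
Proof.
move=> m0 [Lr Li] cu1 cu2 fu /ereal_sup_gt[_ [n [tau [tau0 tau1 -> [g [g0f gL gAC gd] gLip]]]]].
rewrite lte_fin => mnt.
(* From m < n + tau and tau < 1; in the case m = n this also forces tau > 0, which [lip] uses. *)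
have mn : (m <= n)%N by rewrite -ltnS -(ltr_nat R) -natr1; lra.
have n0 : (0 < n)%N by exact: leq_trans mn.
have AC (T : C -> R) j : (forall z, `|T z| <= normc z) -> (forall z z', T (z - z') = T z - T z') ->
    (j < n)%N -> rAC (fun x => T (g j x)).
  move=> T1 T2 jn e e0; have [d d0 Hd] := gAC j jn e e0; exists d => // N x y xy dis sm.
  apply: le_lt_trans (Hd N x y xy dis sm); apply: ler_sum => i _; by rewrite -T2.
have lip (T : C -> R) : (forall z, `|T z| <= normc z) -> (forall z z', T (z - z') = T z - T z') ->
    m = n -> exists K tau : R, [/\ 0 < K, 0 < tau &
    forall t, {ae mu, forall x, `|T (g n x) - T (g n (x - t))| <= K * `|t| `^ tau}].
  move=> T1 T2 mE; have [K K0 HK] := gLip; exists K, tau; split=> //; first by move: mnt; rewrite mE; lra.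
  move=> t; have := HK t; rewrite /Linfty_norm unlock setT_mu_gt0.
  move=> /ess_sup_inf.ess_supP H.
  apply: (@aeS _ (fun x => (`|(normc (g n x - g n (x - t)))%:E| <= (K * `|t| `^ tau)%:E)%E) _ H) => x; rewrite /= lee_fin ger0_norm ?normc_ge0// => h.
  by rewrite -T2 (le_trans (T1 _)).
have dRe (x y : C) : complex.Re (x - y) = complex.Re x - complex.Re y by case: x; case: y.
have dIm (x y : C) : complex.Im (x - y) = complex.Im x - complex.Im y by case: x; case: y.
have gC1 : realCk m (re (g 0%N)).
  apply: (@sobolev_realCk _ n m (fun j => re (g j))) => //.
  - by move=> j; exact: AC (@normc_Re R) dRe.
  - move=> j jn; apply: (@aeS R _ (fun x => isd (re (g j)) x (re (g j.+1) x)) (gd j jn)).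
    by move=> x [].
  - exact: lip (@normc_Re R) dRe.
have gC2 : realCk m (im (g 0%N)).
  apply: (@sobolev_realCk _ n m (fun j => im (g j))) => //.
  - by move=> j; exact: AC (@normc_Im R) dIm.
  - move=> j jn; apply: (@aeS R _ (fun x => isd (im (g j)) x (im (g j.+1) x)) (gd j jn)).
    by move=> x [].
  - exact: lip (@normc_Im R) dIm.
have key (F G U : R -> R) : F \in Lfun mu +oo%E -> continuous G -> continuous U ->
    {ae mu, forall x, G x = F x} ->
    (forall (b : R -> R) (K : R), smoothR b -> (forall x, K < `|x| -> b x = 0) ->
      Rintegral mu setT (fun x => F x * b x) = Rintegral mu setT (fun x => U x * b x)) ->
    G = U.
  move=> FL cG cU GF FU; apply/funext => x; apply/eqP; rewrite -subr_eq0; apply/eqP.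
  apply: (@fundamental_lemma _ (fun x => G x - U x)) => [y|b sb [K bK]].
    by apply: cvgB; [exact: cG|exact: cU].
  have cb : continuous b by have [_] := sb 0%N.
  have nz (h : R -> R) y : K < `|y| -> h y * b y = 0 by move=> /bK ->; rewrite mulr0.
  have cM (h : R -> R) : continuous h -> continuous (fun y => h y * b y).
    by move=> ch y; apply: cvgM; [exact: ch|exact: cb].
  have -> : (fun y => (G y - U y) * b y) = (fun y => 1 * (G y * b y) + (-1) * (U y * b y)).
    by apply/funext => y; ring.
  rewrite Rintegral_lin; [|exact: cs_integrable (cM G cG) (nz G)|exact: cs_integrable (cM U cU) (nz U)].
  rewrite -(FU b K sb bK) (@ae_integral_eq (fun y => G y * b y) (fun y => F y * b y)).
  - by rewrite mul1r mulN1r subrr.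
  - by apply: measurable_realfun.continuous_measurable_fun; exact: cM.
  - apply: measurable_realfun.measurable_funM; last exact: measurable_realfun.continuous_measurable_fun.
    by move: FL => /andP[]; rewrite inE.
  - by apply: (@aeS R _ (fun y => G y * b y = F y * b y) GF) => y ->.
have reM (h : R -> C) (b : R -> R) : re (fun x => h x * (b x)%:C) = (fun x => re h x * b x).
  by apply/funext => x; rewrite /re cReM/= mulr0 subr0.
have imM (h : R -> C) (b : R -> R) : im (fun x => h x * (b x)%:C) = (fun x => im h x * b x).
  by apply/funext => x; rewrite /im cImM/= mulr0 add0r.
have E1 : re (g 0%N) = re u.
  apply: (key (re f)) => //; first exact: realCk_cts gC1 (leq0n _).
    by apply: (@aeS R _ (fun x => re (g 0%N) x = re f x) g0f) => x; rewrite /re => ->.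
  move=> b K sb bK; have /(congr1 (@complex.Re R)) := fu b K sb bK.
  by rewrite /cintegral/= !reM.
have E2 : im (g 0%N) = im u.
  apply: (key (im f)) => //; first exact: realCk_cts gC2 (leq0n _).
    by apply: (@aeS R _ (fun x => im (g 0%N) x = im f x) g0f) => x; rewrite /im => ->.
  move=> b K sb bK; have /(congr1 (@complex.Im R)) := fu b K sb bK.
  by rewrite /cintegral/= !imM.
by split; rewrite -?E1 -?E2.
Qed.

End RepresentativeSmoothness.

Theorem theorem8 (R : realType) (r m : nat) (a : int -> 'M[R[i]]_r)
    (phi : 'I_r -> (R -> R[i]) -> R[i])
    (hr : (0 < r)%N)
    (ha : fin_supp a)
    (hsimple : mup 1 (char_poly (symbol a 0)) = 1%N)
    (heig : forall k : nat, (0 < k)%N -> ~~ eigenvalue (symbol a 0) (2%:R ^+ k))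
    (hphi : forall l, compact_distribution (phi l))
    (hrefine : forall xi : R,
       fourier_vec phi (2%:R * xi) = symbol a xi *m fourier_vec phi xi)
    (hphi0 : fourier_vec phi 0 != 0) :
  lagrange_convergent m a <->
  (0 < sm_mask a)%E /\ sm_distr_gt phi m.
Proof.
have [A0 sA0] := (fin_suppP a).1 ha.
have {sA0} sA : zsupp A0.+1 a by exact: zsuppW sA0.
pose A := A0.+1; have Apos : (0 < A)%N by [].
have aw := fixed_right hrefine.
split=> [H|[H [f [frep fm]]]].
  have [Phi [CPhi sPhi limS]] := lagrange_limit sA H.
  (* The limit of the scheme is known to vanish only from A + 1 on, so one larger radius is used for
     both mask and limit. *)
  have sA' : zsupp A.+1 a by exact: zsuppW sA.
  have cPhi i j : continuous (re (fun x => Phi x i j)) /\ continuous (im (fun x => Phi x i j)).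
    have [C1 C2] := CPhi i j.
    by split; [exact: realCk_cts C1 (leq0n _)|exact: realCk_cts C2 (leq0n _)].
  split; last exact: (lim_sm_distr sA' (ltn0Sn _) hphi hrefine CPhi sPhi limS).
  exact: (lim_sm_mask hr sA' (ltn0Sn _) hsimple hphi hrefine hphi0 cPhi sPhi limS).
have [Phi [cPhi sPhi limS]] := mask_limit hr sA Apos aw hphi0 H.
apply: (limit_lagrange sA _ sPhi limS) => i j.
have [x0 [i0 v0]] := Phi_neq0 sA Apos hphi hrefine hphi0 cPhi sPhi limS.
set v := row i0 (Phi x0) in v0.
have va : v *m symbol a 0 = v.
  by apply: (phase_fixed sA) => g g1; exact: (row_phase sA cPhi sPhi limS).
pose c := v 0 j / (v *m fourier_vec phi 0) 0 0.
have -> : (fun x => Phi x i j) = (fun x => c * (Phi x *m fourier_vec phi 0) i 0).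
  apply/funext => x.
  have := Phi_row sA hsimple hrefine hphi0 cPhi sPhi limS i x v0 va.
  by move/rowP/(_ j); rewrite [LHS]mxE [RHS]mxE => ->; rewrite /c mulrC mulrA mulrAC.
apply: Ck_scale.
have [u1 u2 _] := rep_nice phi cPhi sPhi i.
(* For m = 0 the claim is continuity, which the uniform limit already has. *)
have [|mpos] := posnP m; first by move=> ->; split; split.
have [fL fr] := frep i.
apply: (sobolev_Ck mpos fL u1 u2) => [b K sb bK|]; last exact: sm_vec_lt.
have tb := bump_test sb bK.
by rewrite -(fr _ tb) (rep_smooth sA Apos hphi hrefine cPhi sPhi limS)//; have [] := tb.
Qed.
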